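(* Let $(X^{(n)}_t)_{t\ge0}$, $n\ge1$, be the sequence of continuous-time Markov chains on the finite set $V$ described in the context (irreducible, jump rates converging to limits that are not all zero, comparability condition in force), with time-scales $\theta^{(p)}_n$, sets $\mathscr V^{(p)}_j$, $\Delta_p$, measures $\pi^{(p)}_j$, absorption weights $\mathfrak a^{(p)}$ and transition probabilities $p^{(p)}_t$ as defined there. Set $\theta^{(0)}_n=1$ and $\theta^{(\mathfrak q+1)}_n=+\infty$ for all $n\ge 1$. Then: (a) For each $1\le p\le\mathfrak q+1$, each sequence $(\beta_n)_{n\ge1}$ of positive reals such that $\theta^{(p-1)}_n\prec\beta_n\prec\theta^{(p)}_n$, and each $x\in V$, $$\lim_{n\to\infty}p^{(n)}_{\beta_n}(x,\cdot)=\sum_{j\in S_p}\mathfrak a^{(p-1)}(x,j)\,\pi^{(p)}_j(\cdot).$$ (b) For each $1\le p\le\mathfrak q$, $t>0$, $x\in V$, $$\lim_{n\to\infty}p^{(n)}_{t\theta^{(p)}_n}(x,\cdot)=\sum_{j\in S_p}\omega^{(p)}_t(x,j)\,\pi^{(p)}_j(\cdot),\qquad \omega^{(p)}_t(x,j)=\sum_{k\in S_p}\mathfrak a^{(p-1)}(x,k)\,p^{(p)}_t(k,j).$$ (c) For all $1\le p\le\mathfrak q$, $x\in V$, $$\lim_{t\to0}\lim_{n\to\infty}p^{(n)}_{t\theta^{(p)}_n}(x,\cdot)=\sum_{j\in S_p}\mathfrak a^{(p-1)}(x,j)\,\pi^{(p)}_j(\cdot).$$ (d) For all $1\le p\le\mathfrak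 q$, $x\in V$, $$\lim_{t\to\infty}\lim_{n\to\infty}p^{(n)}_{t\theta^{(p)}_n}(x,\cdot)=\sum_{m\in S_{p+1}}\mathfrak a^{(p)}(x,m)\,\pi^{(p+1)}_m(\cdot).$$ Moreover, $\lim_{n\to\infty}\pi_n(\Delta_{\mathfrak q+1})=0$, and for all $x\in\mathscr V^{(\mathfrak q+1)}$ the limit $\lim_{n\to\infty}\pi_n(x)$ exists and belongs to $(0,1]$.
   Context: Setting. $G=(V,E)$ is a finite directed graph (edges are ordered pairs of distinct vertices). For each $n\ge1$, $(X^{(n)}_t)_{t\ge0}$ is an irreducible continuous-time Markov chain on $V$ with jump rates $R_n(x,y)>0$ for $(x,y)\in E$ and $R_n(x,y)=0$ otherwise; $\lambda_n(x)=\sum_yR_n(x,y)$ are the holding rates, $\pi_n$ the unique stationary probability measure, $\mathbf P^n_x$ the law of the chain started at $x$, and $p^{(n)}_t(x,y)=\mathbf P^n_x[X_t=y]$. Convergence of measures on $V$ is pointwise. For positive sequences, $\alpha_n\prec\beta_n$ means $\alpha_n/\beta_n\to0$ (with $\beta_n\prec+\infty$ always true). Assume $\mathbb R_0(x,y):=\lim_nR_n(x,y)\in[0,\infty)$ exists for all $(x,y)\in E$ and is positive for at least one edge. Two positive sequences are comparable if $\alpha_n\prec\beta_n$, or $\beta_n\prec\alpha_n$, or $\alpha_n/\beta_n\to a\in(0,\infty)$. Comparability condition: for every $m\ge1$, any two of the sequences $\big(\prod_{(x,y)\in E}R_n(x,y)^{k(x,y)}\big)_{n\ge1}$, with $k:E\to\{0,1,2,\dots\}$,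 $\sum_{(x,y)\in E}k(x,y)=m$, are comparable. For $\mathscr A\subset V$: $H_{\mathscr A}=\inf\{t>0:X^{(n)}_t\in\mathscr A\}$, $H^+_{\mathscr A}=\inf\{t>\tau_1:X^{(n)}_t\in\mathscr A\}$, $\tau_1$ the first jump time, $\inf\varnothing=+\infty$. For disjoint non-empty $\mathscr A,\mathscr B$: $\mathrm{cap}_n(\mathscr A,\mathscr B)=\sum_{x\in\mathscr A}\pi_n(x)\lambda_n(x)\mathbf P^n_x[H_{\mathscr B}<H^+_{\mathscr A}]$. Recursive construction. Let $\mathbb X_t$ be the (possibly reducible) chain on $V$ with rates $\mathbb R_0$, $\mathbb Q_x$ its law from $x$, and $\mathscr V_1,\dots,\mathscr V_{\mathfrak n}$ its closed irreducible classes. Put $\mathfrak n_1=\mathfrak n$, $S_1=\{1,\dots,\mathfrak n\}$, $\mathscr V^{(1)}_j=\mathscr V_j$, $\mathscr V^{(1)}=\bigcup_j\mathscr V_j$, $\Delta_1=V\setminus\mathscr V^{(1)}$. If $\mathfrak n_1=1$, set $\mathfrak q=0$. Otherwise, given at level $p\ge1$ disjoint sets $\mathscr V^{(p)}_j$, $j\in S_p=\{1,\dots,\mathfrak n_p\}$, $\mathfrak n_p\ge2$, with $\mathscr V^{(p)}=\bigcup_j\mathscr V^{(p)}_j$ and $\Delta_p=V\setminus\mathscr V^{(p)}$, let $\breve{\mathscr V}^{(p)}_i=\bigcup_{j\in S_p\setminus\{i\}}\mathscr V^{(p)}_j$ and $$\frac1{\theta^{(p)}_n}=\sum_{i\in S_p}\frac{\mathrm{cap}_n(\mathscr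 V^{(p)}_i,\breve{\mathscr V}^{(p)}_i)}{\pi_n(\mathscr V^{(p)}_i)}.$$ The trace of $X^{(n)}_t$ on $\mathscr V^{(p)}$ has jump rates $R^{(p)}_n(x,y)=\lambda_n(x)\mathbf P^n_x[H_{\{y\}}=H^+_{\mathscr V^{(p)}}]$, $x\ne y\in\mathscr V^{(p)}$. Let $r^{(p)}_n(i,j)=\pi_n(\mathscr V^{(p)}_i)^{-1}\sum_{x\in\mathscr V^{(p)}_i}\pi_n(x)\sum_{y\in\mathscr V^{(p)}_j}R^{(p)}_n(x,y)$ and $r^{(p)}(i,j)=\lim_n\theta^{(p)}_nr^{(p)}_n(i,j)\in[0,\infty)$, $i\ne j$ (these limits are known to exist under the comparability condition, and not all vanish). Let $\mathbb X^{(p)}_t$ be the chain on $S_p$ with rates $r^{(p)}$, $p^{(p)}_t(i,j)$ its transition probabilities, $\mathfrak R^{(p)}_1,\dots,\mathfrak R^{(p)}_{\mathfrak n_{p+1}}$ its closed irreducible (recurrent) classes, $\mathfrak T_p$ its set of transient states. Put $S_{p+1}=\{1,\dots,\mathfrak n_{p+1}\}$, $\mathscr V^{(p+1)}_m=\bigcup_{j\in\mathfrak R^{(p)}_m}\mathscr V^{(p)}_j$, $\mathscr V^{(p+1)}=\bigcup_m\mathscr V^{(p+1)}_m$, $\Delta_{p+1}=\Delta_p\cup\bigcup_{j\in\mathfrak T_p}\mathscr V^{(p)}_j=V\setminus\mathscr V^{(p+1)}$. One has $\mathfrak n_{p+1}<\mathfrak n_p$. The construction stops at the first $p$ with $\mathfrak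 n_{p+1}=1$, and then $\mathfrak q:=p$. Measures. $\pi^{(1)}_j$ is the stationary probability measure of $\mathbb X_t$ restricted to $\mathscr V_j$. With $M^{(p)}_m$ the stationary probability measure of $\mathbb X^{(p)}_t$ restricted to $\mathfrak R^{(p)}_m$, $\pi^{(p+1)}_m=\sum_{j\in\mathfrak R^{(p)}_m}M^{(p)}_m(j)\,\pi^{(p)}_j$, $m\in S_{p+1}$, $1\le p\le\mathfrak q$. Absorption weights. $\mathfrak a^{(0)}(x,j)=\lim_{t\to\infty}\mathbb Q_x[\mathbb X_t\in\mathscr V_j]$, $x\in V$, $j\in S_1$. For $1\le p\le\mathfrak q$, $\mathfrak A^{(p)}(j,m)=\lim_{t\to\infty}\sum_{k\in\mathfrak R^{(p)}_m}p^{(p)}_t(j,k)$ and $\mathfrak a^{(p)}(x,m)=\sum_{j\in S_p}\mathfrak a^{(p-1)}(x,j)\,\mathfrak A^{(p)}(j,m)$, $m\in S_{p+1}$. *)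

(* Defs.v *)
From HB Require Import structures.
From mathcomp Require Import all_boot all_order all_algebra.
From mathcomp Require Import all_classical all_reals all_analysis.
Set Implicit Arguments.
Unset Strict Implicit.
Unset Printing Implicit Defensive.
Import Order.TTheory GRing.Theory Num.Theory.
Import numFieldNormedType.Exports.
Local Open Scope classical_set_scope.
Local Open Scope ring_scope.

Section Sequences.
Context (R : realType).

(* In [\bar R] one has [(+oo)^-1 = 0], hence [prec a (fun=> +oo)] always holds
   for real-valued [a]. *)
Definition prec (a b : nat -> \bar R) : Prop :=
  ((a n) / (b n))%E @[n --> \oo] --> 0%E.

Definition comparable_seq (a b : nat -> R) : Prop :=
  [\/ prec (EFin \o a) (EFin \o b), prec (EFin \o b) (EFin \o a) |
      exists c : R, 0 < c /\ (a n / b n) @[n --> \oo] --> c].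

End Sequences.

(* A jump-rate function on a finite type [T] is any [q : T -> T -> R]; its
   diagonal is never relevant. A chain on a subset [D] of [T] is encoded by
   rates on [T] that vanish outside [D * D]. *)
Section Rates.
Context (R : realType) (T : finType).
Implicit Types (q : T -> T -> R) (C D : {set T}).

Definition generator q (f : T -> R) (x : T) : R :=
  \sum_(y : T) q x y * (f y - f x).

(* [p_t(x, y) = (e^{tL} 1_{y})(x)], with [L = generator q]. *)
Definition transition q (t : R) (x y : T) : R :=
  limn (series (fun k =>
    exp_coeff t k * iter k (generator q) (fun z => (z == y)%:R) x)).

Definition reachable q : rel T := connect [rel x y | 0 < q x y].

Definition irreducible q : Prop := forall x y, reachable q x y.

Definition closed_irreducible q C : bool :=
  [&& C != finset.set0,
      [forall x in C, forall y, (0 < q x y) ==> (y \in C)] &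
      [forall x in C, forall y in C, reachable q x y]].

Definition closed_classes q D : {set {set T}} :=
  [set C : {set T} | (C \subset D) && closed_irreducible q C]%SET.

Record stationary q C (mu : T -> R) : Prop := Stationary {
  stationary_ge0 : forall x, 0 <= mu x;
  stationary_supp : forall x, x \notin C -> mu x = 0;
  stationary_sum1 : \sum_(x : T) mu x = 1;
  stationary_inv : forall t y, 0 <= t ->
    \sum_(x : T) mu x * transition q t x y = mu y }.

(* The stationary probability measure of the chain restricted to the closed
   irreducible class [C], extended by [0] to [T]. *)
Definition stationary_measure q C : T -> R :=
  xget (fun=> 0) [set mu | stationary q C mu].

End Rates.

(* The laws [P_x], [x : V], are carried by one measurable space and one family
   of random variables, as on the canonical path space; only the restriction of
   [traj] to nonnegative times is meaningful. *)
Record markov_chain (R : realType) (V : finType) := MarkovChain {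
  rate : V -> V -> R;
  sample_disp : measure_display;
  sample : measurableType sample_disp;
  traj : R -> sample -> V;
  law : V -> probability sample R;
  traj_measurable : forall t y, 0 <= t -> measurable [set w | traj t w = y];
  traj_right_continuous : forall w t, 0 <= t ->
    \forall s \near t^'+, traj s w = traj t w;
  traj_markov : forall (k : nat) (t : nat -> R) (y : nat -> V),
    t 0%N = 0 -> {homo t : i j / (i <= j)%N >-> i <= j} ->
    law (y 0%N) [set w | forall i, (i <= k)%N -> traj (t i) w = y i] =
      (\prod_(i < k) transition rate (t i.+1 - t i) (y i) (y i.+1))%:E }.

Section Chain.
Context (R : realType) (V : finType) (X : markov_chain R V).
Implicit Types (A B : {set V}) (w : sample X).

Definition holding_rate (x : V) : R := \sum_(y : V) rate X x y.

Definition inv_measure : V -> R := stationary_measure (rate X) [set: V]%SET.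

Definition inv_mass A : R := \sum_(x in A) inv_measure x.

Definition ptrans (t : R) (x y : V) : R :=
  fine (law X x [set w | traj t w = y]).

Definition hitting A w : \bar R :=
  ereal_inf [set t%:E | t in [set t : R | 0 < t /\ traj t w \in A]].

Definition first_jump w : \bar R :=
  ereal_inf [set t%:E | t in [set t : R | 0 < t /\ traj t w <> traj 0 w]].

Definition return_time A w : \bar R :=
  ereal_inf [set t%:E | t in
    [set t : R | (first_jump w < t%:E)%E /\ traj t w \in A]].

Definition capacity A B : R :=
  \sum_(x in A) inv_measure x * holding_rate x *
    fine (law X x [set w | (hitting B w < return_time A w)%E]).

Definition trace_rate A (x y : V) : R :=
  holding_rate x *
    fine (law X x [set w | hitting [set y]%SET w = return_time A w]).

End Chain.

(* The index set [S_p] is the family [wells X p] of the sets [V^(p)_j]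
   themselves: an index [j] and the set [V^(p)_j] are the same object. *)
Section Hierarchy.
Context (R : realType) (V : finType) (X : nat -> markov_chain R V).
Implicit Types (S : {set {set V}}) (i j m : {set V}) (p n : nat).

Definition limit_rate (x y : V) : R := limn (fun n => rate (X n) x y).

Definition partition_scale S n : R :=
  (\sum_(i in S)
     capacity (X n) i (finset.cover (S :\ i)) / inv_mass (X n) i)^-1.

Definition mean_rate S n i j : R :=
  (inv_mass (X n) i)^-1 *
    \sum_(x in i) inv_measure (X n) x *
      \sum_(y in j) trace_rate (X n) (finset.cover S) x y.

Definition reduced_rate S i j : R :=
  if [&& i \in S, j \in S & i != j]
  then limn (fun n => partition_scale S n * mean_rate S n i j) else 0.

Definition coarsen S : {set {set V}} :=
  [set finset.cover C | C in closed_classes (reduced_rate S) S]%SET.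

(* Levels start at [p = 1]; [wells 0 = wells 1] is not used. *)
Definition wells p : {set {set V}} :=
  iter p.-1 coarsen (closed_classes limit_rate [set: V]%SET).

Definition leftover p : {set V} := (~: finset.cover (wells p))%SET.

(* The first [p] with [#|wells p.+1| = 1], [p = 0] included. As [#|wells p|] is
   at most [#|V|] and decreases strictly while it exceeds [1], such a [p] is
   found below [#|V|]. *)
Definition depth : nat := find (fun p => #|wells p.+1| == 1%N) (iota 0 #|V|).

Definition time_scale p n : R := partition_scale (wells p) n.

(* [time_scale] with the conventions at the levels [0] and [depth.+1]. *)
Definition theta p n : \bar R :=
  if p == 0%N then 1%E
  else if (p <= depth)%N then (time_scale p n)%:E else +oo%E.

Definition level_trans p (t : R) i j : R :=
  transition (reduced_rate (wells p)) t i j.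

(* For [m] in [wells p.+1], the closed irreducible class of the chain on
   [wells p] whose union is [m]. *)
Definition members p m : {set {set V}} :=
  [set j in wells p | j \subset m]%SET.

Fixpoint level_measure p : {set V} -> V -> R :=
  match p with
  | 0 | 1 => stationary_measure limit_rate
  | p'.+1 => fun m x =>
      \sum_(j in members p' m)
        stationary_measure (reduced_rate (wells p')) (members p' m) j *
        level_measure p' j x
  end.

Definition level_absorption p j m : R :=
  lim ((\sum_(k in members p m) level_trans p t j k) @[t --> +oo]).

Fixpoint absorption p (x : V) : {set V} -> R :=
  match p with
  | 0 => fun j => lim ((\sum_(y in j) transition limit_rate t x y) @[t --> +oo])
  | p'.+1 => fun m =>
      \sum_(j in wells p) absorption p' x j * level_absorption p j m
  end.

Definition level_weight p (t : R) (x : V) j : R :=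
  \sum_(k in wells p) absorption p.-1 x k * level_trans p t k j.

Definition monomial (E : rel V) (k : V * V -> nat) n : R :=
  \prod_(e : V * V | E e.1 e.2) rate (X n) e.1 e.2 ^+ k e.

Definition comparability (E : rel V) : Prop :=
  forall (m : nat) (k l : V * V -> nat), (1 <= m)%N ->
    (\sum_(e : V * V | E e.1 e.2) k e)%N = m ->
    (\sum_(e : V * V | E e.1 e.2) l e)%N = m ->
    comparable_seq (monomial E k) (monomial E l).

End Hierarchy.

(* Main.v *)
(* Let [L] be the generator and [D] the union of the wells of a level. The
   potential of a well is the [L]-harmonic extension to [V] of its indicator
   on [D]; averaging [L] of the potentials over the wells gives the rates
   between wells, and the sum [c] of these rates is the inverse time scale of
   the level. Since the [pi_n]-weights inside a well are comparable, [L] of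
   each potential is [O(c)], so the potentials are almost constant along the
   semigroup at times [<< 1 / c]. Running the chain for a time between the
   previous scale [tm] and [1 / c] turns the potentials into functions [H_j]
   which converge to the absorption weights and satisfy
   [theta L H_j ~ sum_i H_i r(i, j)], up to an error killed by the mixing inside
   the wells. Duhamel's formula then compares the semigroup at time [t theta]
   with [exp (t r)], which is (b); (c) and (d) are its limits in [t]. The wells of the
   next level are the recurrent classes of [r]: their exit rate is [<< 1 / theta]
   by the maximum principle, and (d) shows that the chain has relaxed inside
   them, which is the input of the next step. The first step starts from
   singletons with [tm = 0].

   Rates between wells are sums of products of trace rates and ratios of
   stationary weights. By eliminating states one at a time these are quotients of
   sums of monomials in the rates, homogeneous of degree one, so that their
   fractions of the total rate converge under the comparability condition.

   Capacities and trace rates are expressed through harmonic extensions by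
   observing the path along the times [k h] and letting [h] tend to [0]. *)

Require Import Defs.
From mathcomp Require Import all_boot all_order all_algebra.
From mathcomp Require Import all_classical all_reals all_analysis.
From mathcomp Require Import ring lra zify.
Import Order.TTheory GRing.Theory Num.Theory.
Import numFieldNormedType.Exports.
Set Implicit Arguments.
Unset Strict Implicit.
Unset Printing Implicit Defensive.
Local Open Scope classical_set_scope.
Local Open Scope ring_scope.

(** * The semigroup of a generator *)

(** The potentials themselves do not satisfy an approximate equation
    [theta L pot_l = sum_j pot_j G j l]. Inside a well the left side depends on the point, and only
    its average against the limiting well measure converges. Applying the semigroup for an
    intermediate time replaces point values by these averages and commutes with [L], which is why
    smoothed potentials enter Duhamel's formula. The recursion step is stated for an arbitrary
    finite index type, so the passage from singletons (indexed by [V]) to the first wells and all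
    later passages (indexed by sets of states) are instances of one statement. Paths are known only
    through finite-dimensional laws and right-continuity. A hitting probability is therefore bounded
    from above only, by supersolutions for the skeleton chain. The complementary event receives a
    bound of the same kind, the two bounds add up to one, and ties are null, so both are equalities.
    In a limit in two parameters, the macroscopic time [T] is always fixed before [n] tends to
    infinity. *)

Lemma cvg_bigsum (R : realType) (U : Type) (F : set_system U) (FF : Filter F)
    (I : Type) (r : seq I) (P : pred I) (f : I -> U -> R) (l : I -> R) :
  (forall i, P i -> f i x @[x --> F] --> l i) ->
  \sum_(i <- r | P i) f i x @[x --> F] --> \sum_(i <- r | P i) l i.
Proof.
move=> fl; elim: r => [|i r IH].
  by rewrite big_nil (_ : (fun _ => _) = fun=> 0); [exact: cvg_cst|
     apply/funext => u; rewrite big_nil].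
rewrite big_cons (_ : (fun _ => _) = fun u => if P i then f i u + \sum_(j <- r | P j) f j u
   else \sum_(j <- r | P j) f j u); last by apply/funext => u; rewrite big_cons.
by case: ifPn => // Pi; apply: cvgD => //; exact: fl.
Qed.

Lemma is_derive_bigsum (R : realType) (I : Type) (r : seq I) (P : pred I)
    (f : I -> R -> R) (df : I -> R) (x : R) :
  (forall i, is_derive x (1 : R) (f i) (df i)) ->
  is_derive x (1 : R) (fun x => \sum_(i <- r | P i) f i x) (\sum_(i <- r | P i) df i).
Proof.
move=> fl; elim: r => [|i r IH].
  by rewrite big_nil (_ : (fun _ => _) = cst 0); [exact: is_derive_cst|
     apply/funext => u; rewrite big_nil].
rewrite big_cons (_ : (fun _ => _) = if P i then f i + (fun u => \sum_(j <- r | P j) f j u)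
   else (fun u => \sum_(j <- r | P j) f j u)); last first.
  by apply/funext => u; rewrite big_cons; case: ifP.
by case: ifPn => // Pi; exact: is_deriveD.
Qed.

Lemma is_derive_continuous (R : realType) (f df : R -> R) :
  (forall s : R, is_derive s (1 : R) f (df s)) -> continuous f.
Proof.
move=> fd s; apply: differentiable_continuous; apply/derivable1_diffP.
by have := fd s; case.
Qed.

Lemma mean_value_bound (R : realType) (f df : R -> R) (a b eta : R) :
  a <= b -> (forall s : R, is_derive s (1 : R) f (df s)) ->
  (forall s, a <= s <= b -> `|df s| <= eta) -> `|f b - f a| <= eta * (b - a).
Proof.
move=> ab fd fe.
have fc : {within `[a, b], continuous f}.
  by apply: continuous_subspaceT; exact: is_derive_continuous fd.
have [c cab ->] := @MVT_segment _ f df _ _ ab (fun x _ => fd x) fc.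
by rewrite normrM (ger0_norm (_ : 0 <= b - a)) ?subr_ge0// ler_wpM2r ?subr_ge0// fe.
Qed.

Section Semigroup.
Context (R : realType) (T : finType).
Implicit Types (q : T -> T -> R) (f : T -> R).

Lemma generator_sum q (I : finType) (P : pred I) (c : I -> R) (f : I -> T -> R) x :
  generator q (fun x => \sum_(i | P i) c i * f i x) x =
  \sum_(i | P i) c i * generator q (f i) x.
Proof.
rewrite /generator (eq_bigr (fun y => \sum_(i | P i) c i * (q x y * (f i y - f i x)))).
  by rewrite exchange_big/=; apply: eq_bigr => i _; rewrite mulr_sumr.
move=> y _; rewrite -sumrB mulr_sumr; apply: eq_bigr => i _.
by rewrite -mulrBr mulrCA.
Qed.

Lemma generatorB q f g x :
  generator q (fun x => f x - g x) x = generator q f x - generator q g x.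
Proof. by rewrite /generator -sumrB; apply: eq_bigr => y _; ring. Qed.

Lemma generatorD q f g x :
  generator q (fun x => f x + g x) x = generator q f x + generator q g x.
Proof. by rewrite /generator -big_split/=; apply: eq_bigr => y _; ring. Qed.

Lemma generatorZ q c f x :
  generator q (fun x => c * f x) x = c * generator q f x.
Proof. by rewrite /generator mulr_sumr; apply: eq_bigr => y _; ring. Qed.

Lemma generator_cst q (c : R) x : generator q (fun=> c) x = 0.
Proof. by rewrite /generator big1// => y _; rewrite subrr mulr0. Qed.

Lemma eq_generator q f g x : f =1 g -> generator q f x = generator q g x.
Proof. by move=> /funext ->. Qed.

Lemma sum_delta (f : T -> R) x : \sum_y f y * (x == y)%:R = f x.
Proof.
rewrite (bigD1 x)//= eqxx mulr1 big1 ?addr0// => y yx.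
by rewrite eq_sym (negbTE yx) mulr0.
Qed.

Definition shifted q c f x : R := generator q f x + c * f x.

Lemma shifted0 q : shifted q 0 = generator q.
Proof. by apply/funext => f; apply/funext => x; rewrite /shifted mul0r addr0. Qed.

Lemma iter_shifted_sum q d (I : finType) (c : I -> R) (f : I -> T -> R) k x :
  iter k (shifted q d) (fun x => \sum_i c i * f i x) x =
  \sum_i c i * iter k (shifted q d) (f i) x.
Proof.
elim: k x => [//|k IH] x; rewrite iterS {1}/shifted IH.
rewrite (eq_generator q x IH) (generator_sum q xpredT) mulr_sumr -big_split/=.
by apply: eq_bigr => i _; rewrite /shifted mulrDr (mulrCA d).
Qed.

Definition genbound q : R := \sum_x \sum_y 2 * `|q x y|.

Lemma genbound_ge0 q : 0 <= genbound q.
Proof. by apply: sumr_ge0 => x _; apply: sumr_ge0 => y _; rewrite mulr_ge0. Qed.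

Lemma generator_bound q f B : (forall x, `|f x| <= B) ->
  forall x, `|generator q f x| <= genbound q * B.
Proof.
move=> fB x; have B0 : 0 <= B by apply: le_trans (fB x).
rewrite (le_trans (ler_norm_sum _ _ _))//.
apply: (@le_trans _ _ (\sum_y 2 * `|q x y| * B)).
  apply: ler_sum => y _; rewrite normrM -mulrA mulrCA ler_wpM2l//.
  by rewrite (le_trans (ler_normB _ _))// mulr_natl mulr2n lerD.
rewrite -mulr_suml ler_wpM2r// /genbound [leRHS](bigD1 x)//= lerDl.
by apply: sumr_ge0 => z _; apply: sumr_ge0 => y _; rewrite mulr_ge0.
Qed.

Lemma iter_shifted_bound q c f B k : (forall x, `|f x| <= B) ->
  forall x, `|iter k (shifted q c) f x| <= (genbound q + `|c|) ^+ k * B.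
Proof.
move=> fB; elim: k => [|k IH] x; first by rewrite expr0 mul1r.
rewrite iterS exprS -mulrA mulrDl (le_trans (ler_normD _ _))// lerD//.
  exact: generator_bound.
by rewrite normrM ler_wpM2l.
Qed.

Lemma fin_bound f : exists2 B : R, 0 <= B & forall x, `|f x| <= B.
Proof.
exists (\sum_x `|f x|); first exact: sumr_ge0.
by move=> x; rewrite [leRHS](bigD1 x)//= lerDl sumr_ge0.
Qed.

Let coef q c f x k : R := iter k (shifted q c) f x / k`!%:R.

(* The exponential of [t (L + c)]; for large [c] all its terms are nonnegative,
   which gives the positivity of the case [c = 0]. *)
Definition shifted_semigroup q c (t : R) f x : R := limn (pseries (coef q c f x) t).

Definition semigroup q := shifted_semigroup q 0.

Lemma cvg_semigroup q c f x t : cvgn (pseries (coef q c f x) t).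
Proof.
have [B B0 fB] := fin_bound f.
pose G := genbound q + `|c|.
have G0 : 0 <= G by rewrite addr_ge0// genbound_ge0.
apply: normed_cvg; rewrite /normed_series_of /=.
apply: (@series_le_cvg _ _ (fun k => exp_coeff (G * `|t|) k * B)).
- by move=> k /=.
- by move=> k; rewrite mulr_ge0// exp_coeff_ge0// mulr_ge0// ?genbound_ge0.
- move=> k /=; rewrite /coef /exp_coeff /= normrM normrX normrM normfV.
  rewrite (@ger0_norm _ k`!%:R) ?ler0n//.
  rewrite exprMn; set u := iter k _ f x; set a := _ ^-1; set b := `|t| ^+ k.
  have -> : G ^+ k * b * a * B = (G ^+ k * B) * a * b by ring.
  by rewrite ler_wpM2r ?exprn_ge0// ler_wpM2r ?invr_ge0 ?ler0n// iter_shifted_bound.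
- rewrite (_ : (fun k => _) = B *: exp_coeff (G * `|t|)).
    exact: is_cvg_seriesZ (is_cvg_series_exp_coeff _).
  by apply/funext => k; rewrite mulrC.
Qed.

Lemma transitionE q t x y : transition q t x y = semigroup q t (fun z => (z == y)%:R) x.
Proof.
rewrite /transition /semigroup /shifted_semigroup /coef shifted0 /pseries /exp_coeff/=.
congr (limn (series _)); apply/funext => k; rewrite [LHS]mulrC /=; ring.
Qed.

Lemma semigroup_sum q t (I : finType) (c : I -> R) (f : I -> T -> R) x :
  semigroup q t (fun x => \sum_i c i * f i x) x = \sum_i c i * semigroup q t (f i) x.
Proof.
apply/cvg_lim => //.
rewrite (_ : pseries _ _ = fun n => \sum_i c i * pseries (coef q 0 (f i) x) t n); last first.
  apply/funext => n; rewrite /pseries /series/=.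
  under [RHS]eq_bigr do rewrite mulr_sumr.
  rewrite exchange_big/=; apply: eq_bigr => k _.
  rewrite /coef iter_shifted_sum !mulr_suml; apply: eq_bigr => i _; ring.
apply: cvg_bigsum => i _; apply: cvgM; [exact: cvg_cst|exact: cvg_semigroup].
Qed.

Lemma semigroupE q t f x : semigroup q t f x = \sum_y transition q t x y * f y.
Proof.
have -> : f = (fun x => \sum_y f y * (x == y)%:R).
  by apply/funext => z; rewrite sum_delta.
rewrite semigroup_sum; apply: eq_bigr => y _.
by rewrite -transitionE mulrC sum_delta.
Qed.

(** Differentiating the power series shifts its coefficients by one, and the shifted coefficients
    are those of [shifted q c f]. *)
Lemma is_derive_shifted q c f x t :
  is_derive t (1 : R) (fun t => shifted_semigroup q c t f x)
    (shifted_semigroup q c t (shifted q c f) x).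
Proof.
have d g : pseries_diffs (coef q c g x) = coef q c (shifted q c g) x.
  apply/funext => k; rewrite /pseries_diffs /coef iterSr factS natrM invfM.
  by rewrite mulrCA mulVKf// mulrC.
rewrite /shifted_semigroup -d.
apply: (@pseries_snd_diffs _ _ (`|t| + 1)).
- exact: cvg_semigroup.
- by rewrite d; exact: cvg_semigroup.
- by rewrite !d; exact: cvg_semigroup.
- by rewrite (@ger0_norm _ (_ + _)) ?addr_ge0// ltrDl.
Qed.

Lemma is_derive_semigroup q f x t :
  is_derive t (1 : R) (fun t => semigroup q t f x) (semigroup q t (generator q f) x).
Proof. by rewrite -shifted0; exact: is_derive_shifted. Qed.

Lemma shifted_semigroup0 q c f x : shifted_semigroup q c 0 f x = f x.
Proof.
apply/cvg_lim => //; rewrite -(cvg_shiftn 1)/=.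
rewrite (_ : (fun n => _) = fun=> f x); first exact: cvg_cst.
apply/funext => n; rewrite addn1 /pseries /series/= big_nat_recl// /coef /= fact0 divr1 expr0 mulr1.
by rewrite big1 ?addr0// => k _; rewrite expr0n mulr0.
Qed.

Lemma semigroup0 q f x : semigroup q 0 f x = f x.
Proof. exact: shifted_semigroup0. Qed.

Lemma shifted_shifted_semigroup q c f x t :
  shifted q c (shifted_semigroup q c t f) x = shifted_semigroup q c t (shifted q c f) x.
Proof.
apply/esym/cvg_lim => //.
rewrite (_ : pseries _ _ =
   fun n => \sum_y q x y * (pseries (coef q c f y) t n - pseries (coef q c f x) t n)
     + c * pseries (coef q c f x) t n).
  apply: cvgD.
    apply: cvg_bigsum => y _; apply: cvgM; first exact: cvg_cst.
    by apply: cvgB; exact: cvg_semigroup.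
  by apply: cvgM; [exact: cvg_cst|exact: cvg_semigroup].
apply/funext => n; rewrite /pseries /series/=.
under [in X in _ = X + _]eq_bigr do rewrite -sumrB mulr_sumr.
rewrite exchange_big/= mulr_sumr -big_split/=; apply: eq_bigr => k _.
rewrite /coef -iterSr /= /shifted /generator !(mulrDl, mulr_suml) -!mulrA.
congr (_ + _); apply: eq_bigr => y _; ring.
Qed.

Lemma generator_semigroup q f x t :
  generator q (semigroup q t f) x = semigroup q t (generator q f) x.
Proof. by rewrite -shifted0; exact: shifted_shifted_semigroup. Qed.

(** Once [c] dominates all exit rates, [shifted q c] has nonnegative entries, so every term of the
    series is a lower bound for its sum. The term of order 0 gives positivity, and the term whose
    order is the length of a path gives strict positivity. *)
Lemma shifted_semigroup_ge0 q c t f x :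
  (forall x y, 0 <= q x y) -> (forall x, \sum_y q x y <= c) -> 0 <= t ->
  (forall x, 0 <= f x) -> forall k,
  t ^+ k * iter k (shifted q c) f x / k`!%:R <= shifted_semigroup q c t f x /\
  0 <= iter k (shifted q c) f x.
Proof.
move=> q0 qc t0 f0 k.
have it0 m z : 0 <= iter m (shifted q c) f z.
  elim: m z => [//|m IH] z; rewrite iterS /shifted /generator.
  under eq_bigr do rewrite mulrBr.
  rewrite sumrB -mulr_suml -addrA -mulNr -mulrDl addr_ge0 ?mulr_ge0//.
    by apply: sumr_ge0 => y _; rewrite mulr_ge0.
  by rewrite addrC subr_ge0.
split=> //.
have term0 m : 0 <= coef q c f x m * t ^+ m.
  by rewrite mulr_ge0 ?exprn_ge0// divr_ge0.
apply: limr_ge; first exact: cvg_semigroup.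
exists k.+1 => //= n kn; rewrite /pseries /series /=.
rewrite (bigD1_seq k)/= ?mem_index_iota ?iota_uniq//.
rewrite (_ : _ / _ = coef q c f x k * t ^+ k); last by rewrite /coef; ring.
by rewrite lerDl sumr_ge0// => m _; exact: term0.
Qed.

Lemma is_derive_transition q x y t :
  is_derive t (1 : R) (fun t => transition q t x y)
    (semigroup q t (generator q (fun z => (z == y)%:R)) x).
Proof.
rewrite (_ : (fun t => _) = fun t => semigroup q t (fun z => (z == y)%:R) x).
  exact: is_derive_semigroup.
by apply/funext => s; rewrite transitionE.
Qed.

Lemma is_derive_duhamel q (t s : R) (f df : R -> T -> R) x :
  (forall s z, is_derive s (1 : R) (fun s => f s z) (df s z)) ->
  is_derive s (1 : R) (fun s => semigroup q (t - s) (f s) x)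
    (semigroup q (t - s) (fun z => df s z - generator q (f s) z) x).
Proof.
move=> fd.
rewrite (_ : (fun s => _) = fun s => \sum_y f s y * transition q (t - s) x y); last first.
  by apply/funext => u; rewrite semigroupE; apply: eq_bigr => y _; rewrite mulrC.
pose D y := semigroup q (t - s) (generator q (fun z => (z == y)%:R)) x.
rewrite (_ : semigroup _ _ _ _ = \sum_y (f s y *: (- D y) + transition q (t - s) x y *: df s y)).
  apply: is_derive_bigsum => y; apply: is_deriveM.
  have := is_derive_transition q x y (t - s) => h.
  have h2 : is_derive s (1 : R) (fun s => t - s) (-1).
    rewrite -[-1]sub0r; apply: is_deriveB.
  have := @is_derive1_comp _ (fun t => transition q t x y) (fun s => t - s) s _ _ h h2.
  by rewrite mulrN1.
rewrite big_split/= (_ : \sum_y f s y *: - D y = - semigroup q (t - s) (generator q (f s)) x).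
  rewrite !semigroupE -sumrN -big_split/=; apply: eq_bigr => y _.
  by rewrite mulrBr addrC.
rewrite (_ : generator q (f s) = fun z => \sum_y f s y * generator q (fun z => (z == y)%:R) z).
  by rewrite semigroup_sum -sumrN; apply: eq_bigr => y _; rewrite scalerN.
apply/funext => z; rewrite -(generator_sum q xpredT).
by apply: eq_generator => u; rewrite sum_delta.
Qed.

(** Along a solution of the backward equation, the semigroup at time [t - s] applied to [f s] has
    zero derivative in [s]. The semigroup law, the conservation of constants and the formula with
    the shift all follow from this. *)
Lemma semigroup_unique q (t : R) (f : R -> T -> R) x :
  (forall s z, is_derive s (1 : R) (fun s => f s z) (generator q (f s) z)) ->
  f t x = semigroup q t (f 0) x.
Proof.
move=> fd; rewrite -(semigroup0 q (f t) x) -[in LHS](subrr t) -[in RHS](subr0 t).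
apply: (@is_derive_0_is_cst _ (fun s => semigroup q (t - s) (f s) x)) => s.
have := is_derive_duhamel q t s x fd.
rewrite (_ : semigroup _ _ _ _ = 0)//.
by rewrite semigroupE big1// => y _; rewrite subrr mulr0.
Qed.

Lemma semigroupD q s t f x :
  semigroup q (t + s) f x = semigroup q t (semigroup q s f) x.
Proof.
rewrite -{2}[s]add0r.
apply: (@semigroup_unique q t (fun t => semigroup q (t + s) f)) => u z.
rewrite generator_semigroup.
have h := is_derive_semigroup q f z (u + s).
have h2 : is_derive u (1 : R) (fun u => u + s) 1.
  by rewrite -[1 in X in is_derive _ _ _ X]addr0; apply: is_deriveD.
by have := @is_derive1_comp _ (fun t => semigroup q t f z) (fun u => u + s) u _ _ h h2;
  rewrite mulr1.
Qed.

Lemma semigroup_cst q t (c : R) x : semigroup q t (fun=> c) x = c.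
Proof.
apply/esym; apply: (@semigroup_unique q t (fun _ _ => c) x) => s z.
by rewrite generator_cst; exact: is_derive_cst.
Qed.

Lemma transition_sum1 q t x : \sum_y transition q t x y = 1.
Proof.
rewrite -(semigroup_cst q t 1 x) semigroupE; apply: eq_bigr => y _.
by rewrite mulr1.
Qed.

Lemma transitionD q s t x y :
  transition q (t + s) x y = \sum_z transition q t x z * transition q s z y.
Proof.
rewrite transitionE semigroupD semigroupE; apply: eq_bigr => z _.
by rewrite -transitionE.
Qed.

Lemma transition0 q x y : transition q 0 x y = (x == y)%:R.
Proof. by rewrite transitionE semigroup0. Qed.

Lemma semigroup_shiftedE q c t f x :
  semigroup q t f x = expR (- c * t) * shifted_semigroup q c t f x.
Proof.
pose g (t : R) x := expR (- c * t) * shifted_semigroup q c t f x.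
have g0 : g 0 = f.
  by apply/funext => z; rewrite /g mulr0 expR0 mul1r shifted_semigroup0.
rewrite -/(g t x) -g0; apply/esym; apply: (@semigroup_unique q t g x) => s z.
rewrite /g generatorZ.
have h1 : is_derive s (1 : R) (fun t => expR (- c * t)) (- c * expR (- c * s)).
  have h : is_derive s (1 : R) (fun t => - c * t) (- c).
    by rewrite -[X in is_derive _ _ _ X]mulr1; apply: is_deriveZ.
  have := @is_derive1_comp _ expR (fun t => - c * t) s _ _ (is_derive_expR _) h.
  by rewrite mulrC.
have h2 := is_derive_shifted q c f z s.
have := @is_deriveM _ _ (fun t => expR (- c * t)) (fun t => shifted_semigroup q c t f z) s 1 _ _ h1 h2.
rewrite -shifted_shifted_semigroup /shifted.
congr (is_derive _ _ _ _); rewrite /GRing.scale/=; ring.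
Qed.

Section Positive.
Context (q : T -> T -> R) (q_ge0 : forall x y, 0 <= q x y).

Let c : R := \sum_x \sum_y q x y + 1.

Let c_ge x : \sum_y q x y <= c.
Proof.
rewrite /c -[leLHS]addr0 lerD// [leRHS](bigD1 x)//= lerDl sumr_ge0// => z _.
exact: sumr_ge0.
Qed.

Lemma semigroup_ge0 t f x : 0 <= t -> (forall x, 0 <= f x) -> 0 <= semigroup q t f x.
Proof.
move=> t0 f0; rewrite (semigroup_shiftedE _ c) mulr_ge0 ?expR_ge0//.
have [+ _] := shifted_semigroup_ge0 x q_ge0 c_ge t0 f0 0.
by rewrite expr0 mul1r fact0 divr1; apply: le_trans.
Qed.

Lemma transition_ge0 t x y : 0 <= t -> 0 <= transition q t x y.
Proof. by move=> t0; rewrite transitionE semigroup_ge0. Qed.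

Lemma transition_le1 t x y : 0 <= t -> transition q t x y <= 1.
Proof.
move=> t0; rewrite -(transition_sum1 q t x) [leRHS](bigD1 y)//= lerDl sumr_ge0//.
by move=> z _; exact: transition_ge0.
Qed.

Lemma semigroup_le t f g x : 0 <= t -> (forall x, f x <= g x) ->
  semigroup q t f x <= semigroup q t g x.
Proof.
move=> t0 fg; rewrite !semigroupE ler_sum// => y _.
by rewrite ler_wpM2l// transition_ge0.
Qed.

Lemma semigroup_norm t f B x : 0 <= t -> (forall x, `|f x| <= B) ->
  `|semigroup q t f x| <= B.
Proof.
move=> t0 fB; rewrite ler_norml; apply/andP; split.
  rewrite -[leLHS](semigroup_cst q t (- B) x) semigroup_le// => z.
  by have := fB z; rewrite ler_norml => /andP[].
rewrite -[leRHS](semigroup_cst q t B x) semigroup_le// => z.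
by have := fB z; rewrite ler_norml => /andP[].
Qed.

(** The series term whose order is the length of a path from [x] to [y] is positive, by following
    that path. *)
Lemma transition_gt0 t x y : 0 < t -> reachable q x y -> 0 < transition q t x y.
Proof.
move=> t0 /connectP[p pth ->]; rewrite transitionE (semigroup_shiftedE _ c).
rewrite mulr_gt0 ?expR_gt0//.
set z := last x p.
have f0 u : 0 <= (u == z)%:R :> R by rewrite ler0n.
have [+ _] := shifted_semigroup_ge0 x q_ge0 c_ge (ltW t0) f0 (size p).
apply: lt_le_trans; rewrite divr_gt0 ?ltr0n ?fact_gt0// mulr_gt0 ?exprn_gt0//.
rewrite /z {f0 z}; elim: p x pth => [|u p IH] x /=; first by rewrite eqxx.
move=> /andP[xu pu]; set f := fun z => _.
have f0 z : 0 <= f z by rewrite ler0n.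
have it0 z : 0 <= iter (size p) (shifted q c) f z.
  by have [] := shifted_semigroup_ge0 z q_ge0 c_ge (ltW t0) f0 (size p).
rewrite /shifted /generator; under eq_bigr do rewrite mulrBr.
rewrite sumrB -mulr_suml -addrA -mulNr -mulrDl addrC ltr_wpDl//.
  by rewrite mulr_ge0// addrC subr_ge0.
rewrite (bigD1 u)//= ltr_pwDl//; last by apply: sumr_ge0 => v _; rewrite mulr_ge0.
by rewrite mulr_gt0//; exact: IH.
Qed.

(** The semigroup contracts the sup norm, so a residual of size [eta] in the backward equation
    accumulates at rate at most [eta]. *)
Lemma duhamel_bound (t eta : R) (f df : R -> T -> R) x : 0 <= t ->
  (forall s z, is_derive s (1 : R) (fun s => f s z) (df s z)) ->
  (forall s z, 0 <= s <= t -> `|df s z - generator q (f s) z| <= eta) ->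
  `|f t x - semigroup q t (f 0) x| <= eta * t.
Proof.
move=> t0 fd fe.
pose g s := semigroup q (t - s) (f s) x.
have -> : f t x - semigroup q t (f 0) x = g t - g 0.
  by rewrite /g subrr subr0 semigroup0.
rewrite -[t in leRHS]subr0.
apply: (@mean_value_bound _ g
  (fun s => semigroup q (t - s) (fun z => df s z - generator q (f s) z) x)) => //.
  by move=> s; exact: is_derive_duhamel.
move=> s st; apply: semigroup_norm => [|z]; last exact: fe.
by rewrite subr_ge0; case/andP: st.
Qed.

Lemma semigroup_dist t f B x : 0 <= t -> (forall x, `|generator q f x| <= B) ->
  `|semigroup q t f x - f x| <= B * t.
Proof.
move=> t0 fB; rewrite -[f x in leLHS](semigroup0 q) -[t in leRHS]subr0.
apply: (@mean_value_bound _ (fun t => semigroup q t f x)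
  (fun t => semigroup q t (generator q f) x)) => //.
  by move=> s; exact: is_derive_semigroup.
by move=> s /andP[s0 _]; exact: semigroup_norm.
Qed.

Lemma semigroup_taylor t f B x : 0 <= t ->
  (forall x, `|generator q (generator q f) x| <= B) ->
  `|semigroup q t f x - f x - t * generator q f x| <= B * t ^+ 2.
Proof.
move=> t0 fB.
pose g s := semigroup q s f x - s * generator q f x.
have -> : semigroup q t f x - f x - t * generator q f x = g t - g 0.
  by rewrite /g semigroup0; ring.
rewrite expr2 mulrA -[X in _ <= _ * X]subr0.
apply: (@mean_value_bound _ g
  (fun s => semigroup q s (generator q f) x - generator q f x)) => //.
  move=> s; apply: is_deriveB; first exact: is_derive_semigroup.
  rewrite (_ : (fun s => _) = (fun s => generator q f x *: s)).
    by rewrite -[X in is_derive _ _ _ X]mulr1; apply: is_deriveZ.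
  by apply/funext => u; rewrite mulrC.
move=> s /andP[s0 st]; rewrite (le_trans (semigroup_dist _ s0 fB))// ler_wpM2l//.
by apply: le_trans (fB x).
Qed.

End Positive.

End Semigroup.

(** * Closed classes and stationary measures *)

(** Including 1 in the minimum covers an empty [P] and keeps [1 - e] nonnegative, so that it can
    serve as a contraction factor. *)
Lemma fin_lower (R : realType) (I : finType) (P : pred I) (f : I -> R) :
  (forall i, P i -> 0 < f i) -> exists2 e : R, 0 < e <= 1 & forall i, P i -> e <= f i.
Proof.
move=> f0; exists (\big[Num.min/1]_(i | P i) f i).
  apply/andP; split; last by elim/big_rec: _ => // i x Pi x1; rewrite ge_min x1 orbT.
  by elim/big_rec: _ => // i x Pi x1; rewrite lt_min f0.
by move=> i Pi; rewrite (bigD1 i)//= ge_min lexx.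
Qed.

Section ErgodicTheorem.
Context (R : realType) (T : finType).
Context (q : T -> T -> R) (q_ge0 : forall x y, 0 <= q x y).
Implicit Types (C D : {set T}) (f : T -> R).

Definition closed C := forall x y, x \in C -> 0 < q x y -> y \in C.

Lemma closed_rate0 C x y : closed C -> x \in C -> y \notin C -> q x y = 0.
Proof.
move=> Cc xC yC; apply/eqP/negP => /negP q0.
by move: yC; rewrite (Cc x)// lt_def q0 q_ge0.
Qed.

Lemma closed_generator0 C f x : closed C -> (forall x, x \in C -> f x = 0) ->
  x \in C -> generator q f x = 0.
Proof.
move=> Cc f0 xC; rewrite /generator big1// => y _.
have [yC|yC] := boolP (y \in C); first by rewrite !f0// subrr mulr0.
by rewrite (closed_rate0 Cc xC yC) mul0r.
Qed.

Lemma closed_transition0 C t x y : closed C -> x \in C -> y \notin C ->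
  transition q t x y = 0.
Proof.
move=> Cc xC yC; rewrite /transition.
rewrite (_ : series _ = cst 0); first exact: lim_cst.
apply/funext => n; rewrite /series/= big1// => k _.
suff -> : iter k (generator q) (fun z => (z == y)%:R) x = 0 by rewrite mulr0.
elim: k x xC => [|k IH] x xC /=; last exact: closed_generator0 xC.
by case: eqP => // xy; move: yC; rewrite -xy xC.
Qed.

Lemma closed_semigroupE C t f x : closed C -> x \in C ->
  semigroup q t f x = \sum_(y in C) transition q t x y * f y.
Proof.
move=> Cc xC; rewrite semigroupE [RHS]big_mkcond/=; apply: eq_bigr => y _.
by case: ifPn => // yC; rewrite (closed_transition0 _ Cc xC yC) mul0r.
Qed.

Lemma closed_transition_sum1 C t x : closed C -> x \in C ->
  \sum_(y in C) transition q t x y = 1.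
Proof.
move=> Cc xC; rewrite -(semigroup_cst q t 1 x) (closed_semigroupE _ _ Cc xC).
by apply: eq_bigr => y _; rewrite mulr1.
Qed.

Lemma closed_semigroup_le C t f g x : closed C -> x \in C -> 0 <= t ->
  (forall y, y \in C -> f y <= g y) -> semigroup q t f x <= semigroup q t g x.
Proof.
move=> Cc xC t0 fg; rewrite !(closed_semigroupE _ _ Cc xC) ler_sum// => y yC.
by rewrite ler_wpM2l ?fg// transition_ge0.
Qed.

Lemma closed_reachable C x y : closed C -> x \in C -> reachable q x y -> y \in C.
Proof.
move=> Cc + /connectP[p + ->]; elim: p x => [//|z p IH] x xC /= /andP[xz].
by apply: IH; exact: Cc xz.
Qed.

Lemma closed_irreducibleP C : reflect
  [/\ C != finset.set0, closed C & forall x y, x \in C -> y \in C -> reachable q x y]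
  (closed_irreducible q C).
Proof.
apply: (iffP and3P) => [[C0 /'forall_implyP Cc /'forall_implyP Cr]|[C0 Cc Cr]].
  split=> // [x y xC xy|x y xC yC].
    by have /forallP/(_ y)/implyP := Cc x xC; exact.
  by have /'forall_implyP := Cr x xC; apply.
split=> //; first by apply/'forall_implyP => x xC; apply/forallP => y; apply/implyP; exact: Cc.
by apply/'forall_implyP => x xC; apply/'forall_implyP => y; exact: Cr.
Qed.

Lemma closed_irreducibleE C x : closed_irreducible q C -> x \in C ->
  C = [set y | reachable q x y]%SET.
Proof.
move=> /closed_irreducibleP[_ Cc Cr] xC; apply/setP => y; rewrite inE.
by apply/idP/idP => [|/(closed_reachable Cc xC)//]; exact: Cr.
Qed.

(** Among the points reachable from [x], one with the fewest reachable points works: by minimality,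
    everything it reaches has the same reachable set. *)
Lemma reachable_class x : exists C, [/\ closed_irreducible q C &
  forall y, y \in C -> reachable q x y].
Proof.
pose rch y := [set z | reachable q y z]%SET.
have [y xy ymin] := @arg_minnP _ x (reachable q x) (fun y => #|rch y|) (connect0 _ _).
have sub z : reachable q y z -> rch z = rch y.
  move=> yz; apply/eqP; rewrite eqEcard ymin ?andbT.
    by apply/fintype.subsetP => u; rewrite !inE; exact: connect_trans.
  exact: connect_trans xy yz.
exists (rch y); split; last by move=> z; rewrite inE; exact: connect_trans.
apply/closed_irreducibleP; split.
- by apply/set0Pn; exists y; rewrite inE /reachable connect0.
- move=> u v; rewrite !inE => yu uv; apply: connect_trans yu _.
  exact: connect1.
- move=> u v; rewrite !inE => yu yv.
  by have := sub _ yu => /setP/(_ v); rewrite !inE yv.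
Qed.

Section Class.
Context (C : {set T}) (C_irr : closed_irreducible q C).

Let C_closed : closed C. Proof. by case/closed_irreducibleP: C_irr. Qed.

Lemma class_range t f m M x : 0 <= t -> x \in C ->
  (forall y, y \in C -> m <= f y <= M) -> m <= semigroup q t f x <= M.
Proof.
move=> t0 xC fmM; apply/andP; split.
  rewrite -[leLHS](semigroup_cst q t m x).
  by apply: closed_semigroup_le C_closed xC t0 _ => y /fmM/andP[].
rewrite -[leRHS](semigroup_cst q t M x).
by apply: closed_semigroup_le C_closed xC t0 _ => y /fmM/andP[].
Qed.

(* Doeblin's argument: on [C] the unit-time kernel dominates [e] times a fixed
   point mass, so each unit of time contracts the oscillation by [1 - e]. *)
Lemma class_contraction : exists2 e : R, 0 < e <= 1 &
  forall f m M, (forall y, y \in C -> m <= f y <= M) ->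
  exists m' M', M' - m' = (1 - e) * (M - m) /\
   forall x, x \in C -> m' <= semigroup q 1 f x <= M'.
Proof.
have [C0 _ Cr] := closed_irreducibleP _ C_irr.
have [y0 y0C] := set0Pn _ C0.
have [e e01 ep] := @fin_lower _ _ [pred x | x \in C] (fun x => transition q 1 x y0)
  (fun x xC => transition_gt0 q_ge0 ltr01 (Cr _ _ xC y0C)).
exists e => // f m M fmM.
exists (e * f y0 + (1 - e) * m), (e * f y0 + (1 - e) * M); split; first by ring.
move=> x xC; have /andP[mf fM] := fmM _ y0C.
have h1 := closed_transition_sum1 1 C_closed xC.
rewrite (closed_semigroupE _ _ C_closed xC).
rewrite (bigD1 y0)//= in h1; rewrite (bigD1 y0)//=.
have ex := ep x xC; move: h1 ex; set p := transition q 1 x y0 => h1 ex.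
set s := \sum_(i in C | i != y0) transition q 1 x i in h1.
have s1 : s = 1 - p by rewrite -h1 addrC addrK.
have lo : s * m <= \sum_(i in C | i != y0) transition q 1 x i * f i.
  rewrite /s mulr_suml ler_sum// => y /andP[/fmM/andP[my _] _].
  by rewrite ler_wpM2l// transition_ge0.
have up : \sum_(i in C | i != y0) transition q 1 x i * f i <= s * M.
  rewrite /s mulr_suml ler_sum// => y /andP[/fmM/andP[_ My] _].
  by rewrite ler_wpM2l// transition_ge0.
apply/andP; split.
  apply: le_trans (lerD (lexx _) lo); rewrite s1.
  rewrite -subr_ge0 (_ : _ - _ = (p - e) * (f y0 - m)); last by ring.
  by rewrite mulr_ge0// subr_ge0.
apply: le_trans (lerD (lexx _) up) _; rewrite s1.
rewrite -subr_ge0 (_ : _ - _ = (p - e) * (M - f y0)); last by ring.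
by rewrite mulr_ge0// subr_ge0.
Qed.

Lemma class_converge f : exists L : R, forall e : R, 0 < e ->
  exists k : nat, forall (t : R) x, k%:R <= t -> x \in C -> `|L - semigroup q t f x| <= e.
Proof.
have [e /andP[e0 e1] ec] := class_contraction.
have [B B0 fB] := fin_bound f.
have osc k : exists m M, M - m = (1 - e) ^+ k * (2 * B) /\
    forall (t : R) x, k%:R <= t -> x \in C -> m <= semigroup q t f x <= M.
  have : exists m M, M - m = (1 - e) ^+ k * (2 * B) /\
      forall x, x \in C -> m <= semigroup q k%:R f x <= M.
    elim: k => [|k [m [M [mM IH]]]].
      exists (- B), B; split; first by rewrite expr0; ring.
      by move=> x _; rewrite semigroup0 -ler_norml.
    have [m' [M' [mM' IH']]] := ec _ _ _ IH.
    exists m', M'; split; first by rewrite mM' mM exprS; ring.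
    move=> x xC; rewrite -natr1 addrC semigroupD; exact: IH'.
  move=> [m [M [mM h]]]; exists m, M; split=> // t x kt xC.
  rewrite -(subrK k%:R t) semigroupD.
  by apply: class_range => //; rewrite subr_ge0.
have [C0 _ _] := closed_irreducibleP _ C_irr.
have [x0 x0C] := set0Pn _ C0.
(* The limit is the supremum of the eventual lower bounds. It lies in each bracket [[m, M]] of
   [osc], and these brackets shrink geometrically. *)
pose A := [set m : R | exists k : nat, forall (t : R) x, k%:R <= t -> x \in C -> m <= semigroup q t f x].
have Aup k M : (forall (t : R) x, k%:R <= t -> x \in C -> semigroup q t f x <= M) -> ubound A M.
  move=> h m [l hm]; apply: (le_trans (hm (maxn k l)%:R x0 _ x0C)).
    by rewrite ler_nat leq_maxr.
  by apply: h => //; rewrite ler_nat leq_maxl.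
have Ak k m : (forall (t : R) x, k%:R <= t -> x \in C -> m <= semigroup q t f x) -> A m.
  by exists k.
have hsA : has_sup A.
  have [m [M [_ h]]] := osc 0.
  split; first by exists m; apply: (Ak 0) => t x kt xC; case/andP: (h t x kt xC).
  by exists M; apply: (Aup 0) => t x kt xC; case/andP: (h t x kt xC).
exists (sup A) => d d0.
have g0 : (2 * B) * (1 - e) ^+ k @[k --> \oo] --> (0 : R).
  apply: cvg_geometric; rewrite ger0_norm ?subr_ge0// ltrBlDr ltrDl//.
have /cvgrPdist_le/(_ d d0)[k _ hk] := g0.
exists k => t x kt xC.
have [m [M [mM h]]] := osc k.
have mA : m <= sup A.
  by apply: sup_upper_bound => //; apply: (Ak k) => s y ks yC; case/andP: (h s y ks yC).
have AM : sup A <= M.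
  apply: ge_sup; first by case: hsA.
  by apply: (Aup k) => s y ks yC; case/andP: (h s y ks yC).
have /andP[mt tM] := h t x kt xC.
have := hk k (leqnn _); rewrite /= sub0r normrN mulrC -mM => hd.
have {}hd := le_trans (ler_norm _) hd.
rewrite ler_norml; apply/andP; split; lra.
Qed.

Lemma class_limit : exists M : T -> R,
  [/\ stationary q C M,
      forall x y, x \in C -> transition q t x y @[t --> +oo] --> M y &
      forall y, y \in C -> 0 < M y].
Proof.
have [M hM] := choice (fun y : T => class_converge (fun z => (z == y)%:R)).
have [C0 _ Cr] := closed_irreducibleP _ C_irr.
have [x0 x0C] := set0Pn _ C0.
have Mcvg x y : x \in C -> transition q t x y @[t --> +oo] --> M y.
  move=> xC; apply/cvgrPdist_le => e e0; have [k hk] := hM y e e0.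
  apply: filterS (nbhs_pinfty_ge (num_real k%:R)) => t kt.
  by rewrite transitionE; exact: hk.
have tge0 : \forall t \near +oo, (0 : R) <= t by apply: nbhs_pinfty_ge; rewrite num_real.
have M_ge0 y : 0 <= M y.
  apply: (cvgr_to_ge (Mcvg x0 y x0C)).
  by apply: filterS (nbhs_pinfty_ge (num_real 0)) => t t0; exact: transition_ge0.
have M_supp y : y \notin C -> M y = 0.
  move=> yC; apply/esym; apply: (cvg_unique _ _ (Mcvg x0 y x0C)) => //.
  rewrite (_ : (fun _ => _) = fun=> 0); first exact: cvg_cst.
  by apply/funext => t; rewrite (closed_transition0 _ C_closed).
have M_sum1 : \sum_y M y = 1.
  apply: (@cvg_unique _ _ (\sum_y transition q t x0 y @[t --> +oo])) => //.
    by apply: cvg_bigsum => y _; exact: Mcvg.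
  rewrite (_ : (fun _ => _) = fun=> 1); first exact: cvg_cst.
  by apply/funext => t; rewrite transition_sum1.
have M_inv s y : \sum_x M x * transition q s x y = M y.
  apply: (@cvg_unique _ _ (transition q (t + s) x0 y @[t --> +oo])) => //.
    rewrite (_ : (fun _ => _) = fun t => \sum_z transition q t x0 z * transition q s z y).
      apply: cvg_bigsum => z _; apply: cvgM; [exact: Mcvg|exact: cvg_cst].
    by apply/funext => t; rewrite transitionD.
  by have := Mcvg x0 y x0C; rewrite -(cvg_shiftr s).
exists M; split=> // y yC.
have [x Mx] : exists x, 0 < M x.
  apply/not_existsP => h; have := M_sum1; rewrite big1.
    by move/esym/eqP; rewrite oner_eq0.
  by move=> x _; apply/eqP; rewrite eq_le M_ge0 andbT leNgt; apply/negP/h.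
have xC : x \in C by apply: contraTT Mx => /M_supp ->; rewrite ltxx.
rewrite -(M_inv 1 y) (bigD1 x)//= ltr_pwDl//.
  by rewrite mulr_gt0// transition_gt0//; exact: Cr.
by apply: sumr_ge0 => z _; rewrite mulr_ge0// transition_ge0.
Qed.

Lemma stationary_measureP : stationary q C (stationary_measure q C).
Proof.
have [M [sM _ _]] := class_limit.
by apply: (@xgetPex _ _ [set mu | stationary q C mu]); exists M.
Qed.

Lemma stationary_measure_unique mu : stationary q C mu -> mu = stationary_measure q C.
Proof.
have [M [_ Mcvg _]] := class_limit.
suff h nu : stationary q C nu -> nu = M.
  by move=> /h ->; rewrite (h _ stationary_measureP).
move=> [nu0 nuC nu1 nuP]; apply/funext => y.
apply: (@cvg_unique _ _ (\sum_x nu x * transition q t x y @[t --> +oo])) => //.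
  apply: cvg_near_cst.
  by apply: filterS (nbhs_pinfty_ge (num_real 0)) => t t0; exact: nuP.
rewrite -[M y]mul1r -nu1 mulr_suml; apply: cvg_bigsum => x _.
have [xC|/nuC ->] := boolP (x \in C).
  by apply: cvgM; [exact: cvg_cst|exact: Mcvg].
rewrite mul0r (_ : (fun _ => _) = fun=> 0); first exact: cvg_cst.
by apply/funext => t; rewrite mul0r.
Qed.

Lemma stationary_measure_cvg x y : x \in C ->
  transition q t x y @[t --> +oo] --> stationary_measure q C y.
Proof.
have [M [sM Mcvg _]] := class_limit => xC.
by rewrite -(stationary_measure_unique sM); exact: Mcvg.
Qed.

Lemma stationary_measure_gt0 y : y \in C -> 0 < stationary_measure q C y.
Proof.
have [M [sM _ M0]] := class_limit => yC.
by rewrite -(stationary_measure_unique sM); exact: M0.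
Qed.

End Class.

End ErgodicTheorem.

(** * Absorption into closed classes and long-time limits *)

Section Absorption.
Context (R : realType) (T : finType).
Context (q : T -> T -> R) (q_ge0 : forall x y, 0 <= q x y).
Implicit Types (C D : {set T}) (f : T -> R).

Definition absorb C (x : T) : R :=
  lim ((\sum_(y in C) transition q t x y) @[t --> +oo]).

Lemma closed_mass_homo C x s t : closed q C -> 0 <= s -> s <= t ->
  \sum_(y in C) transition q s x y <= \sum_(y in C) transition q t x y.
Proof.
move=> Cc s0 st.
rewrite [leRHS](eq_bigr (fun y => \sum_z transition q s x z * transition q (t - s) z y));
  last by move=> y _; rewrite -transitionD addrC subrK.
rewrite exchange_big/= [leRHS](bigID (mem C))/= -[leLHS]addr0 lerD//.
  apply: ler_sum => z zC.
  by rewrite -mulr_sumr (closed_transition_sum1 q_ge0 _ Cc zC) mulr1.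
apply: sumr_ge0 => z _; apply: sumr_ge0 => y _.
by rewrite mulr_ge0// transition_ge0// subr_ge0.
Qed.

Lemma mass_le1 C x t : 0 <= t -> \sum_(y in C) transition q t x y <= 1.
Proof.
move=> t0; rewrite -(transition_sum1 q t x) [leRHS](bigID (mem C))/= lerDl.
by apply: sumr_ge0 => y _; exact: transition_ge0.
Qed.

Lemma absorb_cvg C x : closed q C ->
  \sum_(y in C) transition q t x y @[t --> +oo] --> absorb C x.
Proof.
(* The mass of a closed set is known to be monotone and at most 1 only at nonnegative times;
   truncating [t] at 0 gives a function that is monotone on the whole line. *)
move=> Cc; pose g t := \sum_(y in C) transition q (Num.max 0 t) x y.
have gcvg : g t @[t --> +oo] --> sup (range g).
  apply: nondecreasing_cvgr.
    move=> s t st; apply: closed_mass_homo => //.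
      by rewrite le_max lexx.
    by rewrite ge_max le_max lexx le_max st orbT.
  by exists 1 => _ [t _ <-]; apply: mass_le1; rewrite le_max lexx.
suff h : \sum_(y in C) transition q t x y @[t --> +oo] --> sup (range g).
  by rewrite /absorb (cvg_lim _ h).
apply: cvg_trans gcvg; apply: near_eq_cvg.
apply: filterS (nbhs_pinfty_ge (num_real 0)) => t t0.
by rewrite /g max_r.
Qed.

Lemma class_closed C : closed_irreducible q C -> closed q C.
Proof. by case/closed_irreducibleP. Qed.

Lemma class_eq C C' x : closed_irreducible q C -> closed_irreducible q C' ->
  x \in C -> x \in C' -> C = C'.
Proof.
by move=> Ci C'i xC xC'; rewrite (closed_irreducibleE Ci xC) -(closed_irreducibleE C'i xC').
Qed.

Context (D : {set T}) (D_closed : closed q D).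

Let U := finset.cover (closed_classes q D).

Lemma mem_classes C : C \in closed_classes q D ->
  closed_irreducible q C /\ {subset C <= D}.
Proof. by rewrite inE => /andP[/fintype.subsetP]. Qed.

Lemma classes_trivIset : finset.trivIset (closed_classes q D).
Proof.
apply/finset.trivIsetP => C C' /mem_classes[Ci _] /mem_classes[C'i _] CC'.
rewrite -setI_eq0; apply: contraNT CC' => /set0Pn[x]; rewrite inE => /andP[xC xC'].
by apply/eqP; exact: class_eq xC xC'.
Qed.

Lemma recurrent_closed : closed q U.
Proof.
move=> x y /finset.bigcupP[C CD xC] xy; apply/finset.bigcupP; exists C => //.
by have [Ci _] := mem_classes CD; exact: (class_closed Ci) xC xy.
Qed.

(** Within one unit of time every point of [D] sends at least a fixed mass [e] into the recurrent
    set, which is never left again. *)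
Let transient_decay : exists2 r : R, 0 <= r < 1 & forall (k : nat) x, x \in D ->
  semigroup q k%:R (fun z => (z \notin U)%:R) x <= r ^+ k.
Proof.
have reachU x : x \in D -> 0 < \sum_(y in U) transition q 1 x y.
  move=> xD; have [C [Ci xC]] := reachable_class q x.
  have [C0 Cc Cr] := closed_irreducibleP _ _ Ci.
  have [y yC] := set0Pn _ C0.
  have yU : y \in U.
    apply/finset.bigcupP; exists C => //; rewrite inE Ci andbT.
    by apply/fintype.subsetP => z /xC; exact: closed_reachable.
  rewrite (bigD1 y)//= ltr_pwDl ?transition_gt0// ?xC//.
  by apply: sumr_ge0 => z _; exact: transition_ge0.
have [e /andP[e0 e1] eU] := @fin_lower _ _ [pred x | x \in D]
  (fun x => \sum_(y in U) transition q 1 x y) reachU.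
exists (1 - e); first by rewrite subr_ge0 e1 ltrBlDr ltrDl.
set g := fun z => (z \notin U)%:R.
elim=> [|k IH] x xD.
  by rewrite semigroup0 expr0 /g; case: (_ \notin _).
rewrite -natr1 addrC semigroupD (closed_semigroupE q_ge0 _ _ D_closed xD).
have gU y : y \in U -> semigroup q k%:R g y = 0.
  move=> yU; rewrite (closed_semigroupE q_ge0 _ _ recurrent_closed yU) big1// => z zU.
  by rewrite /g zU mulr0.
apply: (@le_trans _ _ (\sum_(y in D | y \notin U) transition q 1 x y * (1 - e) ^+ k)).
  rewrite [leLHS](bigID (mem U))/= big1 ?add0r; last first.
    by move=> y /andP[_ yU]; rewrite gU// mulr0.
  by apply: ler_sum => y /andP[yD _]; rewrite ler_wpM2l ?IH// transition_ge0.
rewrite -mulr_suml exprS ler_wpM2r ?exprn_ge0// ?subr_ge0//.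
rewrite lerBrDr; apply: le_trans (lerD (lexx _) (eU x xD)) _.
rewrite -[leRHS](closed_transition_sum1 q_ge0 1 D_closed xD) [leRHS](bigID (mem U))/= addrC lerD2l.
rewrite [leRHS](eq_bigl (mem U))//= => y.
rewrite andb_idl//= => /finset.bigcupP[C CD yC].
by have [_] := mem_classes CD; exact.
Qed.

Lemma recurrent_mass_cvg x : x \in D ->
  \sum_(y in U) transition q t x y @[t --> +oo] --> (1 : R).
Proof.
move=> xD; have [r /andP[r0 r1] rk] := transient_decay.
apply/cvgrPdist_le => e e0.
have g0 : 1 * r ^+ k @[k --> \oo] --> (0 : R).
  by apply: cvg_geometric; rewrite ger0_norm.
have /cvgrPdist_le/(_ e e0)[k _ hk] := g0.
apply: filterS (nbhs_pinfty_ge (num_real k%:R)) => t kt.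
have t0 : 0 <= t by apply: le_trans kt.
rewrite ger0_norm ?subr_ge0 ?mass_le1//.
apply: (@le_trans _ _ (1 - \sum_(y in U) transition q k%:R x y)).
  by rewrite lerD2l lerN2; apply: closed_mass_homo => //; exact: recurrent_closed.
rewrite -[X in X - _](transition_sum1 q k%:R x) (bigID (mem U))/= addrAC subrr add0r.
have := hk k (leqnn k); rewrite /= sub0r normrN mul1r ger0_norm ?exprn_ge0//.
apply: le_trans; apply: le_trans (rk k x xD); rewrite semigroupE.
rewrite [leRHS](bigID (mem U))/= [X in X + _]big1 ?add0r; last first.
  by move=> y yU; rewrite yU mulr0.
by apply: ler_sum => y yU; rewrite yU mulr1.
Qed.

Lemma recurrent_sumE (F : T -> R) :
  \sum_(y in U) F y = \sum_(C in closed_classes q D) \sum_(y in C) F y.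
Proof. by rewrite /U (finset.big_trivIset _ classes_trivIset). Qed.

Lemma transition_cvg x y : x \in D -> transition q t x y @[t --> +oo] -->
  \sum_(C in closed_classes q D) absorb C x * stationary_measure q C y.
Proof.
move=> xD.
(* The doubled time separates the two effects: the first half carries the mass into the classes, the
   second half mixes inside the class reached. The three sums below are the mixing error, the main
   term and the mass not yet absorbed. *)
suff h : transition q (t + t) x y @[t --> +oo] -->
    \sum_(C in closed_classes q D) absorb C x * stationary_measure q C y.
  have half : (t / 2 : R) @[t --> +oo] --> +oo.
    apply/cvgryPge => A; apply: filterS (nbhs_pinfty_ge (num_real (A * 2))) => t.
    by rewrite ler_pdivlMr.
  have := cvg_comp _ _ half h.
  rewrite (_ : _ \o _ = fun t => transition q t x y)//.
  by apply/funext => t /=; rewrite -splitr.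
rewrite (_ : (fun _ => _) = fun t =>
   \sum_(C in closed_classes q D) \sum_(z in C)
      transition q t x z * (transition q t z y - stationary_measure q C y) +
   \sum_(C in closed_classes q D)
      (\sum_(z in C) transition q t x z) * stationary_measure q C y +
   \sum_(z | z \notin U) transition q t x z * transition q t z y); last first.
  apply/funext => t; rewrite transitionD (bigID (mem U))/=; congr (_ + _).
  rewrite recurrent_sumE -big_split/=; apply: eq_bigr => C _.
  rewrite mulr_suml -big_split/=; apply: eq_bigr => z _; ring.
rewrite -[X in _ --> X]addr0 -[X in _ --> X + _]add0r.
have squeeze (f g : R -> R) : (forall t, 0 <= t -> `|f t| <= g t) ->
    g t @[t --> +oo] --> (0 : R) -> f t @[t --> +oo] --> (0 : R).
  move=> fg g0; apply: (@squeeze_cvgr _ _ _ _ (fun t => - g t) g).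
  - apply: filterS (nbhs_pinfty_ge (num_real 0)) => t t0.
    by rewrite -ler_norml fg.
  - by rewrite -oppr0; exact: cvgN.
  - exact: g0.
apply: cvgD; first apply: cvgD.
- rewrite [X in _ --> X](_ : _ = \sum_(C in closed_classes q D) \sum_(z in C) (0 : R)); last first.
    by rewrite big1// => C _; rewrite big1.
  apply: cvg_bigsum => C /mem_classes[Ci _]; apply: cvg_bigsum => z zC.
  apply: (squeeze _ (fun t => `|transition q t z y - stationary_measure q C y|)).
    move=> t t0; rewrite normrM ger0_norm ?transition_ge0//.
    by rewrite ler_piMl// transition_le1.
  rewrite -[X in _ --> X](@normr0 _ R); apply: cvg_norm.
  rewrite -[X in _ --> X](subrr (stationary_measure q C y)).
  by apply: cvgB; [exact: stationary_measure_cvg|exact: cvg_cst].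
- apply: cvg_bigsum => C /mem_classes[Ci _]; apply: cvgM; last exact: cvg_cst.
  by apply: absorb_cvg; exact: class_closed.
apply: (squeeze _ (fun t => 1 - \sum_(z in U) transition q t x z)); last first.
  by rewrite -[X in _ --> X](subrr 1); apply: cvgB; [exact: cvg_cst|exact: recurrent_mass_cvg].
move=> t t0; rewrite ger0_norm; last first.
  by apply: sumr_ge0 => z _; rewrite mulr_ge0// transition_ge0.
rewrite -(transition_sum1 q t x) [X in _ <= X - _](bigID (mem U))/= addrAC subrr add0r.
by apply: ler_sum => z _; rewrite ler_piMr// ?transition_ge0// transition_le1.
Qed.

End Absorption.

(** * Approximately stationary measures on a closed class *)

Section ApproximateStationarity.
Context (R : realType) (T : finType).
Context (q : T -> T -> R) (q_ge0 : forall x y, 0 <= q x y).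
Context (C : {set T}) (C_irr : closed_irreducible q C).

Lemma stationary_drift (nu : T -> R) t y : (forall x, 0 <= nu x) -> 0 <= t ->
  `|\sum_x nu x * transition q t x y - nu y| <=
    (\sum_z `|\sum_x nu x * generator q (fun u => (u == z)%:R) x|) * t.
Proof.
move=> nu0 t0; pose g t := \sum_x nu x * transition q t x y.
have -> : nu y = g 0.
  rewrite /g -(sum_delta nu y); apply: eq_bigr => x _.
  by rewrite transition0 eq_sym.
rewrite -[t in leRHS]subr0.
apply: (@mean_value_bound _ g (fun s => \sum_x nu x *:
    semigroup q s (generator q (fun z => (z == y)%:R)) x)) => // s.
  by apply: is_derive_bigsum => x; apply: is_deriveZ; exact: is_derive_transition.
move=> /andP[s0 _].
rewrite (eq_bigr (fun x => \sum_z transition q s z y *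
    (nu x * generator q (fun u => (u == z)%:R) x))); last first.
  move=> x _; rewrite -generator_semigroup /GRing.scale/=.
  rewrite (_ : semigroup _ _ _ = fun x => \sum_z transition q s z y * (x == z)%:R).
    by rewrite (generator_sum q xpredT) mulr_sumr; apply: eq_bigr => z _; rewrite mulrCA.
  by apply/funext => u; rewrite sum_delta transitionE.
rewrite exchange_big/= (le_trans (ler_norm_sum _ _ _))// ler_sum// => z _.
rewrite -mulr_sumr normrM ler_piMl//.
by rewrite ger0_norm ?transition_ge0// transition_le1.
Qed.

(** First fix a time [t] after which the law from every point of [C] is close to the stationary one.
    Over this fixed time [nu n] drifts by at most [t] times the size of [nu n L], which vanishes as
    [n] grows. *)
Lemma approximate_stationarity (nu : nat -> T -> R) :
  (forall n x, 0 <= nu n x) -> (forall n x, x \notin C -> nu n x = 0) ->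
  (forall n, \sum_x nu n x = 1) ->
  (forall z, \sum_x nu n x * generator q (fun u => (u == z)%:R) x @[n --> \oo] --> 0) ->
  forall y, nu n y @[n --> \oo] --> stationary_measure q C y.
Proof.
move=> nu0 nuC nu1 nuL y; apply/cvgrPdist_le => e e0.
have e20 : 0 < e / 2 by rewrite divr_gt0.
have [t [t0 ht]] : exists t : R, 0 < t /\ forall x, x \in C ->
    `|stationary_measure q C y - transition q t x y| <= e / 2.
  have A1 : \forall t \near +oo, (0 : R) < t.
    by apply: nbhs_pinfty_gt; rewrite num_real.
  have A2 : \forall t \near +oo, forall x, x \in C ->
      `|stationary_measure q C y - transition q t x y| <= e / 2.
    apply: filter_forall => x; have [xC|xC] := boolP (x \in C); last exact: nearW.
    have /cvgrPdist_le/(_ _ e20) := stationary_measure_cvg q_ge0 C_irr (y := y) xC.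
    by apply: filterS => t.
  by have [t [t0 ht]] := filter_ex (filterI A1 A2); exists t.
pose eta n := \sum_z `|\sum_x nu n x * generator q (fun u => (u == z)%:R) x|.
have eta0 : eta n * t @[n --> \oo] --> 0.
  rewrite -[X in _ --> X](mul0r t); apply: cvgM; last exact: cvg_cst.
  rewrite [X in _ --> X](_ : _ = \sum_(z : T) `|0 : R|); last by rewrite big1// => z _; rewrite normr0.
  by apply: cvg_bigsum => z _; apply: cvg_norm.
have /cvgrPdist_le/(_ _ e20) := eta0; apply: filterS => n.
rewrite sub0r normrN => hn.
have drift := le_trans (stationary_drift y (nu0 n) (ltW t0)) (le_trans (ler_norm _) hn).
have avg : `|stationary_measure q C y - \sum_x nu n x * transition q t x y| <= e / 2.
  rewrite -[X in `|X - _|]mul1r -(nu1 n) mulr_suml -sumrB.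
  rewrite (le_trans (ler_norm_sum _ _ _))//.
  apply: (@le_trans _ _ ((\sum_x nu n x) * (e / 2))); last by rewrite nu1 mul1r.
  rewrite mulr_suml ler_sum// => x _.
  rewrite -mulrBr normrM ger0_norm//.
  have [xC|/nuC ->] := boolP (x \in C); last by rewrite !mul0r.
  by rewrite ler_wpM2l// ht.
rewrite (splitr e); apply: le_trans (lerD avg drift).
apply: le_trans (ler_normD _ _); rewrite le_eqVlt; apply/orP; left.
by apply/eqP; congr `|_|; ring.
Qed.

End ApproximateStationarity.

(** * Harmonic extensions and traces *)

Section Harmonic.
Context (R : realType) (V : finType).
Context (q : V -> V -> R) (q_ge0 : forall x y, 0 <= q x y) (q_irr : irreducible q).
Implicit Types (A D : {set V}) (f g h : V -> R).

Lemma max_principle D f M : D != finset.set0 ->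
  (forall x, x \notin D -> 0 <= generator q f x) ->
  (forall x, x \in D -> f x <= M) -> forall x, f x <= M.
Proof.
move=> /set0Pn[d dD] fL fM x.
have [x0 _ fmax] := @arg_maxP _ _ _ x xpredT f isT.
have {}fmax y : f y <= f x0 by exact: fmax.
apply: le_trans (fmax x) _; rewrite leNgt; apply/negP => Mf.
(* At a maximizer outside [D] the terms of the generator are nonpositive with a nonnegative sum, so
   all of them vanish. If the maximum exceeds [M], the set of maximizers is thus closed and avoids
   [D], contrary to irreducibility. *)
pose A := [set y | f y == f x0]%SET.
have Ac : closed q A.
  move=> y z; rewrite !inE => /eqP fy qyz.
  have yD : y \notin D by apply: contraTN Mf => /fM; rewrite fy leNgt.
  have term u : q y u * (f u - f y) <= 0.
    by rewrite mulr_ge0_le0// subr_le0 fy fmax.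
  have s0 : \sum_u - (q y u * (f u - f y)) = 0.
    by apply/eqP; rewrite eq_le sumrN oppr_le0 fL//= oppr_ge0 sumr_le0.
  have tge0 u : true -> 0 <= - (q y u * (f u - f y)) by rewrite oppr_ge0.
  have := psumr_eq0P tge0 s0 (i := z) isT => /eqP.
  by rewrite oppr_eq0 mulf_eq0 (gt_eqF qyz)/= subr_eq0 fy.
have : d \in A by apply: closed_reachable Ac _ (q_irr x0 d); rewrite inE.
by rewrite inE => /eqP fd; move: Mf; rewrite -fd ltNge fM.
Qed.

Lemma min_principle D f m : D != finset.set0 ->
  (forall x, x \notin D -> generator q f x <= 0) ->
  (forall x, x \in D -> m <= f x) -> forall x, m <= f x.
Proof.
move=> D0 fL fm x; rewrite -lerN2.
apply: (@max_principle D (fun x => - f x) (- m)) => // y yD; last by rewrite lerN2 fm.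
rewrite (_ : (fun x => - f x) = (fun x => -1 * f x)); last by apply/funext => u; rewrite mulN1r.
by rewrite generatorZ mulN1r oppr_ge0 fL.
Qed.

Lemma escape_lt0 D z h : D != finset.set0 -> z \notin D ->
  h z = 1 -> (forall x, x \in D -> h x = 0) ->
  (forall x, x \notin D -> x != z -> generator q h x = 0) -> generator q h z < 0.
Proof.
move=> D0 zD hz hD hL.
rewrite ltNge; apply/negP => Lz.
have hL0 x : x \notin D -> 0 <= generator q h x.
  by have [->//|xz xD] := eqVneq x z; rewrite hL.
have hD0 x : x \in D -> h x <= 0 by move=> /hD ->.
by have := max_principle D0 hL0 hD0 z; rewrite hz ler10.
Qed.

(** Induction on the size of the complement. One point [z] is first added to the boundary; a
    multiple of the function that is 1 at [z], 0 on [D] and harmonic elsewhere then corrects the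
    equation at [z]. The correction is possible because the generator of that function is negative
    at [z]. *)
Lemma dirichlet D f g : D != finset.set0 ->
  exists h, (forall x, x \in D -> h x = g x) /\
            (forall x, x \notin D -> generator q h x = f x).
Proof.
elim: {D}#|~: D|%SET {-2}D (erefl #|~: D|%SET) f g => [|n IH] D Dn f g D0.
  exists g; split=> // x xD.
  by move/eqP: Dn; rewrite cards_eq0 => /eqP/setP/(_ x); rewrite !inE xD.
have /card_gt0P[z] : (0 < #|~: D|%SET)%N by rewrite Dn.
rewrite inE => zD; pose D' := (z |: D)%SET.
have D'n : #|~: D'|%SET = n.
  have -> : (~: D' = ~: D :\ z)%SET by apply/setP => u; rewrite !inE negb_or.
  by have := cardsD1 z (~: D)%SET; rewrite inE zD Dn add1n => -[].
have D'0 : D' != finset.set0 by apply/set0Pn; exists z; rewrite !inE eqxx.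
have [h [hD hL]] := IH D' D'n f g D'0.
have [e [eD eL]] := IH D' D'n (fun=> 0) (fun x => (x == z)%:R) D'0.
have ez : generator q e z < 0.
  apply: (@escape_lt0 D) => // [|x xD|x xD xz].
  - by rewrite eD ?eqxx// !inE eqxx.
  - rewrite eD ?inE ?xD ?orbT//; case: eqP => // xz.
    by move: zD; rewrite -xz xD.
  - by rewrite eL// !inE negb_or xz.
pose c := (f z - generator q h z) / generator q e z.
exists (fun x => h x + c * e x); split=> x xD.
  rewrite hD ?inE ?xD ?orbT// eD ?inE ?xD ?orbT//.
  case: eqP => [xz|_]; first by move: zD; rewrite -xz xD.
  by rewrite mulr0 addr0.
rewrite generatorD generatorZ.
have [->|xz] := eqVneq x z; first by rewrite /c divfK ?lt_eqF// subrKC.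
by rewrite hL ?eL ?mulr0 ?addr0// !inE negb_or xz.
Qed.

Definition harm D g : V -> R :=
  xget (fun=> 0) [set h | (forall x, x \in D -> h x = g x) /\
                          (forall x, x \notin D -> generator q h x = 0)].

Lemma harmP D g : D != finset.set0 ->
  (forall x, x \in D -> harm D g x = g x) /\
  (forall x, x \notin D -> generator q (harm D g) x = 0).
Proof.
move=> D0; have [h hP] := dirichlet (fun=> 0) g D0.
by apply: (@xgetPex _ _ [set h | (forall x, x \in D -> h x = g x) /\
                          (forall x, x \notin D -> generator q h x = 0)]); exists h.
Qed.

Lemma harm_in D g x : x \in D -> harm D g x = g x.
Proof.
move=> xD; have D0 : D != finset.set0 by apply/set0Pn; exists x.
by have [+ _] := harmP g D0; apply.
Qed.

Lemma harm_off D g x : D != finset.set0 -> x \notin D -> generator q (harm D g) x = 0.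
Proof. by move=> D0; have [_] := harmP g D0; apply. Qed.

Lemma harm_unique D g h : D != finset.set0 ->
  (forall x, x \in D -> h x = g x) -> (forall x, x \notin D -> generator q h x = 0) ->
  harm D g = h.
Proof.
move=> D0 hD hL; apply/funext => x; apply/eqP; rewrite -subr_eq0 eq_le.
have L0 y : y \notin D -> generator q (fun x => harm D g x - h x) y = 0.
  by move=> yD; rewrite generatorB harm_off// hL// subrr.
have d0 y : y \in D -> harm D g y - h y = 0.
  by move=> yD; rewrite harm_in// hD// subrr.
rewrite (@max_principle D (fun x => harm D g x - h x))//; last 2 first.
- by move=> y /L0 ->.
- by move=> y /d0 ->.
by rewrite (@min_principle D (fun x => harm D g x - h x))// => y; [move/L0 ->|move/d0 ->].
Qed.

Lemma eq_harm D g g' : (forall x, x \in D -> g x = g' x) -> D != finset.set0 ->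
  harm D g = harm D g'.
Proof.
move=> gg' D0; apply: harm_unique => // x xD; first by rewrite harm_in// gg'.
exact: harm_off.
Qed.

Lemma harm_cst D c : D != finset.set0 -> harm D (fun=> c) = (fun=> c).
Proof. by move=> D0; apply: harm_unique => // x _; rewrite generator_cst. Qed.

Lemma harm_sum D (I : finType) (P : pred I) (c : I -> R) (g : I -> V -> R) :
  D != finset.set0 ->
  harm D (fun x => \sum_(i | P i) c i * g i x) =
  (fun x => \sum_(i | P i) c i * harm D (g i) x).
Proof.
move=> D0; apply: harm_unique => // x xD.
  by apply: eq_bigr => i _; rewrite harm_in.
by rewrite generator_sum big1// => i _; rewrite harm_off// mulr0.
Qed.

Lemma harm_ge0 D g x : D != finset.set0 -> (forall x, x \in D -> 0 <= g x) ->
  0 <= harm D g x.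
Proof.
move=> D0 g0; apply: (@min_principle D) => // y yD; last by rewrite harm_in// g0.
by rewrite harm_off.
Qed.

Lemma harm_le1 D g x : D != finset.set0 -> (forall x, x \in D -> g x <= 1) ->
  harm D g x <= 1.
Proof.
move=> D0 g0; apply: (@max_principle D) => // y yD; last by rewrite harm_in// g0.
by rewrite harm_off.
Qed.

(* For [x != y] in [D], the jump rate from [x] to [y] of the trace on [D]. *)
Definition trace D x y : R := generator q (harm D (fun u => (u == y)%:R)) x.

Lemma harm_setE D A : D != finset.set0 -> A \subset D ->
  harm D (fun x => (x \in A)%:R) =
  (fun x => \sum_(y in A) harm D (fun u => (u == y)%:R) x).
Proof.
move=> D0 AD; rewrite (_ : (fun x => (x \in A)%:R) =
    (fun x => \sum_(y in A) 1 * (x == y)%:R)).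
  by rewrite harm_sum//; apply/funext => x; apply: eq_bigr => y _; rewrite mul1r.
apply/funext => x; under eq_bigr do rewrite mul1r.
have [xA|xA] := boolP (x \in A); last first.
  by rewrite big1// => y yA; case: eqP => // xy; move: xA; rewrite xy yA.
rewrite (bigD1 x)//= eqxx big1 ?addr0// => y /andP[_ yx].
by rewrite eq_sym (negbTE yx).
Qed.

Lemma generator_harm_set D A x : D != finset.set0 -> A \subset D ->
  generator q (harm D (fun x => (x \in A)%:R)) x = \sum_(y in A) trace D x y.
Proof.
move=> D0 AD; rewrite harm_setE//.
have := generator_sum q (mem A) (fun=> 1) (fun y => harm D (fun u => (u == y)%:R)) x.
rewrite (_ : (fun x => \sum_(i in A) 1 * harm D (fun u => (u == i)%:R) x) =
  (fun x => \sum_(y in A) harm D (fun u => (u == y)%:R) x)).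
  by move=> ->; apply: eq_bigr => y _; rewrite mul1r.
by apply/funext => u; apply: eq_bigr => y _; rewrite mul1r.
Qed.

Lemma generator_at_zero_ge0 f x : (forall y, 0 <= f y) -> f x = 0 -> 0 <= generator q f x.
Proof.
by move=> f0 fx; apply: sumr_ge0 => y _; rewrite mulr_ge0// fx subr0.
Qed.

(** The harmonic extension of the constant 1 is constant. The diagonal of [trace] is thus
    meaningful: it is minus the total exit rate, and [trace D] is a full generator matrix on [D]. *)
Lemma trace_sum0 D x : D != finset.set0 -> \sum_(y in D) trace D x y = 0.
Proof.
move=> D0; rewrite -(@generator_harm_set D D)// (eq_harm (g' := fun=> 1))//.
  by rewrite harm_cst// generator_cst.
by move=> u ->.
Qed.

Lemma trace_diag D x : x \in D -> trace D x x = - \sum_(y in D | y != x) trace D x y.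
Proof.
move=> xD; have D0 : D != finset.set0 by apply/set0Pn; exists x.
apply/eqP; rewrite -addr_eq0; apply/eqP.
by have := trace_sum0 x D0; rewrite (bigD1 x).
Qed.

Lemma trace_setT x y : x != y -> trace [set: V]%SET x y = q x y.
Proof.
move=> xy; have T0 : [set: V]%SET != finset.set0 by apply/set0Pn; exists x; rewrite inE.
rewrite /trace (@harm_unique _ _ (fun u => (u == y)%:R))//; last by move=> u; rewrite inE.
rewrite /generator (bigD1 y)//= eqxx (negbTE xy) subr0 mulr1 big1 ?addr0// => z /negbTE ->.
by rewrite subrr mulr0.
Qed.

Lemma trace_exit_gt0 D z : D != finset.set0 -> z \notin D ->
  0 < \sum_(w in D) trace (z |: D)%SET z w.
Proof.
move=> D0 zD; have zD' : z \in (z |: D)%SET by rewrite !inE eqxx.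
rewrite (eq_bigl (fun w => (w \in z |: D)%SET && (w != z))); last first.
  by move=> w; rewrite !inE; have [->|] := eqVneq w z; rewrite ?(negbTE zD)//= andbT.
rewrite -oppr_lt0 -trace_diag//; apply: (@escape_lt0 D) => // [|x xD|x xD xz].
- by rewrite harm_in// eqxx.
- rewrite harm_in ?inE ?xD ?orbT//; case: eqP => // xz.
  by move: zD; rewrite -xz xD.
- by rewrite harm_off ?inE ?negb_or ?xz//; apply/set0Pn; exists z.
Qed.

(** A Schur complement: a jump of the trace on [D] is either direct in the trace on [D] with [z]
    added, or an entrance into [z] followed by the exit from [z] to [y], whose probability is a
    quotient of rates. *)
Lemma trace_elimination D z x y : z \notin D -> x \in D -> y \in D ->
  trace D x y = trace (z |: D)%SET x y +
    trace (z |: D)%SET x z * trace (z |: D)%SET z y /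
      \sum_(w in D) trace (z |: D)%SET z w.
Proof.
move=> zD xD yD; set D' := (z |: D)%SET.
have D0 : D != finset.set0 by apply/set0Pn; exists x.
have zD' : z \in D' by rewrite !inE eqxx.
have D'0 : D' != finset.set0 by apply/set0Pn; exists z.
(* The extension from [D] is also the extension from the larger set with value [c] at [z]; the
   equation [L h z = 0] then determines [c]. *)
set h := harm D (fun u => (u == y)%:R); pose c := h z.
have hE : h = (fun u => harm D' (fun u => (u == y)%:R) u + c * harm D' (fun u => (u == z)%:R) u).
  apply: harm_unique => // u uD.
    have uD' : u \in D' by rewrite !inE uD orbT.
    rewrite !harm_in//; case: (u =P z) => [uz|_]; last by rewrite mulr0 addr0.
    by move: zD; rewrite -uz uD.
  rewrite generatorD generatorZ.
  have [uz|uz] := eqVneq u z; last first.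
    by rewrite !harm_off ?mulr0 ?addr0// !inE negb_or uz.
  have h0 : generator q h z = 0 by rewrite harm_off.
  move: h0; rewrite (_ : h = harm D' (fun u => (u == y)%:R + c * (u == z)%:R)); last first.
    apply/esym/harm_unique => // v.
      rewrite !inE => /orP[/eqP ->|vD].
        rewrite eqxx mulr1; case: eqP => [zy|_]; last by rewrite add0r.
        by move: zD; rewrite zy yD.
      rewrite /h harm_in//; case: (v =P z) => [vz|_]; last by rewrite mulr0 addr0.
      by move: zD; rewrite -vz vD.
    by rewrite !inE negb_or => /andP[_ vD]; rewrite harm_off.
  rewrite uz (_ : harm D' (fun u => (u == y)%:R + c * (u == z)%:R) =
    (fun u => harm D' (fun u => (u == y)%:R) u + c * harm D' (fun u => (u == z)%:R) u)).
    by rewrite generatorD generatorZ.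
  apply: harm_unique => // v vD'; first by rewrite !harm_in.
  by rewrite generatorD generatorZ !harm_off// mulr0 addr0.
have L u : generator q h u = trace D' u y + c * trace D' u z.
  by rewrite hE generatorD generatorZ.
rewrite /trace -/h L; congr (_ + _).
have := L z; rewrite (harm_off _ D0 zD) trace_diag//.
rewrite (eq_bigl (mem D)); last first.
  by move=> w; rewrite !inE; have [->|] := eqVneq w z; rewrite ?(negbTE zD)//= andbT.
have := trace_exit_gt0 D0 zD; rewrite -/D'.
set s := \sum_(w in D) _ => s0 e.
have -> : c = trace D' z y / s.
  apply: (mulIf (lt0r_neq0 s0)); rewrite divfK ?lt0r_neq0//.
  by apply/eqP; rewrite -subr_eq0 -oppr_eq0 opprB -mulrN e.
by rewrite mulrC mulrA.
Qed.

Section Stationary.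
Context (pi : V -> R) (pi_stat : stationary q [set: V]%SET pi).

Lemma stationary_generator f : \sum_x pi x * generator q f x = 0.
Proof.
have [pi0 _ _ piP] := pi_stat.
have sg t g : 0 <= t -> \sum_x pi x * semigroup q t g x = \sum_x pi x * g x.
  move=> t0; under eq_bigr do rewrite semigroupE mulr_sumr.
  rewrite exchange_big/=; apply: eq_bigr => y _.
  by rewrite -(piP t y t0) mulr_suml; apply: eq_bigr => x _; rewrite mulrA.
pose g t := \sum_x pi x * semigroup q t f x.
have gd (s : R) : is_derive s (1 : R) g (\sum_x pi x *: semigroup q s (generator q f) x).
  by apply: is_derive_bigsum => x; apply: is_deriveZ; exact: is_derive_semigroup.
have gc : {within `[0 : R, 1], continuous g}.
  by apply: continuous_subspaceT; exact: is_derive_continuous gd.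
(* By invariance [g] is constant on [[0, 1]], and its derivative at the intermediate point [c] is,
   again by invariance, the sum in question. *)
have [c c01 /esym] := @MVT_segment _ g _ _ _ ler01 (fun x _ => gd x) gc.
rewrite /g !sg//; last by move: c01; rewrite in_itv/= => /andP[].
by rewrite subrr subr0 mulr1.
Qed.

Lemma stationary_gt0 x : 0 < pi x.
Proof.
have [pi0 _ pi1 piP] := pi_stat.
have [y py] : exists y, 0 < pi y.
  apply/not_existsP => h; have := pi1; rewrite big1.
    by move/esym/eqP; rewrite oner_eq0.
  by move=> y _; apply/eqP; rewrite eq_le pi0 andbT leNgt; apply/negP/h.
rewrite -(piP 1 x)// (bigD1 y)//= ltr_pwDl//.
  by rewrite mulr_gt0// transition_gt0.
by apply: sumr_ge0 => z _; rewrite mulr_ge0// transition_ge0.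
Qed.

(** Testing stationarity against the harmonic extension of the indicator of [y] from the pair leaves
    only the terms at [x] and [y]: the balance of flows of the two-state trace. *)
Lemma stationary_ratio x y : x != y ->
  0 < trace [set x; y]%SET x y /\
  pi x / pi y = trace [set x; y]%SET y x / trace [set x; y]%SET x y.
Proof.
move=> xy; set D := [set x; y]%SET.
have xD : x \in D by rewrite !inE eqxx.
have yD : y \in D by rewrite !inE eqxx orbT.
have D0 : D != finset.set0 by apply/set0Pn; exists x.
have t0 : 0 < trace D x y.
  have := @trace_exit_gt0 [set y]%SET x; rewrite big_set1 !inE; apply=> //.
  by apply/set0Pn; exists y; rewrite inE.
split=> //.
have := stationary_generator (harm D (fun u => (u == y)%:R)).
rewrite (bigD1 x)//= (bigD1 y)/=; last by rewrite eq_sym.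
rewrite big1 ?addr0; last first.
  by move=> u /andP[ux uy]; rewrite harm_off ?mulr0// !inE negb_or ux.
rewrite -!/(trace _ _ _) (trace_diag yD) (big_pred1 x); last first.
  by move=> u; rewrite !inE; case: (u =P x) => [->|]//=; case: eqP => // -> /eqP/esym.
move=> e; have py := stationary_gt0 y.
apply/eqP; rewrite eqr_div ?lt0r_neq0// -subr_eq0 [_ * pi y]mulrC -mulrN e //.
Qed.

End Stationary.

End Harmonic.

(** * Ratios of homogeneous sums of monomials *)

Lemma prec_EFinP (R : realType) (a b : nat -> R) : (forall n, 0 < b n) ->
  prec (EFin \o a) (EFin \o b) <-> a n / b n @[n --> \oo] --> 0.
Proof.
move=> b0; rewrite /prec (_ : (fun n => _) = EFin \o (fun n => a n / b n)).
  split=> [/fine_cvgP[_]//|h]; apply/fine_cvgP; split=> //.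
  exact: nearW.
by apply/funext => n /=; rewrite inver gt_eqF.
Qed.

Section RatioClass.
Context (R : realType) (V : finType) (E : rel V) (q : nat -> V -> V -> R).
Context (q_edge : forall n x y, E x y -> 0 < q n x y).
Context (q_nonedge : forall n x y, ~~ E x y -> q n x y = 0).

Let mono (k : V * V -> nat) n : R := \prod_(e : V * V | E e.1 e.2) q n e.1 e.2 ^+ k e.
Let deg (k : V * V -> nat) := (\sum_(e : V * V | E e.1 e.2) k e)%N.

Context (q_comparable : forall (m : nat) (k l : V * V -> nat), (1 <= m)%N ->
  deg k = m -> deg l = m -> comparable_seq (mono k) (mono l)).

(** The list may repeat a monomial, which encodes positive integer coefficients; it is non-empty so
    that [a] is positive. Subtraction never enters, and positivity is what makes all denominators
    legitimate. *)
Definition homogeneous d (a : nat -> R) := exists s : seq (V * V -> nat),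
  [/\ s <> [::], forall k, List.In k s -> deg k = d &
      forall n, a n = \sum_(k <- s) mono k n].

Let mono_gt0 k n : 0 < mono k n.
Proof. by apply: prodr_gt0 => e Ee; rewrite exprn_gt0// q_edge. Qed.

Let sum_mono_gt0 s n : s <> [::] -> 0 < \sum_(k <- s) mono k n.
Proof.
case: s => // k s _; rewrite big_cons ltr_pwDl//.
by apply: sumr_ge0 => l _; exact: ltW.
Qed.

Lemma homogeneous_gt0 d a n : homogeneous d a -> 0 < a n.
Proof. by move=> [s [s0 _ ->]]; exact: sum_mono_gt0. Qed.

Lemma homogeneousD d a b : homogeneous d a -> homogeneous d b ->
  homogeneous d (fun n => a n + b n).
Proof.
move=> [s [s0 sd sE]] [t [_ td tE]]; exists (s ++ t); split.
- by case: s s0 {sd sE}.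
- by move=> k kst; case: (List.in_app_or _ _ _ kst); [exact: sd|exact: td].
- by move=> n; rewrite big_cat sE tE.
Qed.

Lemma homogeneousM d d' a b : homogeneous d a -> homogeneous d' b ->
  homogeneous (d + d') (fun n => a n * b n).
Proof.
move=> [s [s0 sd sE]] [t [t0 td tE]].
exists [seq (fun e => k e + l e)%N | k <- s, l <- t]; split.
- by case: s t s0 t0 {sd td sE tE} => [|? ?] [|? ?].
- elim: s sd {s0 sE} => [//|k s IH] sd m /= mst; case: (List.in_app_or _ _ _ mst) => {mst}.
    elim: t td {t0 tE IH} => [//|l t IHt] td /= [<-|].
      by rewrite /deg big_split/= -/(deg k) -/(deg l) (sd k) ?(td l)//; left.
    by apply: IHt => l' l't; apply: td; right.
  by apply: IH => l ls; apply: sd; right.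
- move=> n; rewrite sE tE big_allpairs_dep/= big_distrl/=; apply: eq_bigr => k _.
  rewrite big_distrr/=; apply: eq_bigr => l _.
  by rewrite /mono -big_split/=; apply: eq_bigr => e _; rewrite exprD.
Qed.

Lemma homogeneous1 : homogeneous 0 (fun=> 1).
Proof.
exists [:: fun=> 0%N]; split=> //; last first.
  by move=> n; rewrite big_seq1 /mono big1// => e _; rewrite expr0.
by move=> k [<-|//]; rewrite /deg big1.
Qed.

Lemma homogeneous_rate x y : E x y -> homogeneous 1 (fun n => q n x y).
Proof.
move=> Exy; exists [:: fun e => (e == (x, y))%N : nat]; split=> //.
  move=> k [<-|//]; rewrite /deg (bigD1 (x, y))//= eqxx big1// => e /andP[_].
  by move=> /negbTE ->.
move=> n; rewrite big_seq1 /mono (bigD1 (x, y))//= eqxx expr1 big1 ?mulr1//.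
by move=> e /andP[_ /negbTE ->]; rewrite expr0.
Qed.

Let mono_ratio d k l : (1 <= d)%N -> deg k = d -> deg l = d ->
  cvgn (fun n => mono l n / mono k n) \/ mono k n / mono l n @[n --> \oo] --> 0.
Proof.
move=> d1 kd ld; case: (q_comparable d1 ld kd) => [|/prec_EFinP|[c [_ lk]]].
- move/prec_EFinP => /(_ (mono_gt0 k)) h; left; apply/cvg_ex; exists 0; exact: h.
- by move=> /(_ (mono_gt0 l)) h; right.
- by left; apply/cvg_ex; exists c.
Qed.

(** It suffices to treat a single monomial [k] over the sum of all. Either some monomial of the sum
    dominates [k] and the quotient tends to 0, or every monomial divided by that of [k] converges.
    In the latter case the sum of these ratios has a limit at least 1, because the ratio of [k] to
    itself occurs in it, and so can be inverted. *)
Lemma homogeneous_fraction d a b : (1 <= d)%N -> homogeneous d a -> homogeneous d b ->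
  cvgn (fun n => a n / (a n + b n)).
Proof.
move=> d1 [s [s0 sd sE]] [t [_ td tE]].
suff h u k : u <> [::] -> (forall l, List.In l u -> deg l = d) -> List.In k u ->
    cvgn (fun n => mono k n / \sum_(l <- u) mono l n).
  have st0 : s ++ t <> [::] by case: s s0 {sd sE}.
  have std k : List.In k (s ++ t) -> deg k = d by move=> kst; case: (List.in_app_or _ _ _ kst); [exact: sd|exact: td].
  rewrite (_ : (fun n => _) = fun n => \sum_(k <- s) (mono k n / \sum_(l <- s ++ t) mono l n)).
    have sst k : List.In k s -> List.In k (s ++ t) by move=> ks; apply/List.in_or_app; left.
    elim: s {s0 sd sE} (s ++ t) st0 std sst => [|k s IH] st st0 std sst.
      by rewrite (_ : (fun n => _) = cst 0); [exact: is_cvg_cst|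
        apply/funext => n; rewrite big_nil].
    rewrite (_ : (fun n => _) = (fun n => mono k n / \sum_(l <- st) mono l n) +
      (fun n => \sum_(k <- s) (mono k n / \sum_(l <- st) mono l n))).
      apply: is_cvgD; first by apply: h => //; apply: sst; left.
      by apply: IH => // l ls; apply: sst; right.
    by apply/funext => n; rewrite big_cons.
  by apply/funext => n; rewrite -mulr_suml -sE big_cat/= -sE -tE.
move=> u0 ud ku; have kd := ud _ ku.
have [[l [lu kl0]]|noinf] := pselect (exists l, List.In l u /\ mono k n / mono l n @[n --> \oo] --> 0).
  apply/cvg_ex; exists 0.
  apply: (@squeeze_cvgr _ _ _ _ (fun=> 0) (fun n => mono k n / mono l n)) => //.
    apply: nearW => n; apply/andP; split.
      by rewrite divr_ge0 ?ltW// ?sum_mono_gt0.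
    rewrite ler_wpM2l ?(ltW (mono_gt0 _ _))// lef_pV2 ?posrE ?sum_mono_gt0//.
    elim: u lu {u0 ud ku} => [//|l' u IH] /= [->|lu].
      by rewrite big_cons lerDl sumr_ge0// => j _; exact: ltW.
    by rewrite big_cons (le_trans (IH lu))// lerDr ltW.
  exact: cvg_cst.
have cv l : List.In l u -> cvgn (fun n => mono l n / mono k n).
  by move=> lu; have [//|kl] := mono_ratio d1 kd (ud _ lu); case: noinf; exists l.
have S1 n : 1 <= \sum_(l <- u) (mono l n / mono k n).
  elim: u ku {u0 ud noinf cv} => [//|l u IH] /= [->|ku]; rewrite big_cons.
    rewrite divff ?gt_eqF// lerDl sumr_ge0// => j _.
    by rewrite divr_ge0 ?ltW.
  by rewrite (le_trans (IH ku))// lerDr divr_ge0 ?ltW.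
have Scvg : cvgn (fun n => \sum_(l <- u) (mono l n / mono k n)).
  elim: u cv {u0 ud ku noinf S1} => [|l u IH] cv.
    by rewrite (_ : (fun n => _) = cst 0); [exact: is_cvg_cst|
      apply/funext => n; rewrite big_nil].
  rewrite (_ : (fun n => _) = (fun n => mono l n / mono k n) +
      (fun n => \sum_(l <- u) (mono l n / mono k n))).
    apply: is_cvgD; first by apply: cv; left.
    by apply: IH => j ju; apply: cv; right.
  by apply/funext => n; rewrite big_cons.
rewrite (_ : (fun n => _) = (fun n => (\sum_(l <- u) (mono l n / mono k n))^-1)).
  apply/cvg_ex; exists (limn (fun n => \sum_(l <- u) (mono l n / mono k n)))^-1.
  apply: (cvgV _ Scvg); apply: lt0r_neq0; apply: (@lt_le_trans _ _ 1) => //.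
  by apply: (limr_ge Scvg); apply: nearW => n; exact: S1.
by apply/funext => n; rewrite -mulr_suml invfM invrK mulrC.
Qed.

Definition ratio d (a : nat -> R) := exists b A B,
  [/\ homogeneous (b + d) A, homogeneous b B & forall n, a n = A n / B n].

(* All terms vanish or none does: the zero pattern of the rates is that of [E]. *)
Definition ratio0 d (a : nat -> R) := (forall n, a n = 0) \/ ratio d a.

Lemma ratio_gt0 d a n : ratio d a -> 0 < a n.
Proof. by move=> [b [A [B [hA hB ->]]]]; rewrite divr_gt0 ?(homogeneous_gt0 _ hA) ?(homogeneous_gt0 _ hB). Qed.

Lemma ratio_pos d a : ratio0 d a -> (forall n, 0 < a n) -> ratio d a.
Proof. by case=> // a0 /(_ 0%N); rewrite a0 ltxx. Qed.

Lemma ratioD d a b : ratio d a -> ratio d b -> ratio d (fun n => a n + b n).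
Proof.
move=> [m [A [B [hA hB aE]]]] [m' [A' [B' [hA' hB' bE]]]].
exists (m + m')%N, (fun n => A n * B' n + A' n * B n), (fun n => B n * B' n); split.
- apply: homogeneousD; first by rewrite addnAC; exact: homogeneousM.
  by rewrite (addnC m) addnAC; exact: homogeneousM.
- exact: homogeneousM.
- move=> n; have := homogeneous_gt0 n hB; have := homogeneous_gt0 n hB'.
  by move=> /lt0r_neq0 B'0 /lt0r_neq0 B0; rewrite aE bE addf_div.
Qed.

Lemma ratioM d d' a b : ratio d a -> ratio d' b -> ratio (d + d') (fun n => a n * b n).
Proof.
move=> [m [A [B [hA hB aE]]]] [m' [A' [B' [hA' hB' bE]]]].
exists (m + m')%N, (fun n => A n * A' n), (fun n => B n * B' n); split.
- by rewrite addnACA; exact: homogeneousM.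
- exact: homogeneousM.
- by move=> n; rewrite aE bE mulf_div.
Qed.

Lemma ratio_div d d' a b : ratio (d + d') a -> ratio d' b -> ratio d (fun n => a n / b n).
Proof.
move=> [m [A [B [hA hB aE]]]] [m' [A' [B' [hA' hB' bE]]]].
exists (m + (m' + d'))%N, (fun n => A n * B' n), (fun n => B n * A' n); split.
- rewrite (_ : (_ + d)%N = (m + (d + d') + m')%N); last by lia.
  exact: homogeneousM.
- exact: homogeneousM.
- by move=> n; rewrite aE bE invf_div mulf_div.
Qed.

Lemma ratio1 : ratio 0 (fun=> 1).
Proof.
exists 0%N, (fun=> 1), (fun=> 1); split; try exact: homogeneous1.
by move=> n; rewrite divr1.
Qed.

Lemma ratio0_rate x y : ratio0 1 (fun n => q n x y).
Proof.
have [Exy|Exy] := boolP (E x y); last by left => n; rewrite q_nonedge.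
right; exists 0%N, (fun n => q n x y), (fun=> 1); split.
- exact: homogeneous_rate.
- exact: homogeneous1.
- by move=> n; rewrite divr1.
Qed.

Lemma eq_ratio0 d a b : (forall n, a n = b n) -> ratio0 d a -> ratio0 d b.
Proof. by move=> /funext ->. Qed.

Lemma eq_ratio d a b : (forall n, a n = b n) -> ratio d a -> ratio d b.
Proof. by move=> /funext ->. Qed.

Lemma ratio0D d a b : ratio0 d a -> ratio0 d b -> ratio0 d (fun n => a n + b n).
Proof.
case=> [a0|ha] [b0|hb].
- by left => n; rewrite a0 b0 addr0.
- by right; apply: eq_ratio hb => n; rewrite a0 add0r.
- by right; apply: eq_ratio ha => n; rewrite b0 addr0.
- by right; exact: ratioD.
Qed.

Lemma ratio0M d d' a b : ratio0 d a -> ratio0 d' b -> ratio0 (d + d') (fun n => a n * b n).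
Proof.
case=> [a0 _|ha]; first by left => n; rewrite a0 mul0r.
by case=> [b0|hb]; [left => n; rewrite b0 mulr0|right; exact: ratioM].
Qed.

Lemma ratio0_div d d' a b : ratio0 (d + d') a -> ratio d' b -> ratio0 d (fun n => a n / b n).
Proof.
case=> [a0 _|ha hb]; first by left => n; rewrite a0 mul0r.
by right; exact: ratio_div ha hb.
Qed.

Lemma ratio0_sum d (I : Type) (r : seq I) (P : pred I) (a : I -> nat -> R) :
  (forall i, P i -> ratio0 d (a i)) -> ratio0 d (fun n => \sum_(i <- r | P i) a i n).
Proof.
move=> ha; elim: r => [|i r IH]; first by left => n; rewrite big_nil.
have [Pi|Pi] := boolP (P i).
  by apply: eq_ratio0 (ratio0D (ha i Pi) IH) => n; rewrite big_cons Pi.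
by apply: eq_ratio0 IH => n; rewrite big_cons (negbTE Pi).
Qed.

Lemma ratio0_fraction d a c : (1 <= d)%N -> ratio0 d a -> ratio0 d c ->
  cvgn (fun n => a n / (a n + c n)).
Proof.
move=> d1 [a0 _|ha [c0|hc]].
- rewrite (_ : (fun n => _) = cst 0); first exact: is_cvg_cst.
  by apply/funext => n; rewrite a0 mul0r.
- rewrite (_ : (fun n => _) = cst 1); first exact: is_cvg_cst.
  by apply/funext => n; rewrite c0 addr0 divff// gt_eqF// (ratio_gt0 _ ha).
have [m [A [B [hA hB aE]]]] := ha; have [m' [A' [B' [hA' hB' cE]]]] := hc.
have := @homogeneous_fraction (m + m' + d) (fun n => A n * B' n) (fun n => A' n * B n).
rewrite (_ : (fun n => a n / _) = (fun n => A n * B' n / (A n * B' n + A' n * B n))).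
  apply; first by lia.
    by rewrite addnAC; exact: homogeneousM.
  by rewrite (addnC m) addnAC; exact: homogeneousM.
apply/funext => n; rewrite aE cE.
have /lt0r_neq0 B0 := homogeneous_gt0 n hB; have /lt0r_neq0 B'0 := homogeneous_gt0 n hB'.
have s0 : A n * B' n + A' n * B n != 0.
  by rewrite lt0r_neq0// addr_gt0// mulr_gt0 ?(homogeneous_gt0 _ hA) ?(homogeneous_gt0 _ hB)
     ?(homogeneous_gt0 _ hA') ?(homogeneous_gt0 _ hB').
by field; rewrite B0 B'0 s0.
Qed.

Section Trace.
Context (q_irr : forall n, irreducible (q n)).

Let q_ge0 n x y : 0 <= q n x y.
Proof. by have [/(q_edge n)/ltW//|/(q_nonedge n) ->] := boolP (E x y). Qed.

Lemma trace_ratio0 (D : {set V}) x y : x \in D -> y \in D -> x != y ->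
  ratio0 1 (fun n => trace (q n) D x y).
Proof.
elim: {D}#|~: D|%SET {-2}D (erefl #|~: D|%SET) x y => [|m IH] D Dm x y xD yD xy.
  have -> : D = [set: V]%SET.
    apply/setP => u; move/eqP: Dm; rewrite cards_eq0 => /eqP/setP/(_ u).
    by rewrite !inE => /negbFE.
  by apply: eq_ratio0 (ratio0_rate x y) => n; rewrite (trace_setT (q_ge0 n) (q_irr n)).
have /card_gt0P[z] : (0 < #|~: D|%SET)%N by rewrite Dm.
rewrite inE => zD; pose D' := (z |: D)%SET.
have D'm : #|~: D'|%SET = m.
  have -> : (~: D' = ~: D :\ z)%SET by apply/setP => u; rewrite !inE negb_or.
  by have := cardsD1 z (~: D)%SET; rewrite inE zD Dm add1n => -[].
have zD' : z \in D' by rewrite !inE eqxx.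
have DD' u : u \in D -> u \in D' by rewrite !inE => ->; rewrite orbT.
have zneq u : u \in D -> z != u by apply: contraTneq => <-.
have D0 : D != finset.set0 by apply/set0Pn; exists x.
apply: eq_ratio0 (_ : ratio0 1 (fun n => trace (q n) D' x y +
  trace (q n) D' x z * trace (q n) D' z y / \sum_(w in D) trace (q n) D' z w)).
  by move=> n; rewrite (trace_elimination (q_ge0 n) (q_irr n) zD).
apply: ratio0D; first by apply: IH => //; exact: DD'.
apply: ratio0_div.
  apply: (@ratio0M 1 1); first by apply: IH => //; [exact: DD'|rewrite eq_sym zneq].
  by apply: IH => //; [exact: DD'|exact: zneq].
(* Positivity of the exit rate from [z] excludes the identically zero alternative, so the division
   stays within the class. *)
apply: ratio_pos; last by move=> n; exact: trace_exit_gt0.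
by apply: ratio0_sum => w wD; apply: IH => //; [exact: DD'|exact: zneq].
Qed.

Lemma stationary_ratio_class (pi : nat -> V -> R) x y :
  (forall n, stationary (q n) [set: V]%SET (pi n)) -> ratio 0 (fun n => pi n x / pi n y).
Proof.
move=> pi_stat; have [->|xy] := eqVneq x y.
  apply: eq_ratio ratio1 => n; rewrite divff// gt_eqF//.
  exact: (stationary_gt0 (q_ge0 n) (q_irr n) (pi_stat n)).
have xD : x \in [set x; y]%SET by rewrite !inE eqxx.
have yD : y \in [set x; y]%SET by rewrite !inE eqxx orbT.
have H n := stationary_ratio (q_ge0 n) (q_irr n) (pi_stat n) xy.
have yx : y != x by rewrite eq_sym.
have H' n := stationary_ratio (q_ge0 n) (q_irr n) (pi_stat n) yx.
apply: eq_ratio (_ : ratio 0 (fun n => trace (q n) [set x; y]%SET y x / trace (q n) [set x; y]%SET x y)).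
  by move=> n; have [_ ->] := H n.
apply: (@ratio_div 0 1).
  apply: ratio_pos; first by apply: trace_ratio0; rewrite // eq_sym.
  by move=> n; have [+ _] := H' n; rewrite finset.setUC.
apply: ratio_pos; first exact: trace_ratio0.
by move=> n; have [] := H n.
Qed.

End Trace.

End RatioClass.

(** * Hitting events of right-continuous paths *)

Fixpoint hits_first (T : finType) (F D : {set T}) (s : seq T) : bool :=
  if s is z :: s' then (z \in F) || (z \notin D) && hits_first F D s' else false.

(** The skeleton version of the event that the first visit to [D] after the first jump takes place
    in [F]: leading letters [x] mean that no jump has been observed yet. *)
Fixpoint leaves_and_hits (T : finType) (x : T) (F D : {set T}) (s : seq T) : bool :=
  if s is z :: s' then
    if z == x then leaves_and_hits x F D s' else hits_first F D s
  else false.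

Lemma hits_first_cat (T : finType) (F D : {set T}) s t :
  hits_first F D s -> hits_first F D (s ++ t).
Proof.
by elim: s => //= z s IH /orP[->//|/andP[-> /IH ->]]; rewrite orbT.
Qed.

Lemma leaves_and_hits_cat (T : finType) x (F D : {set T}) s t :
  leaves_and_hits x F D s -> leaves_and_hits x F D (s ++ t).
Proof.
elim: s => //= z s IH; case: ifP => // _.
exact: (@hits_first_cat _ F D (z :: s)).
Qed.

Lemma hits_first_iota (T : finType) (F D : {set T}) (f : nat -> T) j n :
  (forall i, (j <= i < j + n)%N -> f i \notin D) -> f (j + n)%N \in F ->
  hits_first F D (map f (iota j n.+1)).
Proof.
elim: n j => [|n IH] j fD fF; first by rewrite addn0 in fF; rewrite /= fF.
have -> : hits_first F D (map f (iota j n.+2)) =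
  (f j \in F) || (f j \notin D) && hits_first F D (map f (iota j.+1 n.+1)) by [].
rewrite IH ?addSnnS//; first by rewrite fD ?orbT// leqnn addnS ltnS leq_addr.
by move=> i /andP[ji ijn]; rewrite fD// (ltnW ji).
Qed.

Lemma leaves_and_hits_iota (T : finType) x (F D : {set T}) (f : nat -> T) a j n :
  (forall i, (a <= i < a + j)%N -> f i = x) -> f (a + j)%N != x ->
  hits_first F D (map f (iota (a + j) n)) ->
  leaves_and_hits x F D (map f (iota a (j + n))).
Proof.
elim: j a => [|j IH] a fx fj.
  rewrite addn0 in fj *; rewrite add0n; case: n => // n /=.
  by rewrite (negbTE fj).
move=> h; rewrite addSn /= fx ?leqnn ?addnS ?ltnS ?leq_addr// eqxx.
apply: IH; rewrite ?addSnnS// => i /andP[ai ij].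
by rewrite fx// (ltnW ai).
Qed.

Lemma grid_ceil (R : realType) (s h : R) : 0 < h ->
  exists j : nat, [/\ s <= j%:R * h, forall i : nat, (i < j)%N -> i%:R * h < s &
    (0 < s -> j%:R * h < s + h) /\ (0 < s -> (0 < j)%N)].
Proof.
move=> h0; have ex : exists n : nat, s <= n%:R * h.
  exists (Num.truncn `|s / h|).+1; rewrite -ler_pdivrMr// (le_trans (ler_norm _))//.
  by rewrite ltW// truncnS_gt.
exists (ex_minn ex); case: ex_minnP => j sj jmin; split=> //.
  by move=> i ij; rewrite ltNge; apply: contraL ij; rewrite -leqNgt; exact: jmin.
have j0 : 0 < s -> (0 < j)%N.
  by case: j sj {jmin} => //; rewrite mul0r leNgt => /negP.
split=> // s0; have := j0 s0; case: j sj jmin {j0} => // j _ jmin _.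
rewrite -natr1 mulrDl mul1r ltrD2r ltNge; apply/negP => /jmin.
by rewrite ltnn.
Qed.

Section Paths.
Context (R : realType) (V : finType) (X : markov_chain R V).
Implicit Types (A B F D : {set V}) (w : sample X) (s t h : R).

Lemma right_constant w t : 0 <= t -> exists2 e : R, 0 < e &
  forall u, t <= u < t + e -> traj u w = traj t w.
Proof.
move=> t0; have /nbhs_ballP[e e0 he] := traj_right_continuous w t0.
exists e => // u /andP[tu ue]; move: tu; rewrite le_eqVlt => /orP[/eqP ->//|tu].
apply: he => //; rewrite /ball/= ltr_distlC; apply/andP; split.
  by rewrite (lt_trans _ tu)// ltrBlDr ltrDl.
exact: ue.
Qed.

(** Right-continuity makes the infimum attained: the path is constant just after it, and the set
    contains times arbitrarily close to it. *)
Lemma first_entrance (P : V -> Prop) w (a : R) : 0 <= a ->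
  [set t : R | a < t /\ P (traj t w)] !=set0 ->
  exists s, [/\ a <= s,
    ereal_inf [set t%:E | t in [set t : R | a < t /\ P (traj t w)]] = s%:E,
    P (traj s w) & forall t, a < t < s -> ~ P (traj t w)].
Proof.
set T := [set t | _] => a0 T0.
have Tlb : has_lbound T by exists a => t [/ltW].
have as_ : a <= inf T by apply: lb_le_inf => // t [/ltW].
exists (inf T); split=> //.
- exact: ereal_inf_EFin.
- have [e e0 he] := right_constant w (le_trans a0 as_).
  have [t [ta Pt] te] := inf_adherent e0 (conj T0 Tlb).
  by rewrite -(he t)// te andbT ge_inf.
- move=> t /andP[ta ts] Pt; move: ts; rewrite ltNge => /negP; apply.
  by apply: ge_inf => //; split.
Qed.

Definition skeleton (h : R) (K : nat) w : seq V :=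
  [seq traj (i%:R * h) w | i <- iota 1 K].

Lemma skeleton_leaves_and_hits x F D w s s' : 0 < s -> s <= s' ->
  (forall t, 0 < t < s -> traj t w = x) -> traj s w <> x ->
  (forall t, s <= t < s' -> traj t w \notin D) -> traj s' w \in F ->
  exists2 e : R, 0 < e & forall h, 0 < h < e ->
    exists K, leaves_and_hits x F D (skeleton h K w).
Proof.
move=> s0 ss' wx ws wD wF.
have [e1 e10 he1] := right_constant w (ltW s0).
have s'0 := lt_le_trans s0 ss'.
have [e2 e20 he2] := right_constant w (ltW s'0).
exists (Num.min e1 e2); first by rewrite lt_min e10 e20.
move=> h /andP[h0]; rewrite lt_min => /andP[h1 h2].
have [j [sj ltj [/(_ s0) jh /(_ s0) j0]]] := grid_ceil s h0.
have [k [sk ltk [/(_ s'0) kh _]]] := grid_ceil s' h0.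
have jk : (j <= k)%N.
  by rewrite leqNgt; apply/negP => /ltj; rewrite ltNge (le_trans ss' sk).
pose f (i : nat) := traj (i%:R * h) w.
(* The skeleton starts at index 1. There are [j.-1] grid points before the jump time [s], and those
   of index [j] to [k] run from the first one after [s] to the first one after [s']. The mesh is so
   small that both of these fall where the path is still constant. *)
exists (j.-1 + (k - j).+1)%N.
rewrite /skeleton; apply: (leaves_and_hits_iota (f := f)).
- move=> i /andP[i1 ij]; apply: wx; rewrite mulr_gt0 ?ltr0n//=.
  by apply: ltj; rewrite (leq_trans ij)// add1n prednK.
- rewrite add1n prednK// /f he1; first exact/eqP.
  by rewrite sj (lt_trans jh)// ltrD2l.
rewrite add1n prednK//; apply: hits_first_iota; rewrite subnKC//.
  move=> i /andP[ji ik]; apply: wD; rewrite ltk// andbT (le_trans sj)//.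
  by rewrite ler_pM2r// ler_nat.
rewrite /f he2//; by rewrite sk (lt_trans kh)// ltrD2l.
Qed.

Section Events.
Context (x : V) (A B : {set V}) (xA : x \in A) (AB : forall y, y \in A -> y \notin B).

Lemma hitting_finite w : hitting B w <> +oo%E -> exists s : R,
  [/\ 0 <= s, hitting B w = s%:E, traj s w \in B & forall t, 0 < t < s -> traj t w \notin B].
Proof.
have [T0|T0] := pselect ([set t : R | 0 < t /\ traj t w \in B] !=set0).
  move=> _; have [s [s0 e sB sP]] := first_entrance (P := fun v => v \in B) (lexx 0) T0.
  by exists s; split=> // t /sP /negP.
rewrite /hitting (_ : [set t : R | _] = set0) ?image_set0 ?ereal_inf0//.
exact/nonemptyPn.
Qed.

Lemma first_jump_finite w : first_jump w <> +oo%E -> exists s : R,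
  [/\ 0 < s, first_jump w = s%:E, traj s w <> traj 0 w &
      forall t, 0 < t < s -> traj t w = traj 0 w].
Proof.
have [T0|T0] := pselect ([set t : R | 0 < t /\ traj t w <> traj 0 w] !=set0).
  move=> _; have [s [s0 e sB sP]] :=
    first_entrance (P := fun v => v <> traj 0 w) (lexx 0) T0.
  exists s; split=> //; last by move=> t /sP /contrapT.
  rewrite lt_neqAle s0 andbT; apply/eqP => s00; by apply: sB; rewrite -s00.
rewrite /first_jump (_ : [set t : R | _] = set0) ?image_set0 ?ereal_inf0//.
exact/nonemptyPn.
Qed.

Lemma return_time_finite w : return_time A w <> +oo%E -> exists s1 s : R,
  [/\ first_jump w = s1%:E, s1 <= s, return_time A w = s%:E, traj s w \in A &
      forall t, s1 < t < s -> traj t w \notin A].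
Proof.
have [fj|fj] := pselect (first_jump w = +oo%E).
  rewrite /return_time (_ : [set t : R | _] = set0) ?image_set0 ?ereal_inf0//.
  by apply/seteqP; split=> // t [] ; rewrite fj.
have [s1 [s10 fjE _ _]] := first_jump_finite fj.
rewrite /return_time fjE.
have TE : [set t : R | (s1%:E < t%:E)%E /\ traj t w \in A] =
    [set t : R | s1 < t /\ traj t w \in A].
  by apply/funext => t /=; rewrite lte_fin.
rewrite TE.
have [T0|T0] := pselect ([set t : R | s1 < t /\ traj t w \in A] !=set0).
  move=> _; have [s [s0 e sB sP]] :=
    first_entrance (P := fun v => v \in A) (ltW s10) T0.
  by exists s1, s; split=> // t /sP /negP.
rewrite (_ : [set t : R | _] = set0) ?image_set0 ?ereal_inf0//.
exact/nonemptyPn.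
Qed.

Lemma return_time_le w s1 u : first_jump w = s1%:E -> s1 < u -> traj u w \in A ->
  (return_time A w <= u%:E)%E.
Proof.
move=> fj s1u uA; apply: ereal_inf_lbound; exists u => //=.
by rewrite fj lte_fin.
Qed.

Lemma first_jump_le w u : 0 < u -> traj u w <> traj 0 w -> (first_jump w <= u%:E)%E.
Proof. by move=> u0 uw; apply: ereal_inf_lbound; exists u. Qed.

Lemma hitting_le w u : 0 < u -> traj u w \in B -> (hitting B w <= u%:E)%E.
Proof. by move=> u0 uw; apply: ereal_inf_lbound; exists u. Qed.

(** Finite values of both times are attained, and at a common time the path would lie in the
    disjoint sets [A] and [B]. *)
Lemma hitting_eq_return w : hitting B w = return_time A w -> hitting B w = +oo%E.
Proof.
move=> e; apply: contrapT => H; have Rf := H; rewrite e in Rf.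
have [s [_ hs sB _]] := hitting_finite H.
have [s1 [s2 [_ _ rs sA _]]] := return_time_finite Rf.
by move: sB (AB sA); rewrite -[s2]/(fine s2%:E) -rs -e hs/= => ->.
Qed.

Lemma skeleton_hitting_first w : traj 0 w = x -> (hitting B w < return_time A w)%E ->
  exists2 e : R, 0 < e & forall h, 0 < h < e ->
    exists K, leaves_and_hits x B (A :|: B)%SET (skeleton h K w).
Proof.
move=> w0 HR.
have Hf : hitting B w <> +oo%E by move=> e; rewrite e ltNge leey in HR.
have [s' [s'0 Hs' s'B s'P]] := hitting_finite Hf.
have xB := AB xA.
have s'x : traj s' w <> traj 0 w by rewrite w0 => e; move: xB; rewrite -e s'B.
have {}s'0 : 0 < s'.
  by rewrite lt_neqAle s'0 andbT; apply/eqP => e; apply: s'x; rewrite -e.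
have fjs' := first_jump_le s'0 s'x.
have [|s [s0 fj sx sP]] := @first_jump_finite w; first by move=> e; rewrite e in fjs'.
have ss' : s <= s' by rewrite -lee_fin -fj.
apply: (skeleton_leaves_and_hits s0 ss') => //.
- by move=> t /sP ->.
- by rewrite -w0.
move=> t /andP[st ts']; rewrite inE negb_or; apply/andP; split; last first.
  by apply: s'P; rewrite ts' (lt_le_trans s0).
(* [return_time] counts only times strictly after the first jump, while [t] may be the jump time
   [s]. A slightly later [u], still before [s'] and still in [A], does count. *)
apply/negP => tA; have [e e0 he] := right_constant w (le_trans (ltW s0) st).
pose u := Num.min ((t + s') / 2) (t + e / 2).
have tu : t < u by rewrite lt_min midf_lt//= ltrDl divr_gt0.
have us' : u < s' by rewrite gt_min midf_lt.
have ue : u < t + e.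
  by rewrite gt_min; apply/orP; right; rewrite ltrD2l ltr_pdivrMr// ltr_pMr// ltr1n.
have uA : traj u w \in A by rewrite he ?(ltW tu)//.
have := return_time_le fj (le_lt_trans st tu) uA; rewrite leNgt => /negP; apply.
by apply: lt_trans HR; rewrite Hs' lte_fin.
Qed.

Lemma skeleton_return_first w : traj 0 w = x -> (return_time A w < hitting B w)%E ->
  exists2 e : R, 0 < e & forall h, 0 < h < e ->
    exists K, leaves_and_hits x A (A :|: B)%SET (skeleton h K w).
Proof.
move=> w0 HR.
have Rf : return_time A w <> +oo%E by move=> e; rewrite e ltNge leey in HR.
have [s [s' [fj ss' Rs' s'A s'P]]] := return_time_finite Rf.
have [|s_ [s0 fj_ sx sP]] := @first_jump_finite w; first by rewrite fj.
move: fj_; rewrite fj => -[es]; rewrite -{s_}es in s0 sx sP.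
apply: (skeleton_leaves_and_hits s0 ss') => //.
- by move=> t /sP ->.
- by rewrite -w0.
move=> t /andP[st ts']; rewrite inE negb_or; apply/andP; split; last first.
  apply/negP => tB; have := hitting_le (lt_le_trans s0 st) tB.
  rewrite leNgt => /negP; apply; apply: le_lt_trans HR.
  by rewrite Rs' lee_fin ltW.
(* [s'P] does not cover the jump time itself; there right-continuity produces a later visit to [A],
   which [s'P] forbids. *)
move: st; rewrite le_eqVlt => /orP[/eqP est|st]; last by apply: s'P; rewrite st.
apply/negP => tA; have [e e0 he] := right_constant w (ltW s0).
pose u := Num.min ((s + s') / 2) (s + e / 2).
have ss2 : s < s' by rewrite est.
have tu : s < u by rewrite lt_min midf_lt//= ltrDl divr_gt0.
have us' : u < s' by rewrite gt_min midf_lt.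
have ue : u < s + e.
  by rewrite gt_min; apply/orP; right; rewrite ltrD2l ltr_pdivrMr// ltr_pMr// ltr1n.
have uE : traj u w = traj s w by rewrite he// (ltW tu).
by have := s'P u; rewrite tu us' uE est tA => /(_ isT).
Qed.

End Events.

Section Measurability.

Lemma measurable_traj A t : 0 <= t -> measurable [set w : sample X | traj t w \in A].
Proof.
move=> t0; rewrite (_ : [set w | _] = \bigcup_(y in [set y | y \in A]) [set w | traj t w = y]).
  by apply: fin_bigcup_measurable => // y _; exact: traj_measurable.
by apply/seteqP; split=> w /=; [exists (traj t w)|move=> [y yA /= ->]].
Qed.

Lemma measurable_moved t : 0 <= t -> measurable [set w : sample X | traj t w <> traj 0 w].
Proof.
move=> t0; rewrite (_ : [set w | _] =
  ~` \bigcup_(y in [set: V]) ([set w | traj t w = y] `&` [set w | traj 0 w = y])).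
  apply: measurableC; apply: fin_bigcup_measurable => // y _.
  by apply: measurableI; exact: traj_measurable.
apply/seteqP; split=> w /=; first by move=> wt [y _ [/= e1 e2]]; apply: wt; rewrite e1 e2.
by move=> h e; apply: h; exists (traj 0 w).
Qed.

(* Right-openness of [T w] reduces the infimum to rational times. *)
Lemma measurable_inf_lt (T : sample X -> set R) (c : R) :
  (forall w t, T w t -> 0 <= t) ->
  (forall w t, T w t -> exists2 e : R, 0 < e & forall u, t <= u < t + e -> T w u) ->
  (forall t, 0 <= t -> measurable [set w | T w t]) ->
  measurable [set w | (ereal_inf [set t%:E | t in T w] < c%:E)%E].
Proof.
move=> T0 Topen mT.
rewrite (_ : [set w | _] = \bigcup_(r : rat)
    (if 0 <= (ratr r : R) < c then [set w | T w (ratr r)] else set0)).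
  apply: bigcupT_measurable_rat => r; case: ifPn => [/andP[r0 _]|_].
    exact: mT.
  exact: measurable0.
apply/seteqP; split=> w /=.
  move=> /ereal_inf_lt[_ [t Tt <-]]; rewrite lte_fin => tc.
  have [e e0 he] := Topen w t Tt.
  have [|r] := @rat_in_itvoo R t (Num.min c (t + e)).
    by rewrite lt_min tc ltrDl.
  rewrite in_itv/= lt_min => /and3P[tr rc re]; exists r => //=.
  have Tr : T w (ratr r) by apply: he; rewrite (ltW tr) re.
  by rewrite (T0 _ _ Tr) rc.
move=> [r _]; case: ifPn => // /andP[_ rc] /= Tr.
apply: (@le_lt_trans _ _ (ratr r : R)%:E); last by rewrite lte_fin.
by apply: ereal_inf_lbound; exists (ratr r).
Qed.

Lemma measurable_hitting_lt A c : measurable [set w : sample X | (hitting A w < c%:E)%E].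
Proof.
apply: measurable_inf_lt => [w t [/ltW]//|w t [t0 tA]|t t0].
  have [e e0 he] := right_constant w (ltW t0).
  by exists e => // u tu; split; [case/andP: tu => tu _; exact: lt_le_trans tu|rewrite he].
rewrite (_ : [set w | _] = if 0 < t then [set w | traj t w \in A] else set0).
  by case: ifP => _; [exact: measurable_traj|exact: measurable0].
by apply/seteqP; split=> w /=; [case=> ->|case: ifP].
Qed.

Lemma measurable_first_jump_lt c : measurable [set w : sample X | (first_jump w < c%:E)%E].
Proof.
apply: measurable_inf_lt => [w t [/ltW]//|w t [t0 tA]|t t0].
  have [e e0 he] := right_constant w (ltW t0).
  by exists e => // u tu; split; [case/andP: tu => tu _; exact: lt_le_trans tu|rewrite he].
rewrite (_ : [set w | _] = if 0 < t then [set w : sample X | traj t w <> traj 0 w] else set0).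
  by case: ifP => _; [exact: measurable_moved|exact: measurable0].
by apply/seteqP; split=> w /=; [case=> ->|case: ifP].
Qed.

Lemma first_jump_ge0 w : (0 <= first_jump w)%E.
Proof. by apply: le_ereal_inf_tmp => _ [t [/ltW t0 _] <-]; rewrite lee_fin. Qed.

Lemma measurable_return_lt A c : measurable [set w : sample X | (return_time A w < c%:E)%E].
Proof.
apply: measurable_inf_lt => [w t [ft _]|w t [ft tA]|t t0].
- by rewrite -lee_fin (le_trans (first_jump_ge0 w))// ltW.
- have t0 : 0 <= t by rewrite -lee_fin (le_trans (first_jump_ge0 w))// ltW.
  have [e e0 he] := right_constant w t0.
  exists e => // u tu; split; last by rewrite he.
  by apply: lt_le_trans ft _; rewrite lee_fin; case/andP: tu.
rewrite (_ : [set w | _] = [set w | (first_jump w < t%:E)%E] `&` [set w | traj t w \in A])//.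
by apply: measurableI; [exact: measurable_first_jump_lt|exact: measurable_traj].
Qed.

Lemma measurable_lt_of_rat (f g : sample X -> \bar R) :
  (forall c : R, measurable [set w | (f w < c%:E)%E]) ->
  (forall c : R, measurable [set w | (g w < c%:E)%E]) ->
  measurable [set w | (f w < g w)%E].
Proof.
move=> mf mg.
rewrite (_ : [set w | _] = \bigcup_(r : rat)
    ([set w | (f w < (ratr r : R)%:E)%E] `&` ~` [set w | (g w < (ratr r : R)%:E)%E])).
  by apply: bigcupT_measurable_rat => r; apply: measurableI => //; exact: measurableC.
apply/seteqP; split=> w /=; last first.
  by move=> [r _ [/= fr /negP]]; rewrite -leNgt; exact: lt_le_trans.
have rat1 (a b : R) : a < b -> exists r : rat, a < ratr r < b.
  by move=> /rat_in_itvoo[r]; rewrite in_itv; exists r.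
suff h : (f w < g w)%E -> exists r : rat, (f w < (ratr r : R)%:E <= g w)%E.
  move=> /h[r /andP[fr rg]]; exists r => //; split=> //=.
  by apply/negP; rewrite -leNgt.
case: (f w) (g w) => [a||] [b||] //=.
- rewrite lte_fin => /rat1[r /andP[ar rb]]; exists r.
  by rewrite lte_fin lee_fin ar ltW.
- have [|r /andP[ar rb]] := rat1 a (a + 1); first by rewrite ltrDl.
  by exists r; rewrite lte_fin ar leey.
- have [|r /andP[ar rb]] := rat1 (b - 1) b; first by rewrite ltrBlDr ltrDl.
  by exists r; rewrite ltNyr lee_fin ltW.
- by exists 0; rewrite ltNyr leey.
Qed.

End Measurability.

End Paths.

Lemma cvg_dist_bound (R : realType) (u b : nat -> R) (l : R) :
  (forall n, `|u n - l| <= b n) -> b n @[n --> \oo] --> 0 -> u n @[n --> \oo] --> l.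
Proof.
move=> ub b0; apply/cvgrPdist_le => e e0.
have /cvgrPdist_le/(_ e e0) := b0; apply: filterS => n.
rewrite sub0r normrN distrC => /(le_trans (ler_norm _)); exact: le_trans.
Qed.

(** * Laws of skeleton words *)

Section WordLaw.
Context (R : realType) (V : finType) (X : markov_chain R V).
Implicit Types (A B F D : {set V}) (h : R) (g : seq V -> bool).

Local Notation q := (rate X).
Hypothesis q_ge0 : forall x y, 0 <= q x y.

Fixpoint word_prob h (K : nat) g (z : V) : R :=
  if K is K'.+1 then \sum_z' transition q h z z' * word_prob h K' (fun s => g (z' :: s)) z'
  else (g [::])%:R.

Lemma word_prob_le1 h K g z : 0 <= h -> word_prob h K g z <= 1.
Proof.
move=> h0; elim: K g z => [|K IH] g z /=; first by case: (g _).
rewrite -(transition_sum1 q h z) ler_sum// => y _.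
by rewrite ler_piMr// ?transition_ge0.
Qed.

Lemma word_prob_false h K z : word_prob h K (fun=> false) z = 0.
Proof. by elim: K z => [//|K IH] z /=; rewrite big1// => y _; rewrite IH mulr0. Qed.

(** A supermartingale bound: [f] is a supersolution for the skeleton off [D] and is at least 1 on
    the target. The induction on the length of the word stops at the first letter in [D]. *)
Lemma hits_first_word_bound F D (f : V -> R) h K z : 0 <= h ->
  (forall z, 0 <= f z) -> (forall z, z \in F -> 1 <= f z) ->
  (forall z, z \notin D -> semigroup q h f z <= f z) ->
  word_prob h K (fun s => hits_first F D (z :: s)) z <= f z.
Proof.
move=> h0 f0 f1 fD.
elim: K z => [|K IH] z /=.
  by rewrite andbF orbF; have [/f1|_] := boolP (z \in F).
have [zF|zF] := boolP (z \in F).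
  apply: le_trans (f1 z zF); exact: (@word_prob_le1 h K.+1 (fun=> true) z h0).
have [zD|zD] := boolP (z \in D).
  by rewrite big1// => y _; rewrite word_prob_false mulr0.
apply: le_trans (fD z zD); rewrite semigroupE ler_sum// => y _.
by rewrite ler_wpM2l ?transition_ge0//; exact: IH.
Qed.

(** The last hypothesis says that, given a step that leaves [x], the mean of [f] is at most [c]. A
    step that stays at [x] repeats the problem with one letter fewer. *)
Lemma leaves_and_hits_word_bound x F D (f : V -> R) (c : R) h K : 0 <= h -> 0 <= c ->
  (forall z, 0 <= f z) -> (forall z, z \in F -> 1 <= f z) ->
  (forall z, z \notin D -> semigroup q h f z <= f z) ->
  \sum_(z | z != x) transition q h x z * f z <= (1 - transition q h x x) * c ->
  word_prob h K (leaves_and_hits x F D) x <= c.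
Proof.
move=> h0 c0 f0 f1 fD fc; elim: K => [//|K IH] /=.
rewrite (bigD1 x)//= eqxx.
rewrite (_ : c = transition q h x x * c + (1 - transition q h x x) * c); last by ring.
apply: lerD; first by apply: ler_wpM2l; [exact: transition_ge0|exact: IH].
apply: le_trans fc; rewrite ler_sum// => z /negbTE ->.
by rewrite ler_wpM2l ?transition_ge0//; exact: hits_first_word_bound.
Qed.

Lemma measurable_word g h a K : 0 <= h ->
  measurable [set w : sample X | g (map (fun i : nat => traj (i%:R * h) w) (iota a K))].
Proof.
move=> h0; elim: K a g => [|K IH] a g /=.
  by case: (g [::]); [rewrite (_ : mkset _ = setT)//|rewrite (_ : mkset _ = set0)//];
    apply/seteqP; split.
rewrite (_ : [set w | _] = \bigcup_(z in [set: V]) ([set w | traj (a%:R * h) w = z] `&`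
  [set w : sample X | g (z :: map (fun i : nat => traj (i%:R * h) w) (iota a.+1 K))])).
  apply: fin_bigcup_measurable => // z _; apply: measurableI.
    by apply: traj_measurable; rewrite mulr_ge0.
  exact: (IH a.+1 (fun s => g (z :: s))).
apply/seteqP; split=> w /=; first by exists (traj (a%:R * h) w).
by move=> [z _ [/= -> ]].
Qed.

Lemma measure_split d (S : measurableType d) (P : probability S R) (f : S -> V) (E : set S) :
  measurable E -> (forall z, measurable [set w | f w = z]) ->
  P E = (\sum_z P (E `&` [set w | f w = z]))%E.
Proof.
move=> mE mf.
suff h (s : seq V) : uniq s ->
    P (E `&` [set w | f w \in s]) = (\sum_(z <- s) P (E `&` [set w | f w = z]))%E /\
    measurable (E `&` [set w | f w \in s]).
  have [+ _] := h (index_enum V) (index_enum_uniq V).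
  rewrite (_ : E `&` _ = E)//; apply/seteqP; split=> [w []//|w Ew]; split=> //=.
  exact: mem_index_enum.
elim: s => [_|z s IH /= /andP[zs us]].
  rewrite big_nil (_ : _ `&` _ = set0) ?measure0; first by split.
  by apply/seteqP; split=> [w []//|].
have [IHE IHm] := IH us.
have -> : E `&` [set w | f w \in z :: s] =
    (E `&` [set w | f w = z]) `|` (E `&` [set w | f w \in s]).
  apply/seteqP; split=> w /=.
    by move=> [Ew]; rewrite inE => /orP[/eqP|]; [left|right].
  by move=> [[Ew /= ->]|[Ew /= ws]]; split=> //; rewrite inE ?eqxx// ws orbT.
split; last by apply: measurableU => //; exact: measurableI.
rewrite big_cons -IHE measureU//; first exact: measurableI.
apply/seteqP; split=> // w [[_ /= wz] [_ /= ws]].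
by move: zs; rewrite -wz ws.
Qed.

(** The prescribed positions up to [j] make the induction on [K] possible: splitting according to
    the next letter moves it from the word into the cylinder, whose law [traj_markov] gives. *)
Lemma cylinder_word_law h K g (y : nat -> V) j : 0 <= h ->
  law X (y 0%N) [set w | (forall i, (i <= j)%N -> traj (i%:R * h) w = y i) /\
    g (map (fun i : nat => traj (i%:R * h) w) (iota j.+1 K))] =
  ((\prod_(i < j) transition q h (y i) (y i.+1)) * word_prob h K g (y j))%:E.
Proof.
move=> h0; elim: K g y j => [|K IH] g y j.
  rewrite /=; case: (g [::]); last first.
    by rewrite mulr0 (_ : mkset _ = set0) ?measure0//; apply/seteqP; split=> w // [].
  rewrite mulr1 (_ : mkset _ = [set w | forall i, (i <= j)%N -> traj (i%:R * h) w = y i]).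
    rewrite (@traj_markov _ _ X j (fun i => i%:R * h)) ?mul0r//.
      congr (_%:E); apply: eq_bigr => i _; congr (transition _ _ _ _).
      by rewrite -mulrBl -natrB// subSnn mul1r.
    by move=> i k ik; rewrite ler_wpM2r// ler_nat.
  by apply/seteqP; split=> w //= [].
have cylm k (z : nat -> V) : measurable [set w : sample X | forall i, (i <= k)%N -> traj (i%:R * h) w = z i].
  rewrite (_ : mkset _ = \bigcap_(i in [set i | (i <= k)%N]) [set w | traj (i%:R * h) w = z i]) //.
  apply: bigcap_measurable; first by exists 0%N.
  by move=> i _; apply: traj_measurable; rewrite mulr_ge0.
rewrite (@measure_split _ _ _ (traj (j.+1%:R * h))); last 2 first.
- by apply: measurableI; [exact: cylm|exact: measurable_word].
- by move=> z; apply: traj_measurable; rewrite mulr_ge0.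
rewrite mulr_sumr -sumEFin; apply: eq_bigr => z _.
pose y' i := if (i <= j)%N then y i else z.
have y'0 : y' 0%N = y 0%N by [].
have y'j : y' j = y j by rewrite /y' leqnn.
have y'S : y' j.+1 = z by rewrite /y' ltnn.
have := IH (fun s => g (z :: s)) y' j.+1; rewrite y'0.
rewrite big_ord_recr/= y'j y'S.
have -> : \prod_(i < j) transition q h (y' i) (y' i.+1) =
    \prod_(i < j) transition q h (y i) (y i.+1).
  by apply: eq_bigr => i _; rewrite /y' (ltnW (ltn_ord i)) ltn_ord.
rewrite -mulrA => <-; congr (law X _ _); apply/seteqP; split=> w /=.
  move=> [[wy wg] wz]; split; last by rewrite -wz.
  move=> i; rewrite leq_eqVlt => /orP[/eqP ->|]; first by rewrite /y' ltnn.
  by rewrite ltnS => ij; rewrite /y' ij wy.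
move=> [wy wg].
have wz : traj (j.+1%:R * h) w = z by rewrite wy// /y' ltnn.
split=> //; split; last by rewrite wz.
by move=> i ij; rewrite wy ?(leq_trans ij)// /y' ij.
Qed.

Lemma word_law x h K g : 0 <= h ->
  law X x [set w | traj 0 w = x /\ g (skeleton h K w)] = (word_prob h K g x)%:E.
Proof.
move=> h0; have := @cylinder_word_law h K g (fun=> x) 0%N h0.
rewrite big_ord0 mul1r => <-; congr (law X x _); apply/seteqP; split=> w /= [w0 wg];
  split=> //.
  by move=> i; rewrite leqn0 => /eqP ->; rewrite mul0r.
by have := w0 0%N isT; rewrite mul0r.
Qed.

Lemma law_start x : law X x [set w | traj 0 w = x] = 1%E.
Proof.
have := @word_law x 0 0 (fun=> true) (lexx 0); rewrite /= => <-.
by congr (law X x _); apply/seteqP; split=> w //= [].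
Qed.

(** [traj_markov] describes events that prescribe the position at time 0; the paths that do not
    start at [x] form a null set. *)
Lemma ptransE t x y : 0 <= t -> ptrans X t x y = transition q t x y.
Proof.
move=> t0; rewrite /ptrans -(@fineK _ (law X x _)); last first.
  by apply: fin_num_measure; exact: traj_measurable.
have h1 : law X x [set w | traj t w = y] =
    law X x [set w | traj 0 w = x /\ (fun s => s == [:: y]) (skeleton t 1 w)].
  rewrite [LHS](@measure_split _ _ _ (traj 0)); last 2 first.
  - exact: traj_measurable.
  - by move=> z; exact: traj_measurable.
  rewrite (bigD1 x)//= big1 ?adde0; last first.
    move=> z zx; apply/eqP; rewrite -measure_le0.
    apply: (@le_trans _ _ (law X x (~` [set w | traj 0 w = x]))).
      apply: le_measure; rewrite ?inE.
      - by apply: measurableI; exact: traj_measurable.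
      - by apply: measurableC; exact: traj_measurable.
      - by move=> w [_ /= ->]; exact/eqP.
    by rewrite probability_setC ?law_start ?subee//; exact: traj_measurable.
  congr (law X x _); apply/seteqP; split=> w /=.
    by move=> [wy wx]; split=> //; rewrite /skeleton/= mul1r wy.
  by rewrite /skeleton/= mul1r => -[wx /eqP[]].
rewrite fineK; last by apply: fin_num_measure; exact: traj_measurable.
rewrite h1 (@word_law x t 1 (fun s => s == [:: y]))//= (bigD1 y)//= eqxx mulr1 big1 ?addr0// => z zy.
by rewrite eqseq_cons (negbTE zy) mulr0.
Qed.

Lemma measurable_hitting_infty B : measurable [set w : sample X | hitting B w = +oo%E].
Proof.
rewrite (_ : mkset _ = ~` \bigcup_(n : nat) [set w | (hitting B w < n%:R%:E)%E]).
  by apply: measurableC; apply: bigcupT_measurable => n; exact: measurable_hitting_lt.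
apply/seteqP; split=> w /= H.
  by move=> [n _ /=]; rewrite H ltNge leey.
apply: contrapT => /hitting_finite[s [_ sE _ _]]; apply: H.
exists (Num.truncn `|s|).+1 => //=; rewrite sE lte_fin (le_lt_trans (ler_norm _))//.
exact: truncnS_gt.
Qed.

(** A path that never hits [B] avoids it at all positive integer times, and each unit step enters a
    given point of [B] with probability at least [e]. *)
Lemma never_hit_null x B : (exists y, y \in B) -> irreducible q ->
  law X x [set w | traj 0 w = x /\ hitting B w = +oo%E] = 0.
Proof.
move=> [b bB] q_irr.
have [e /andP[e0 e1] eB] := @fin_lower _ _ xpredT (fun z => transition q 1 z b)
  (fun z _ => transition_gt0 q_ge0 ltr01 (q_irr z b)).
pose g s := all (fun z => z \notin B) s.
have gcons y : (fun s => g (y :: s)) = if y \in B then fun=> false else g.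
  by apply/funext => s; rewrite /g /=; case: (y \in B).
have bound K z : word_prob 1 K g z <= (1 - e) ^+ K.
  elim: K z => [|K IH] z; first by rewrite expr0.
  rewrite [leLHS](_ : _ = \sum_y transition q 1 z y *
    word_prob 1 K (if y \in B then fun=> false else g) y); last first.
    by apply: eq_bigr => y _; rewrite gcons.
  rewrite (bigD1 b)//= bB word_prob_false mulr0 add0r.
  apply: (@le_trans _ _ (\sum_(y | y != b) transition q 1 z y * (1 - e) ^+ K)).
    rewrite ler_sum// => y _; rewrite ler_wpM2l ?transition_ge0//.
    by case: ifP => _; rewrite ?IH// word_prob_false exprn_ge0// subr_ge0.
  rewrite -mulr_suml exprS ler_wpM2r ?exprn_ge0// ?subr_ge0//.
  rewrite lerBrDr -[leRHS](transition_sum1 q 1 z) [leRHS](bigD1 b)//= addrC.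
  by apply: lerD => //; exact: eB.
have mE : measurable [set w : sample X | traj 0 w = x /\ hitting B w = +oo%E].
  by apply: measurableI; [exact: traj_measurable|exact: measurable_hitting_infty].
have PK K : (law X x [set w | traj 0 w = x /\ hitting B w = +oo%E] <= ((1 - e) ^+ K)%:E)%E.
  apply: (@le_trans _ _ (word_prob 1 K g x)%:E); last by rewrite lee_fin bound.
  rewrite -word_law//; apply: le_measure; rewrite ?inE//.
    by apply: measurableI; [exact: traj_measurable|exact: measurable_word].
  move=> w /= [w0 H]; split=> //; apply/allP => z /mapP[i].
  rewrite mem_iota => /andP[i1 _] ->; rewrite mulr1; apply/negP => wB.
  have := @hitting_le _ _ X B w i%:R; rewrite ltr0n => /(_ i1 wB).
  by rewrite H leNgt ltry.
have g0 : 1 * (1 - e) ^+ K @[K --> \oo] --> (0 : R).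
  by apply: cvg_geometric; rewrite ger0_norm ?subr_ge0// ltrBlDr ltrDl.
have Pfin : law X x [set w | traj 0 w = x /\ hitting B w = +oo%E] \is a fin_num.
  exact: fin_num_measure.
have P0 : (0 <= law X x [set w | traj 0%R w = x /\ hitting B w = +oo%E])%E.
  exact: measure_ge0.
move: Pfin PK P0; case: (law X x _) => // p _ PK; rewrite lee_fin => p0.
apply/eqP; rewrite eqe eq_le p0 andbT.
by apply: (cvgr_to_ge g0); apply: nearW => K; rewrite mul1r -lee_fin.
Qed.

End WordLaw.

Lemma measure_bigcup_le d (S : measurableType d) (R : realType) (P : probability S R)
    (F : nat -> set S) (v : \bar R) :
  (forall n, measurable (F n)) -> {homo F : n m / (n <= m)%N >-> (n <= m)%O} ->
  (forall n, (P (F n) <= v)%E) -> (P (\bigcup_n F n) <= v)%E.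
Proof.
move=> mF hF Pv; apply: (cvge_to_le (nondecreasing_cvg_mu mF (bigcupT_measurable _ mF) hF)).
by apply: nearW => n; exact: Pv.
Qed.

(** * Capacities and trace rates through harmonic extensions *)

Section HittingLaw.
Context (R : realType) (V : finType) (X : markov_chain R V).
Implicit Types (A B F D : {set V}) (h : R).

Local Notation q := (rate X).
Hypothesis q_ge0 : forall x y, 0 <= q x y.
Hypothesis q_irr : irreducible q.
Hypothesis q_diag : forall x, q x x = 0.
Hypothesis q_jumps : forall x, 0 < holding_rate X x.

Lemma transition_diag_lt1 h x : 0 < h -> transition q h x x < 1.
Proof.
move=> h0; have [y] : exists y, 0 < q x y.
  apply/not_existsP => H; have := q_jumps x; rewrite /holding_rate big1 ?ltxx// => y _.
  by apply/eqP; rewrite eq_le q_ge0 andbT leNgt; apply/negP/H.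
have [->|yx] := eqVneq y x; first by rewrite q_diag ltxx.
move=> _; rewrite -(transition_sum1 q h x) [ltRHS](bigD1 x)//= ltrDl.
rewrite (bigD1 y)//= ltr_pwDl//; first exact: transition_gt0.
by apply: sumr_ge0 => z _; apply: transition_ge0 => //; exact: ltW.
Qed.

Lemma escape_rate_cvg x :
  (1 - transition q n.+1%:R^-1 x x) / n.+1%:R^-1 @[n --> \oo] --> holding_rate X x.
Proof.
pose d (u : V) : R := (u == x)%:R.
have [B B0 hB] := fin_bound (generator q (generator q d)).
apply: (@cvg_dist_bound _ _ (fun n => B * n.+1%:R^-1)).
  move=> n; set h := n.+1%:R^-1.
  have h0 : 0 < h by rewrite invr_gt0.
  have := semigroup_taylor q_ge0 x (ltW h0) hB.
  have -> : generator q d x = - holding_rate X x.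
    rewrite /generator /holding_rate -sumrN; apply: eq_bigr => y _.
    rewrite /d eqxx; have [->|yx] := eqVneq y x; first by rewrite q_diag mul0r oppr0.
    by rewrite sub0r mulrN1.
  rewrite -transitionE /d eqxx.
  set p := transition q h x x => tay.
  have -> : (1 - p) / h - holding_rate X x =
      - (p - 1 - h * - holding_rate X x) / h by field; rewrite gt_eqF.
  rewrite normrM normrN normfV (gtr0_norm h0) ler_pdivrMr// -mulrA -expr2.
  exact: tay.
rewrite -[X in _ --> X](mulr0 B); apply: cvgM; [exact: cvg_cst|exact: cvg_harmonic].
Qed.

(** The bound is the mean of the harmonic extension just after the first jump. It is obtained for
    the skeleton of mesh [h] from a supersolution and passed to the limit as [h] tends to 0. *)
Lemma hit_bound x F D (E : set (sample X)) : F \subset D -> x \in D ->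
  measurable E -> E `<=` [set w | traj 0 w = x] ->
  (forall w, E w -> exists2 e : R, 0 < e & forall h, 0 < h < e ->
     exists K, leaves_and_hits x F D (skeleton h K w)) ->
  (law X x E <= (harm q D (fun u => (u \in F)%:R) x +
     generator q (harm q D (fun u => (u \in F)%:R)) x / holding_rate X x)%:E)%E.
Proof.
move=> FD xD mE E0 Eskel; set hF := harm q D _.
have D0 : D != finset.set0 by apply/set0Pn; exists x.
have hF0 z : 0 <= hF z by apply: harm_ge0 => // u _; rewrite ler0n.
have hF1 z : z \in F -> hF z = 1.
  by move=> zF; rewrite /hF harm_in ?zF//; exact: (fintype.subsetP FD).
(* [g] is the mean hitting time of [D]. The function [hF] is harmonic for [L] but not for a step of
   length [h], which costs up to [k h ^ 2]; adding [k h g] lowers the generator off [D] by [k h] and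
   pays exactly for this. *)
have [g [gD gL]] := dirichlet q_ge0 q_irr (fun=> -1) (fun=> 0) D0.
have g0 z : 0 <= g z.
  apply: (@min_principle _ _ _ q_ge0 q_irr D) => // u uD; last by rewrite gD.
  by rewrite gL// lerN10.
have [B1 B10 hB1] := fin_bound (generator q (generator q hF)).
have [B2 B20 hB2] := fin_bound (generator q (generator q g)).
pose k := B1 + 1; have k0 : 0 < k by rewrite ltr_wpDl.
pose f h z := hF z + k * h * g z.
have fL h z : generator q (f h) z = generator q hF z + k * h * generator q g z.
  by rewrite /f generatorD generatorZ.
(* [k] has to bound the iterated generator of [f h], in which it occurs itself. For [h <= h0] the
   part [k h B2] is at most 1, so [k = B1 + 1] is enough. *)
pose h0 := (k * B2 + 1)^-1.
have h00 : 0 < h0 by rewrite invr_gt0 ltr_wpDl// mulr_ge0// ltW.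
have tay h z : 0 < h -> h <= h0 ->
    semigroup q h (f h) z <= f h z + h * generator q (f h) z + k * h ^+ 2.
  move=> hpos hh0.
  have LL u : `|generator q (generator q (f h)) u| <= k.
    rewrite (_ : generator q (f h) = fun z => generator q hF z + k * h * generator q g z).
      rewrite generatorD generatorZ (le_trans (ler_normD _ _))// /k lerD//.
      rewrite normrM gtr0_norm ?mulr_gt0//.
      apply: (@le_trans _ _ (k * h * B2)); first by rewrite ler_wpM2l// ltW// mulr_gt0.
      apply: (@le_trans _ _ (h0 * (k * B2 + 1))).
        rewrite mulrAC mulrC ler_pM ?(ltW hpos)//; first by rewrite mulr_ge0// ltW.
        by rewrite lerDl.
      by rewrite /h0 mulVf// gt_eqF// ltr_wpDl// mulr_ge0// ltW.
    by apply/funext => v; rewrite fL.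
  have := semigroup_taylor q_ge0 z (ltW hpos) LL.
  move/(le_trans (ler_norm _)); lra.
pose p h := transition q h x x.
(* The Taylor bound for the sum over the steps that leave [x], divided by [1 - p h]. It converges
   because [(1 - p h) / h] tends to the holding rate. *)
pose c h := hF x + (generator q hF x + k * h * generator q g x + k * h) / ((1 - p h) / h).
have bound h K : 0 < h -> h <= h0 -> word_prob X h K (leaves_and_hits x F D) x <= c h.
  move=> hpos hh0.
  have p1 : 0 < 1 - p h by rewrite subr_gt0 transition_diag_lt1.
  have f0 z : 0 <= f h z by rewrite /f addr_ge0// mulr_ge0// ltW// mulr_gt0.
  have num : \sum_(z | z != x) transition q h x z * f h z <= (1 - p h) * c h.
    have := tay h x hpos hh0; rewrite semigroupE (bigD1 x)//= -/(p h) fL.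
    have -> : (1 - p h) * c h = (1 - p h) * hF x +
        h * (generator q hF x + k * h * generator q g x + k * h).
      by rewrite /c; field; rewrite !gt_eqF.
    have -> : f h x = hF x by rewrite /f gD// mulr0 addr0.
    rewrite expr2; lra.
  have c0 : 0 <= c h.
    rewrite -(pmulr_rge0 _ p1); apply: le_trans num.
    by apply: sumr_ge0 => z _; rewrite mulr_ge0// transition_ge0// ltW.
  apply: (@leaves_and_hits_word_bound _ _ _ q_ge0 x F D (f h)) => //.
  - exact: ltW.
  - by move=> z zF; rewrite /f hF1// lerDl mulr_ge0// ltW// mulr_gt0.
  move=> z zD; apply: le_trans (tay h z hpos hh0) _.
  by rewrite fL gL// /hF harm_off// expr2; lra.
pose h_ (n : nat) : R := n.+1%:R^-1.
have h_gt0 n : 0 < h_ n by rewrite invr_gt0.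
have h_small e : 0 < e -> exists N, forall n, (N <= n)%N -> h_ n < e.
  move=> e0; have /cvgrPdist_lt/(_ e e0)[N _ hN] := @cvg_harmonic R.
  by exists N => n /hN/=; rewrite sub0r normrN gtr0_norm.
pose G n := \bigcup_K [set w : sample X | traj 0 w = x /\ leaves_and_hits x F D (skeleton (h_ n) K w)].
have mGK n K : measurable [set w : sample X | traj 0 w = x /\ leaves_and_hits x F D (skeleton (h_ n) K w)].
  by apply: measurableI; [exact: traj_measurable|apply: measurable_word; exact: ltW].
have mG n : measurable (G n) by exact: bigcupT_measurable.
have [N0 hN0] := h_small h0 h00.
have PG n : (N0 <= n)%N -> (law X x (G n) <= (c (h_ n))%:E)%E.
  move=> nN; apply: measure_bigcup_le => //.
    move=> K K' KK'; apply/subsetPset => w /= [w0 wl]; split=> //.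
    rewrite /skeleton -(subnKC KK') iotaD map_cat.
    exact: leaves_and_hits_cat.
  move=> K; have e := word_law X x K (leaves_and_hits x F D) (ltW (h_gt0 n)).
  by rewrite e lee_fin bound// ltW// hN0.
(* Each path of [E] is detected by all fine enough skeletons, so [E] lies in the lower limit of the
   events [G n], whose probability is at most the limit of the bounds. *)
pose C N := \bigcap_(n in [set n | (N <= n)%N]) G n.
have mC N : measurable (C N).
  apply: bigcap_measurable => [|n _]; last exact: mG.
  by exists N => /=.
have EC : E `<=` \bigcup_N C N.
  move=> w Ew; have [e e0 he] := Eskel w Ew; have [N hN] := h_small e e0.
  exists N => // n /= Nn; have [|K wK] := he (h_ n).
    by rewrite h_gt0 hN.
  by exists K => //; split=> //; exact: E0.
apply: (@le_trans _ _ (law X x (\bigcup_N C N))).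
  by apply: le_measure; rewrite ?inE//; exact: bigcupT_measurable.
apply: measure_bigcup_le => //.
  move=> N N' NN'; apply/subsetPset => w /= Cw n /= N'n; apply: Cw => /=.
  exact: leq_trans N'n.
move=> N.
have ccvg : c (h_ n) @[n --> \oo] --> hF x + generator q hF x / holding_rate X x.
  have hz : h_ n @[n --> \oo] --> (0 : R) by exact: cvg_harmonic.
  have -> : generator q hF x = generator q hF x + k * 0 * generator q g x + k * 0.
    by rewrite mulr0 mul0r !addr0.
  apply: cvgD; first exact: cvg_cst.
  apply: cvgM; last by apply: cvgV; [rewrite gt_eqF|exact: escape_rate_cvg].
  apply: cvgD; last by apply: cvgM; [exact: cvg_cst|].
  apply: cvgD; first exact: cvg_cst.
  by apply: cvgM; [apply: cvgM; [exact: cvg_cst|]|exact: cvg_cst].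
have Cfin : law X x (C N) \is a fin_num by exact: fin_num_measure.
rewrite -(fineK Cfin) lee_fin; apply: (cvgr_to_ge ccvg).
exists (maxn N N0) => // n /=; rewrite geq_max => /andP[Nn N0n].
rewrite -lee_fin (fineK Cfin); apply: le_trans (PG n N0n).
by apply: le_measure; rewrite ?inE// => w /(_ n); exact.
Qed.

Lemma law_start_setI x (E : set (sample X)) : measurable E ->
  law X x E = law X x ([set w | traj 0 w = x] `&` E).
Proof.
set start := [set w | _]; have mstart : measurable start by exact: traj_measurable.
move=> mE; have -> : E = (start `&` E) `|` (~` start `&` E).
  by rewrite -setIUl setUCr setTI.
rewrite measureU; last 3 first.
- exact: measurableI.
- by apply: measurableI => //; exact: measurableC.
- by rewrite setIACA setICr set0I.
rewrite -[in RHS]setIUl setUCr setTI [X in (_ + X)%E](_ : _ = 0) ?adde0//.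
apply/eqP; rewrite -measure_le0.
apply: (@le_trans _ _ (law X x (~` start))).
  apply: le_measure; rewrite ?inE; last by move=> w [].
  - by apply: measurableI => //; exact: measurableC.
  - exact: measurableC.
by rewrite probability_setC// law_start// subee.
Qed.

Lemma measurable_hitting_eq_return A B :
  measurable [set w : sample X | hitting B w = return_time A w].
Proof.
have -> : [set w : sample X | hitting B w = return_time A w] =
    ~` ([set w | (hitting B w < return_time A w)%E] `|`
        [set w | (return_time A w < hitting B w)%E]).
  apply/seteqP; split=> w /=; first by move=> e [] /=; rewrite e ltxx.
  move=> h; apply/eqP; rewrite eq_le !leNgt; apply/andP; split; apply/negP => h'; apply: h.
    by right.
  by left.
apply: measurableC; apply: measurableU; apply: measurable_lt_of_rat => c;
  by [exact: measurable_hitting_lt|exact: measurable_return_lt].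
Qed.

(** A path starting outside [B] must jump before or when it hits [B]. The strict inequality in
    [return_time] does not change the infimum, since the path remains in [B] for a while. *)
Lemma hitting_return B (w : sample X) : traj 0 w \notin B -> hitting B w = return_time B w.
Proof.
move=> wB; apply/eqP; rewrite eq_le; apply/andP; split.
  apply: ereal_inf_le_tmp => _ [t [ft tB] <-]; exists t => //; split=> //.
  by rewrite -lte_fin; apply: le_lt_trans ft; exact: first_jump_ge0.
have [->|H] := pselect (hitting B w = +oo%E); first by rewrite leey.
have [s [s0 Hs sB _]] := hitting_finite H.
have sw : traj s w <> traj 0 w by move=> e; move: wB; rewrite -e sB.
have {}s0 : 0 < s by rewrite lt_neqAle s0 andbT; apply/eqP => e; apply: sw; rewrite -e.
have [|s1 [s10 fj _ _]] := @first_jump_finite _ _ _ w.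
  by move=> e; have := first_jump_le s0 sw; rewrite e.
have s1s : s1 <= s by have := first_jump_le s0 sw; rewrite fj lee_fin.
have [e e0 he] := right_constant w (ltW s0).
rewrite Hs; apply/lee_addgt0Pr => d d0.
pose u := s + Num.min (d / 2) (e / 2).
have su : s < u by rewrite ltrDl lt_min !divr_gt0.
have ue : u < s + e.
  by rewrite ltrD2l gt_min; apply/orP; right; rewrite ltr_pdivrMr// ltr_pMr// ltr1n.
have ud : u <= s + d.
  by rewrite lerD2l ge_min; apply/orP; left; rewrite ler_pdivrMr// ler_pMr// ler1n.
apply: (@le_trans _ _ u%:E); last by rewrite -EFinD lee_fin.
by apply: return_time_le fj (le_lt_trans s1s su) _; rewrite he// (ltW su).
Qed.

Lemma return_time_setU A A' (w : sample X) :
  return_time (A :|: A')%SET w = Order.min (return_time A w) (return_time A' w).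
Proof.
apply/eqP; rewrite eq_le; apply/andP; split.
  rewrite le_min; apply/andP; split; apply: ereal_inf_le_tmp => _ [t [ft tB] <-];
    exists t => //; split=> //; by rewrite inE tB ?orbT.
apply: le_ereal_inf_tmp => _ [t [ft tB] <-]; move: tB.
rewrite inE ge_min => /orP[tA|tA]; apply/orP; [left|right];
  by apply: ereal_inf_lbound; exists t.
Qed.

Section Formulas.
Context (x : V) (A B : {set V}) (xA : x \in A) (AB : forall y, y \in A -> y \notin B)
  (B0 : B != finset.set0).

Let D := (A :|: B)%SET.
Let hB := harm q D (fun u => (u \in B)%:R).
Let hA := harm q D (fun u => (u \in A)%:R).

Let start := [set w : sample X | traj 0 w = x].
Let EB := [set w : sample X | (hitting B w < return_time A w)%E].
Let EA := [set w : sample X | (return_time A w < hitting B w)%E].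

Let mstart : measurable start. Proof. exact: traj_measurable. Qed.

Let mEB : measurable EB.
Proof.
by apply: measurable_lt_of_rat => c; [exact: measurable_hitting_lt|exact: measurable_return_lt].
Qed.

Let mEA : measurable EA.
Proof.
by apply: measurable_lt_of_rat => c; [exact: measurable_return_lt|exact: measurable_hitting_lt].
Qed.

(** The extensions of the indicators of [A] and [B] sum to 1, so [hit_bound] gives [v] for one event
    and [1 - v] for the opposite one. Ties force both times to be infinite, hence are null, and the
    two bounds must be attained. *)
Lemma law_hitting_before_return :
  law X x EB = (generator q hB x / holding_rate X x)%:E /\
  law X x [set w | hitting B w = return_time A w] = 0.
Proof.
have AD : A \subset D by exact: finset.subsetUl.
have BD : B \subset D by exact: finset.subsetUr.
have xD : x \in D by rewrite inE xA.
have D0 : D != finset.set0 by apply/set0Pn; exists x.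
have hBx : hB x = 0 by rewrite /hB harm_in// (negbTE (AB xA)).
have hAx : hA x = 1 by rewrite /hA harm_in// xA.
have hAE : hA = fun u => 1 - hB u.
  apply: harm_unique => // u uD; last first.
    by rewrite generatorB generator_cst /hB harm_off// subr0.
  rewrite /hB harm_in//; move: uD; rewrite inE.
  by have [uA _|_ /= ->] := boolP (u \in A); rewrite ?(negbTE (AB uA)) ?subr0 ?subrr.
pose v := generator q hB x / holding_rate X x.
have upB : (law X x EB <= v%:E)%E.
  rewrite (_ : v = hB x + v); last by rewrite hBx add0r.
  rewrite law_start_setI//; apply: hit_bound => //.
  - by apply: measurableI.
  - by move=> w [w0 ?]; exact: skeleton_hitting_first.
have upA : (law X x EA <= (1 - v)%:E)%E.
  rewrite law_start_setI// (_ : 1 - v = hA x + generator q hA x / holding_rate X x).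
    apply: hit_bound => //.
    - by apply: measurableI.
    - by move=> w [w0 ?]; exact: (@skeleton_return_first _ _ _ x A B).
  by rewrite hAx hAE generatorB generator_cst /v sub0r mulNr.
pose EE := [set w : sample X | hitting B w = return_time A w].
have EEE : EE = ~` (EB `|` EA).
  apply/seteqP; split=> w /=; first by move=> e [] /=; rewrite /EB /EA /= e ltxx.
  move=> h; apply/eqP; rewrite eq_le !leNgt; apply/andP; split; apply/negP => h'; apply: h.
    by right.
  by left.
have mEE : measurable EE by rewrite EEE; apply: measurableC; exact: measurableU.
have EE0 : law X x EE = 0.
  suff EE0 : (law X x EE <= 0)%E by apply/eqP; rewrite -measure_le0.
  rewrite law_start_setI//.
  have b : exists y, y \in B by apply/set0Pn.
  rewrite -(never_hit_null q_ge0 x b q_irr); apply: le_measure; rewrite ?inE.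
  - exact: measurableI.
  - by apply: measurableI => //; exact: measurable_hitting_infty.
  - by move=> w [w0 e]; split=> //; exact: hitting_eq_return e.
split=> //.
have tot : (law X x EB + law X x EA = 1)%E.
  have <- : law X x (EB `|` EA) = (law X x EB + law X x EA)%E.
    rewrite measureU//; apply/seteqP; split=> // w /= [/lt_trans h /h].
    by rewrite ltxx.
  have <- : law X x (EE `|` (EB `|` EA)) = 1%E by rewrite EEE setvU probability_setT.
  have -> : law X x (EE `|` (EB `|` EA)) = (law X x EE + law X x (EB `|` EA))%E.
    rewrite measureU//; first exact: measurableU.
    by rewrite EEE setICl.
  by rewrite EE0 add0e.
have Bfin : law X x EB \is a fin_num by exact: fin_num_measure.
have Afin : law X x EA \is a fin_num by exact: fin_num_measure.
move: tot upA upB; rewrite -(fineK Bfin) -(fineK Afin) -EFinD !lee_fin => -[] tot upA upB.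
congr (_%:E); apply/eqP; rewrite -/v eq_le upB/=; lra.
Qed.

End Formulas.

Lemma capacityE A B : (forall y, y \in A -> y \notin B) -> B != finset.set0 ->
  capacity X A B = \sum_(x in A) inv_measure X x *
    generator q (harm q (A :|: B)%SET (fun u => (u \in B)%:R)) x.
Proof.
move=> AB B0; apply: eq_bigr => x xA.
have [-> _] := law_hitting_before_return xA AB B0.
by rewrite /= -mulrA; congr (_ * _); rewrite mulrC divfK// gt_eqF.
Qed.

(** The return time to [A] is the minimum of the return times to [y] and to the rest of [A], and
    from [x] the former is the hitting time of [y]. The event thus says that [y] is hit no later
    than the rest, and ties are null. *)
Lemma trace_rateE A x y : x \in A -> y \in A -> x != y ->
  trace_rate X A x y = trace q A x y.
Proof.
move=> xA yA xy; pose A' := (A :\ y)%SET.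
have xA' : x \in A' by rewrite !inE xy.
have A'y z : z \in A' -> z \notin [set y]%SET by rewrite !inE => /andP[].
have y0 : [set y]%SET != finset.set0 by apply/set0Pn; exists y; rewrite inE.
have [h1 h2] := law_hitting_before_return xA' A'y y0.
have AE : (A' :|: [set y] = A)%SET by rewrite finset.setUC finset.setD1K.
rewrite /trace_rate /trace.
have -> : law X x [set w | hitting [set y]%SET w = return_time A w] =
    law X x [set w | (hitting [set y]%SET w < return_time A' w)%E].
  set E2 := [set w | (_ < _)%E] in h1 *; set N := [set w | _] in h2.
  have mE2 : measurable E2.
    by apply: measurable_lt_of_rat => c; [exact: measurable_hitting_lt|exact: measurable_return_lt].
  have mN : measurable N by exact: measurable_hitting_eq_return.
  rewrite law_start_setI; last exact: measurable_hitting_eq_return.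
  have -> : law X x E2 = law X x (E2 `|` N).
    rewrite measureU// ?[X in (_ + X)%E]h2 ?adde0//.
    by apply/seteqP; split=> // w []; rewrite /E2 /N /= => /[swap] ->; rewrite ltxx.
  rewrite [RHS]law_start_setI; last exact: measurableU.
  congr (law X x _); apply/seteqP; split=> w [/= w0].
    have wy : traj 0 w \notin [set y]%SET by rewrite w0 inE.
    rewrite -AE return_time_setU -(hitting_return wy) => e; split=> //.
    have : (hitting [set y]%SET w <= return_time A' w)%E by rewrite e ge_min lexx.
    by rewrite le_eqVlt => /orP[/eqP|]; [right|left].
  have wy : traj 0 w \notin [set y]%SET by rewrite w0 inE.
  move=> h; split=> //=; rewrite -AE return_time_setU -(hitting_return wy) min_r//.
  by case: h => /= [/ltW//|->].
rewrite h1 /= mulrC divfK ?gt_eqF//; congr (generator _ _ _).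
by rewrite AE; apply: eq_harm => // [u uA|]; [rewrite inE|apply/set0Pn; exists x].
Qed.

End HittingLaw.

(** * Wells and their potentials *)

Lemma cvg_seq_bound (R : realType) (u : nat -> R) (l : R) : u n @[n --> \oo] --> l ->
  exists2 B : R, 0 <= B & forall n, `|u n| <= B.
Proof.
move=> ul; have /cvg_seq_bounded : cvgn u by apply/cvg_ex; exists l.
move=> [B [_ hB]]; exists (`|B| + 1); first by rewrite addr_ge0.
by move=> n; apply: hB => //; rewrite (le_lt_trans (ler_norm _))// ltrDl.
Qed.

Lemma cvg0_bounded_mul (R : realType) (b u : nat -> R) (B : R) :
  (forall n, `|b n| <= B) -> u n @[n --> \oo] --> 0 -> b n * u n @[n --> \oo] --> 0.
Proof.
move=> bB u0; apply: (@cvg_dist_bound _ _ (fun n => B * `|u n|)).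
  by move=> n; rewrite subr0 normrM ler_wpM2r.
have h : B * `|u n| @[n --> \oo] --> B * `|0 : R|.
  by apply: cvgM; [exact: cvg_cst|exact: cvg_norm].
by rewrite normr0 mulr0 in h.
Qed.

Lemma cvg_near_bound (R : realType) (u b : nat -> R) (l : R) :
  (\forall n \near \oo, `|u n - l| <= b n) -> b n @[n --> \oo] --> 0 -> u n @[n --> \oo] --> l.
Proof.
move=> ub b0; apply/cvgrPdist_le => e e0.
have /cvgrPdist_le/(_ e e0) := b0; move: ub; apply: filterS2 => n ub.
rewrite sub0r normrN distrC => /(le_trans (ler_norm _)); exact: le_trans.
Qed.

Lemma cvg_approx (R : realType) (u : nat -> R) (l : R) :
  (forall e : R, 0 < e -> exists2 b : nat -> R, b n @[n --> \oo] --> 0 &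
     \forall n \near \oo, `|u n - l| <= e + b n) -> u n @[n --> \oo] --> l.
Proof.
move=> h; apply/cvgrPdist_le => e e0; have e2 : 0 < e / 2 by rewrite divr_gt0.
have [b b0 ub] := h _ e2.
have /cvgrPdist_le/(_ _ e2) := b0; move: ub; apply: filterS2 => n ub.
rewrite sub0r normrN distrC => /(le_trans (ler_norm _)) hb.
by rewrite (splitr e) (le_trans ub)// lerD2l.
Qed.

Lemma cvg0_sum (R : realType) (I : finType) (P : pred I) (u : I -> nat -> R) :
  (forall i, P i -> u i n @[n --> \oo] --> 0) ->
  \sum_(i | P i) u i n @[n --> \oo] --> 0.
Proof.
move=> u0; rewrite [X in _ --> X](_ : _ = \sum_(i | P i) (0 : R)); last by rewrite big1.
exact: cvg_bigsum.
Qed.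

Lemma cvg0_norm (R : realType) (u : nat -> R) (l : R) :
  u n @[n --> \oo] --> l -> `|u n - l| @[n --> \oo] --> 0.
Proof.
move=> ul; have h : `|u n - l| @[n --> \oo] --> `|l - l|.
  by apply: cvg_norm; apply: cvgB => //; exact: cvg_cst.
by rewrite subrr normr0 in h.
Qed.

Lemma semigroup_dist_sum (R : realType) (T : finType) (q : T -> T -> R) t (f g : T -> R) x :
  (forall x y, 0 <= q x y) -> 0 <= t ->
  `|semigroup q t f x - semigroup q t g x| <= \sum_y `|f y - g y|.
Proof.
move=> q0 t0; rewrite !semigroupE -sumrB (le_trans (ler_norm_sum _ _ _))// ler_sum// => y _.
rewrite -mulrBr normrM ler_piMl// ger0_norm ?transition_ge0// transition_le1//.
Qed.

Section Potentials.
Context (R : realType) (V : finType) (q : nat -> V -> V -> R) (pi : nat -> V -> R).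
Hypothesis q_ge0 : forall n x y, 0 <= q n x y.
Hypothesis q_irr : forall n, irreducible (q n).
Hypothesis pi_stat : forall n, stationary (q n) [set: V]%SET (pi n).

Let pi_gt0 n x : 0 < pi n x.
Proof. exact: (stationary_gt0 (q_ge0 n) (q_irr n) (pi_stat n)). Qed.

Definition mass n (A : {set V}) : R := \sum_(x in A) pi n x.

Lemma mass_gt0 n A : A != finset.set0 -> 0 < mass n A.
Proof.
move=> /set0Pn[x xA]; rewrite /mass (bigD1 x)//= ltr_pwDl//.
by apply: sumr_ge0 => y _; exact: ltW.
Qed.

Section Wells.
Context (I : finType) (S : {set I}) (w : I -> {set V}).

Definition dom : {set V} := (\bigcup_(i in S) w i)%SET.

Definition potential n j : V -> R := harm (q n) dom (fun u => (u \in w j)%:R).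

(** The value at [i = j] is meaningful: it is minus the exit rate of the well, so [well_rate n] is a
    full generator matrix on [S]. *)
Definition well_rate n i j : R :=
  (mass n (w i))^-1 * \sum_(x in w i) pi n x * generator (q n) (potential n j) x.

Definition exit_rate n : R := \sum_(i in S) \sum_(j in S | j != i) well_rate n i j.

Record wells_ok (m : I -> V -> R) : Prop := WellsOk {
  wells_ne : S != finset.set0;
  well_ne : forall i, i \in S -> w i != finset.set0;
  well_disj : forall i j x, i \in S -> j \in S -> x \in w i -> x \in w j -> i = j;
  well_supp : forall i x, i \in S -> x \notin w i -> m i x = 0;
  well_pos : forall i x, i \in S -> x \in w i -> 0 < m i x;
  well_sum1 : forall i, i \in S -> \sum_x m i x = 1;
  well_mu : forall i x, i \in S -> x \in w i ->
    pi n x / mass n (w i) @[n --> \oo] --> m i x }.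

Context (m : I -> V -> R) (ok : wells_ok m).

Lemma mem_dom i x : i \in S -> x \in w i -> x \in dom.
Proof. by move=> iS xi; apply/finset.bigcupP; exists i. Qed.

Lemma dom_ne : dom != finset.set0.
Proof.
have [i iS] := set0Pn _ (wells_ne ok); have [x xi] := set0Pn _ (well_ne ok iS).
by apply/set0Pn; exists x; exact: mem_dom xi.
Qed.

Lemma well_ge0 i x : i \in S -> 0 <= m i x.
Proof.
move=> iS; have [xi|xi] := boolP (x \in w i); first exact: (ltW (well_pos ok iS xi)).
by rewrite (well_supp ok).
Qed.

Lemma potential_ge0 n j x : 0 <= potential n j x.
Proof. by apply: harm_ge0 => //; exact: dom_ne. Qed.

Lemma potential_le1 n j x : potential n j x <= 1.
Proof. by apply: harm_le1 => // [|u _]; [exact: dom_ne|case: (_ \in _)]. Qed.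

Lemma potential_norm n j x : `|potential n j x| <= 1.
Proof. by rewrite ger0_norm ?potential_ge0// potential_le1. Qed.

Lemma potential_well n i j x : i \in S -> j \in S -> x \in w i ->
  potential n j x = (i == j)%:R.
Proof.
move=> iS jS xi; rewrite /potential (harm_in (q_ge0 n) (q_irr n)); last exact: mem_dom xi.
suff -> : (x \in w j) = (i == j) by [].
have [<-|ij] := eqVneq i j; first by rewrite xi.
by apply/negbTE/negP => xj; move/eqP: ij; apply; exact: (well_disj ok iS jS xi xj).
Qed.

Lemma potential_sum n x : \sum_(j in S) potential n j x = 1.
Proof.
have := harm_sum (q_ge0 n) (q_irr n) (mem S) (fun=> 1) (fun j u => (u \in w j)%:R) dom_ne.
move=> /(congr1 (fun f => f x)) /=.
under [X in _ = X -> _]eq_bigr do rewrite mul1r.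
move=> <-; rewrite (eq_harm (q_ge0 n) (q_irr n) (g' := fun=> 1)) ?dom_ne//.
  by rewrite (harm_cst (q_ge0 n) (q_irr n))// dom_ne.
move=> u /finset.bigcupP[i iS ui]; rewrite (bigD1 i)//= ui mulr1 big1 ?addr0// => j /andP[jS ji].
have [uj|_] := boolP (u \in w j); last by rewrite mulr0.
by move/eqP: ji; case; exact: (well_disj ok jS iS uj ui).
Qed.

Lemma potential_off n j x : x \notin dom -> generator (q n) (potential n j) x = 0.
Proof. by move=> xD; rewrite (harm_off (q_ge0 n) (q_irr n))// dom_ne. Qed.

Lemma generator_potential_sum n x :
  \sum_(j in S) generator (q n) (potential n j) x = 0.
Proof.
have := generator_sum (q n) (mem S) (fun=> 1) (fun j => potential n j) x.
under [X in _ = X -> _]eq_bigr do rewrite mul1r.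
move=> <-; rewrite -[RHS](generator_cst (q n) 1 x); apply: eq_generator => u.
by under eq_bigr do rewrite mul1r; rewrite potential_sum.
Qed.

Lemma generator_potential_ge0 n i j x : i \in S -> j \in S -> i != j -> x \in w i ->
  0 <= generator (q n) (potential n j) x.
Proof.
move=> iS jS ij xi; apply: generator_at_zero_ge0 => //; first by move=> y; exact: potential_ge0.
by rewrite (potential_well _ iS)// (negbTE ij).
Qed.

Lemma well_rate_ge0 n i j : i \in S -> j \in S -> i != j -> 0 <= well_rate n i j.
Proof.
move=> iS jS ij; rewrite /well_rate mulr_ge0 ?invr_ge0 ?(ltW (mass_gt0 _ (well_ne ok iS)))//.
by apply: sumr_ge0 => x xi; rewrite mulr_ge0 ?(ltW (pi_gt0 _ _))// (generator_potential_ge0 _ iS).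
Qed.

Lemma exit_rate_ge0 n : 0 <= exit_rate n.
Proof.
apply: sumr_ge0 => i iS; apply: sumr_ge0 => j /andP[jS ji].
by apply: well_rate_ge0 => //; rewrite eq_sym.
Qed.

Lemma well_rate_le_exit n i j : i \in S -> j \in S -> i != j -> well_rate n i j <= exit_rate n.
Proof.
move=> iS jS ij; rewrite /exit_rate (bigD1 i)//= (bigD1 j)/=; last by rewrite jS eq_sym.
rewrite -addrA lerDl addr_ge0//; apply: sumr_ge0.
  by move=> k /andP[/andP[kS ki] _]; apply: well_rate_ge0; rewrite // eq_sym.
move=> k /andP[kS _]; apply: sumr_ge0 => l /andP[lS lk].
by apply: well_rate_ge0; rewrite // eq_sym.
Qed.

Lemma well_rate_sum0 n i : \sum_(j in S) well_rate n i j = 0.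
Proof.
rewrite -mulr_sumr exchange_big/= big1 ?mulr0// => x _.
by rewrite -mulr_sumr generator_potential_sum mulr0.
Qed.

Lemma well_rate_diag n i : i \in S ->
  well_rate n i i = - \sum_(j in S | j != i) well_rate n i j.
Proof.
move=> iS; apply/eqP; rewrite -addr_eq0; apply/eqP.
by have := well_rate_sum0 n i; rewrite (bigD1 i).
Qed.

Lemma sum_unionE (C : {set I}) (F : V -> R) : C \subset S ->
  \sum_(x in (\bigcup_(i in C) w i)%SET) F x = \sum_(i in C) \sum_(x in w i) F x.
Proof.
move=> /fintype.subsetP CS.
rewrite (eq_bigr (fun x => \sum_(i in C | x \in w i) F x)); last first.
  move=> x /finset.bigcupP[i iC xi]; rewrite (big_pred1 i)// => j /=.
  by apply/andP/eqP => [[jC xj]|->//]; exact: (well_disj ok (CS _ jC) (CS _ iC) xj xi).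
rewrite (exchange_big_dep (mem C))/=; last by move=> x j _ /andP[].
apply: eq_bigr => i iC; apply: eq_bigl => x; rewrite iC /=.
by rewrite andb_idl// => xi; apply/finset.bigcupP; exists i.
Qed.

Lemma sum_domE (F : V -> R) : (forall x, x \notin dom -> F x = 0) ->
  \sum_x F x = \sum_(i in S) \sum_(x in w i) F x.
Proof.
move=> F0; rewrite (bigID (mem dom))/= [X in _ + X]big1// addr0.
exact: sum_unionE.
Qed.

(** Stationarity tested against a potential: the masses of the wells are invariant for the chain
    between wells, for each [n] and without approximation. *)
Lemma well_balance n j : \sum_(i in S) mass n (w i) * well_rate n i j = 0.
Proof.
rewrite -[RHS](stationary_generator (pi_stat n) (potential n j)).
rewrite [RHS]sum_domE; last by move=> x xD; rewrite potential_off// mulr0.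
apply: eq_bigr => i iS; rewrite /well_rate mulVKf// gt_eqF//.
exact: (mass_gt0 n (well_ne ok iS)).
Qed.

(** On another well the values are nonnegative, so each is bounded by their weighted average divided
    by its own weight, which stays away from 0. On the well itself they are recovered from the
    others, since the potentials sum to 1. *)
Lemma generator_potential_bound : exists2 K : R, 0 <= K & forall n j x, j \in S ->
  `|generator (q n) (potential n j) x| <= K * exit_rate n.
Proof.
have bx (ix : I * V) : exists B : R, ix.1 \in S -> ix.2 \in w ix.1 ->
    forall n, mass n (w ix.1) / pi n ix.2 <= B.
  case: ix => i x /=; have [iS|] := boolP (i \in S); last by exists 0.
  have [xi|] := boolP (x \in w i); last by exists 0.
  have h : mass n (w i) / pi n x @[n --> \oo] --> (m i x)^-1.
    rewrite (_ : (fun n => _) = fun n => (pi n x / mass n (w i))^-1).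
      by apply: cvgV; [rewrite gt_eqF// (well_pos ok)|exact: (well_mu ok)].
    by apply/funext => n; rewrite invf_div.
  have [B _ hB] := cvg_seq_bound h.
  by exists B => _ _ n; rewrite (le_trans (ler_norm _)).
have [B hB] := choice bx.
pose K0 := \sum_ix `|B ix|.
have K00 : 0 <= K0 by exact: sumr_ge0.
have off n i j x : i \in S -> j \in S -> i != j -> x \in w i ->
    generator (q n) (potential n j) x <= K0 * exit_rate n.
  move=> iS jS ij xi.
  have Mi : 0 < mass n (w i) := mass_gt0 n (well_ne ok iS).
  apply: (@le_trans _ _ (mass n (w i) / pi n x * exit_rate n)); last first.
    rewrite ler_wpM2r ?exit_rate_ge0//.
    apply: le_trans (hB (i, x) iS xi n) _; rewrite (le_trans (ler_norm _))//.
    by rewrite /K0 (bigD1 (i, x))//= lerDl sumr_ge0.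
  rewrite mulrAC ler_pdivlMr// mulrC.
  apply: (@le_trans _ _ (mass n (w i) * well_rate n i j)); last first.
    by rewrite ler_wpM2l ?(ltW Mi)// well_rate_le_exit.
  rewrite /well_rate mulVKf ?gt_eqF// (bigD1 x)//= lerDl.
  apply: sumr_ge0 => y /andP[yi _].
  by rewrite mulr_ge0 ?(ltW (pi_gt0 _ _))// (generator_potential_ge0 _ iS).
exists (#|I|%:R * K0 + K0); first by rewrite addr_ge0// mulr_ge0.
move=> n j x jS; have e0 := exit_rate_ge0 n.
have [xD|xD] := boolP (x \in dom); last first.
  by rewrite potential_off// normr0 mulr_ge0// addr_ge0// mulr_ge0.
have /finset.bigcupP[i iS xi] := xD.
have [ij|ij] := eqVneq i j; last first.
  rewrite ger0_norm ?(generator_potential_ge0 _ iS)// mulrDl ler_wpDl ?(off _ i)//.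
  by rewrite mulr_ge0// mulr_ge0.
have -> : generator (q n) (potential n j) x =
    - \sum_(k in S | k != j) generator (q n) (potential n k) x.
  apply/eqP; rewrite -addr_eq0; apply/eqP.
  by have := generator_potential_sum n x; rewrite (bigD1 j).
rewrite normrN (le_trans (ler_norm_sum _ _ _))//.
apply: (@le_trans _ _ (\sum_(k : I) K0 * exit_rate n)).
  rewrite [leLHS]big_mkcond/= ler_sum// => k _; case: ifP => [/andP[kS kj]|_]; last first.
    by rewrite mulr_ge0.
  have ik : i != k by rewrite ij eq_sym.
  by rewrite ger0_norm ?(generator_potential_ge0 _ iS)// (off _ i).
by rewrite sumr_const -[leLHS]mulr_natl mulrA ler_wpM2r// lerDl.
Qed.

Lemma potential_slow : exists2 K : R, 0 <= K & forall n j x t, j \in S -> 0 <= t ->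
  `|semigroup (q n) t (potential n j) x - potential n j x| <= K * (t * exit_rate n).
Proof.
have [K K0 hK] := generator_potential_bound; exists K => // n j x t jS t0.
rewrite (mulrC t) mulrA; apply: semigroup_dist => // y; exact: hK.
Qed.

Lemma well_measure_potential n i j : i \in S -> j \in S ->
  \sum_x m i x * potential n j x = (i == j)%:R.
Proof.
move=> iS jS; have -> : (i == j)%:R = (\sum_x m i x) * (i == j)%:R :> R.
  by rewrite (well_sum1 ok iS) mul1r.
rewrite mulr_suml; apply: eq_bigr => x _.
have [xi|xi] := boolP (x \in w i); last by rewrite (well_supp ok)// !mul0r.
by rewrite (potential_well _ iS jS xi).
Qed.

(** The potentials are dual to the measures [m i], so integrating them against a mixture recovers
    its coefficients for each [n]. *)
Lemma kernel_potential (a : V -> I -> R) n x j : j \in S ->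
  \sum_y (\sum_(i in S) a x i * m i y) * potential n j y = a x j.
Proof.
move=> jS; under eq_bigr do rewrite mulr_suml.
rewrite exchange_big/= (eq_bigr (fun i => a x i * (i == j)%:R)); last first.
  move=> i iS; rewrite -(well_measure_potential n iS jS) mulr_sumr.
  by apply: eq_bigr => y _; rewrite mulrA.
rewrite (bigD1 j)//= eqxx mulr1 big1 ?addr0// => i /andP[_ /negbTE ->].
by rewrite mulr0.
Qed.

Section Scale.
Context (th : nat -> R) (r : I -> I -> R).
Hypothesis th_gt0 : forall n, 0 < th n.
Hypothesis r_off : forall i j, ~~ [&& i \in S, j \in S & i != j] -> r i j = 0.
Hypothesis r_cvg : forall i j, i \in S -> j \in S -> i != j ->
  th n * well_rate n i j @[n --> \oo] --> r i j.

Lemma scaled_rate_ge0 i j : 0 <= r i j.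
Proof.
have [/and3P[iS jS ij]|/r_off ->//] := boolP [&& i \in S, j \in S & i != j].
apply: (cvgr_to_ge (r_cvg iS jS ij)); apply: nearW => n.
by rewrite mulr_ge0 ?(ltW (th_gt0 _))// well_rate_ge0.
Qed.

Lemma scaled_rate_closed : closed r S.
Proof.
move=> i j iS; apply: contraTT => jS.
by rewrite r_off ?ltxx// (negbTE jS) andbF.
Qed.

Lemma generator_delta (i l : I) :
  generator r (fun k => (k == l)%:R) i = if i == l then - \sum_(j | j != i) r i j else r i l.
Proof.
rewrite /generator; have [->|il] := eqVneq i l.
  rewrite (bigD1 l)//= eqxx subrr mulr0 add0r -sumrN; apply: eq_bigr => j /negbTE ->.
  by rewrite sub0r mulrN1.
rewrite (bigD1 l)//= eqxx subr0 mulr1 big1 ?addr0// => j /negbTE ->.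
by rewrite subrr mulr0.
Qed.

Lemma scaled_rate_cvg i l : i \in S -> l \in S ->
  th n * well_rate n i l @[n --> \oo] --> generator r (fun k => (k == l)%:R) i.
Proof.
move=> iS lS; rewrite generator_delta; case: eqP => [<-|/eqP il]; last exact: r_cvg.
rewrite (_ : (fun n => _) = fun n => - \sum_(j in S | j != i) (th n * well_rate n i j)).
  apply: cvgN; rewrite (bigID (mem S))/= [X in _ + X]big1 ?addr0; last first.
    by move=> j /andP[_ jS]; rewrite r_off// (negbTE jS) andbF.
  rewrite (eq_bigl (fun j => (j \in S) && (j != i))); last by move=> j; rewrite andbC.
  by apply: cvg_bigsum => j /andP[jS ji]; apply: r_cvg; rewrite // eq_sym.
by apply/funext => n; rewrite well_rate_diag// mulrN mulr_sumr.
Qed.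

Lemma scaled_exit_cvg : exists E : R, th n * exit_rate n @[n --> \oo] --> E.
Proof.
exists (\sum_(i in S) \sum_(j in S | j != i) r i j).
rewrite (_ : (fun n => _) = fun n =>
  \sum_(i in S) \sum_(j in S | j != i) th n * well_rate n i j).
  apply: cvg_bigsum => i iS; apply: cvg_bigsum => j /andP[jS ji].
  by apply: r_cvg; rewrite // eq_sym.
by apply/funext => n; rewrite mulr_sumr; apply: eq_bigr => i _; rewrite mulr_sumr.
Qed.

End Scale.

End Wells.

End Potentials.

(** * The limit at the time scale of a level *)

Section LevelLimit.
Context (R : realType) (V : finType) (q : nat -> V -> V -> R) (pi : nat -> V -> R).
Hypothesis q_ge0 : forall n x y, 0 <= q n x y.
Hypothesis q_irr : forall n, irreducible (q n).
Hypothesis pi_stat : forall n, stationary (q n) [set: V]%SET (pi n).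

(* The state of the recursion after the time scale [tm]: on time scales between
   [tm] and the inverse exit rate of the wells, the chain started at [x] is in
   the [i]-th well with probability [a x i], distributed there as [m i]. *)
Record prelevel (I : finType) (S : {set I}) (w : I -> {set V})
    (a : V -> I -> R) (m : I -> V -> R) (tm : nat -> R) : Prop := Prelevel {
  pl_ok : wells_ok pi S w m;
  pl_tm : forall n, 0 <= tm n;
  pl_sep : tm n * exit_rate q pi S w n @[n --> \oo] --> 0;
  pl_fast : forall d : nat -> R, (forall n, 0 < d n) ->
    tm n / d n @[n --> \oo] --> 0 ->
    d n * exit_rate q pi S w n @[n --> \oo] --> 0 ->
    forall x y, transition (q n) (d n) x y @[n --> \oo] --> \sum_(i in S) a x i * m i y }.

Context (I : finType) (S : {set I}) (w : I -> {set V}).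
Context (a : V -> I -> R) (m : I -> V -> R) (tm : nat -> R).
Hypothesis pl : prelevel S w a m tm.

Let ok : wells_ok pi S w m := pl_ok pl.
Let pot := potential q S w.
Let kern x y := \sum_(i in S) a x i * m i y.

Context (th : nat -> R) (r : I -> I -> R).
Hypothesis th_gt0 : forall n, 0 < th n.
Hypothesis r_off : forall i j, ~~ [&& i \in S, j \in S & i != j] -> r i j = 0.
Hypothesis r_cvg : forall i j, i \in S -> j \in S -> i != j ->
  th n * well_rate q pi S w n i j @[n --> \oo] --> r i j.
Hypothesis tm_th : tm n / th n @[n --> \oo] --> 0.

Let r_ge0 i j : 0 <= r i j.
Proof. exact: (scaled_rate_ge0 q_ge0 q_irr pi_stat ok th_gt0 r_off r_cvg). Qed.

Let G i l : R := generator r (fun k => (k == l)%:R) i.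

Section Intermediate.
Context (d : nat -> R).
Hypothesis d_gt0 : forall n, 0 < d n.
Hypothesis tm_d : tm n / d n @[n --> \oo] --> 0.
Hypothesis d_th : d n / th n @[n --> \oo] --> 0.

Let d_exit : d n * exit_rate q pi S w n @[n --> \oo] --> 0.
Proof.
have [E hE] := scaled_exit_cvg r_cvg.
rewrite (_ : (fun n => _) = fun n => d n / th n * (th n * exit_rate q pi S w n)).
  by rewrite -[X in _ --> X](mul0r E); exact: cvgM.
by apply/funext => n; rewrite mulrA divfK// gt_eqF.
Qed.

Let fast x y : transition (q n) (d n) x y @[n --> \oo] --> kern x y.
Proof. exact: (pl_fast pl d_gt0 tm_d d_exit). Qed.

Let H n j x := semigroup (q n) (d n) (pot n j) x.

(** The function may depend on [n] without converging: uniform boundedness suffices, because the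
    kernels converge entrywise. *)
Let fast_avg (f : nat -> V -> R) (B : R) x : (forall n y, `|f n y| <= B) ->
  semigroup (q n) (d n) (f n) x - \sum_y kern x y * f n y @[n --> \oo] --> 0.
Proof.
move=> fB; rewrite (_ : (fun n => _) =
    fun n => \sum_y f n y * (transition (q n) (d n) x y - kern x y)).
  apply: cvg0_sum => y _; apply: (cvg0_bounded_mul (B := B)) => //.
  by rewrite -[X in _ --> X](subrr (kern x y)); apply: cvgB => //; exact: cvg_cst.
apply/funext => n; rewrite semigroupE -sumrB; apply: eq_bigr => y _.
by rewrite mulrBr mulrC [kern _ _ * _]mulrC.
Qed.

Lemma smoothed_potential_cvg j x : j \in S -> H n j x @[n --> \oo] --> a x j.
Proof.
move=> jS; rewrite (_ : (fun n => _) =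
    fun n => semigroup (q n) (d n) (pot n j) x - \sum_y kern x y * pot n j y + a x j).
  rewrite -[X in _ --> X]add0r; apply: cvgD; last exact: cvg_cst.
  by apply: (fast_avg (B := 1)) => n y; exact: (potential_norm q_ge0 q_irr ok).
by apply/funext => n; rewrite (kernel_potential q_ge0 q_irr ok)// subrK.
Qed.

Let err n l x := th n * generator (q n) (H n l) x - \sum_(j in S) H n j x * G j l.

(** [err] is the smoothed version of the residual [X] of the raw potentials. Pointwise [X] is only
    bounded, but its integrals against the [m i] vanish in the limit, and after time [d n] the law
    is asymptotically a mixture of the [m i]. *)
Lemma smoothed_error_cvg l x : l \in S -> err n l x @[n --> \oo] --> 0.
Proof.
move=> lS.
pose X n y := th n * generator (q n) (pot n l) y - \sum_(j in S) G j l * pot n j y.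
have XE n : err n l x = semigroup (q n) (d n) (X n) x.
  have semi2 (f g : V -> R) c : semigroup (q n) (d n) (fun y => c * f y - g y) x =
      c * semigroup (q n) (d n) f x - semigroup (q n) (d n) g x.
    rewrite !semigroupE mulr_sumr -sumrB; apply: eq_bigr => y _; ring.
  rewrite /X semi2 /err /H -generator_semigroup; congr (_ - _).
  rewrite semigroupE.
  under [RHS]eq_bigr do rewrite mulr_sumr.
  rewrite exchange_big/=; apply: eq_bigr => j _; rewrite semigroupE mulr_suml.
  by apply: eq_bigr => y _; ring.
have [K K0 hK] := generator_potential_bound q_ge0 q_irr pi_stat ok.
have [E hE] := scaled_exit_cvg r_cvg.
have [BE BE0 hBE] := cvg_seq_bound hE.
pose B := K * BE + \sum_(j in S) `|G j l|.
have genB n y : `|th n * generator (q n) (pot n l) y| <= K * BE.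
  rewrite normrM gtr0_norm//.
  apply: (@le_trans _ _ (th n * (K * exit_rate q pi S w n))).
    by rewrite ler_wpM2l ?(ltW (th_gt0 n))// hK.
  rewrite mulrCA ler_wpM2l//; exact: (le_trans (ler_norm _) (hBE n)).
have XB n y : `|X n y| <= B.
  rewrite /X /B (le_trans (ler_normB _ _))// lerD// (le_trans (ler_norm_sum _ _ _))//.
  rewrite ler_sum// => j jS; rewrite normrM ler_piMr//.
  exact: (potential_norm q_ge0 q_irr ok).
have mX i : i \in S -> \sum_y m i y * X n y @[n --> \oo] --> 0.
  move=> iS.
  (* Replacing [m i] by the normalized restriction of [pi n] to the well turns the integral of the
     generator into [well_rate]; what remains is the error of this replacement and that of the
     scaled rate. *)
  rewrite (_ : (fun n => _) = fun n =>
    \sum_(y in w i) (th n * generator (q n) (pot n l) y) * (m i y - pi n y / mass pi n (w i)) +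
    (th n * well_rate q pi S w n i l - G i l)).
    rewrite -[X in _ --> X]addr0; apply: cvgD.
      apply: cvg0_sum => y yi; apply: (cvg0_bounded_mul (B := K * BE)) => //.
      rewrite -[X in _ --> X](subrr (m i y)); apply: cvgB; first exact: cvg_cst.
      exact: (well_mu ok iS yi).
    rewrite -[X in _ --> X](subrr (G i l)); apply: cvgB; last exact: cvg_cst.
    exact: (scaled_rate_cvg q_ge0 q_irr ok r_off r_cvg iS lS).
  apply/funext => n.
  have -> : \sum_y m i y * X n y =
      \sum_y m i y * (th n * generator (q n) (pot n l) y) - G i l.
    rewrite (eq_bigr (fun y => m i y * (th n * generator (q n) (pot n l) y) -
        \sum_(j in S) G j l * (m i y * pot n j y))); last first.
      move=> y _; rewrite /X mulrBr; congr (_ - _); rewrite mulr_sumr.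
      by apply: eq_bigr => j _; rewrite mulrCA.
    rewrite sumrB; congr (_ - _); rewrite exchange_big/=.
    rewrite (eq_bigr (fun j => G j l * (i == j)%:R)); last first.
      move=> j jS; rewrite -(well_measure_potential q_ge0 q_irr ok n iS jS).
      by rewrite mulr_sumr.
    rewrite (bigD1 i)//= eqxx mulr1 big1 ?addr0// => j /andP[_].
    by rewrite eq_sym => /negbTE ->; rewrite mulr0.
  rewrite addrA; congr (_ - _).
  rewrite (bigID (mem (w i)))/= [X in _ + X]big1 ?addr0; last first.
    by move=> y yi; rewrite (well_supp ok)// mul0r.
  rewrite /well_rate mulrCA mulr_sumr mulr_sumr -big_split/=.
  by apply: eq_bigr => y _; rewrite -/(pot n l); ring.
rewrite (_ : (fun n => _) = fun n =>
   (semigroup (q n) (d n) (X n) x - \sum_y kern x y * X n y) +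
   \sum_(i in S) a x i * \sum_y m i y * X n y).
  rewrite -[X in _ --> X]addr0; apply: cvgD; first exact: (fast_avg (B := B)).
  apply: cvg0_sum => i iS; rewrite -[X in _ --> X](mulr0 (a x i)).
  by apply: cvgM; [exact: cvg_cst|exact: mX].
apply/funext => n; rewrite XE -[LHS](subrK (\sum_y kern x y * X n y)); congr (_ + _).
under [RHS]eq_bigr do rewrite mulr_sumr.
rewrite exchange_big/=; apply: eq_bigr => y _; rewrite /kern mulr_suml.
by apply: eq_bigr => i _; rewrite mulrA.
Qed.

(** Evolving the index of [H n] by the limiting chain, slowed down by [th n], nearly solves the
    backward equation of the microscopic chain, with residual [err / th n]. *)
Lemma intertwining_bound n k x t : k \in S -> 0 <= t ->
  `|\sum_(j in S) H n j x * transition r (t / th n) j k - semigroup (q n) t (H n k) x| <=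
    (\sum_(l in S) \sum_y `|err n l y|) / th n * t.
Proof.
move=> kS t0.
pose f (s : R) y := \sum_(j in S) H n j y * transition r (s / th n) j k.
pose D s j := semigroup r (s / th n) (generator r (fun z => (z == k)%:R)) j.
pose df (s : R) y := \sum_(j in S) H n j y * ((th n)^-1 * D s j).
have f0 : f 0 = H n k.
  apply/funext => y; rewrite /f mul0r (bigD1 k)//= transition0 eqxx mulr1 big1 ?addr0//.
  by move=> j /andP[_ /negbTE jk]; rewrite transition0 jk mulr0.
rewrite -f0 -/(f t x).
have fd (s : R) z : is_derive s (1 : R) (fun s => f s z) (df s z).
  apply: is_derive_bigsum => j.
  have hd : is_derive s (1 : R) (fun s => s / th n) (th n)^-1.
    rewrite (_ : (fun s => _) = (fun s => (th n)^-1 *: s)).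
      by rewrite -[X in is_derive _ _ _ X]mulr1; apply: is_deriveZ.
    by apply/funext => u; rewrite mulrC.
  have hp := is_derive_transition r j k (s / th n).
  have hc := @is_derive1_comp _ (fun t => transition r t j k) (fun s => s / th n) s _ _ hp hd.
  rewrite (mulrC (semigroup _ _ _ _)) in hc.
  exact: (@is_deriveZ _ _ _ (fun s : R => transition r (s / th n) j k) (H n j z) s 1 _ hc).
apply: (duhamel_bound (q_ge0 n) _ t0 fd) => s z /andP[s0 _].
have st0 : 0 <= s / th n by rewrite divr_ge0 ?(ltW (th_gt0 n)).
have DE j : j \in S -> D s j = \sum_(l in S) G j l * transition r (s / th n) l k.
  move=> jS; rewrite /D -generator_semigroup.
  rewrite (_ : semigroup _ _ _ = fun u => \sum_l transition r (s / th n) l k * (u == l)%:R).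
    rewrite (generator_sum r xpredT) [LHS](bigID (mem S))/= [X in _ + X]big1 ?addr0.
      by apply: eq_bigr => l _; rewrite mulrC.
    move=> l lS; rewrite generator_delta; case: eqP => [jl|_].
      by move: lS; rewrite -jl jS.
    by rewrite r_off ?mulr0// (negbTE lS) andbF.
  by apply/funext => u; rewrite sum_delta transitionE.
have -> : df s z - generator (q n) (f s) z =
    - (\sum_(l in S) transition r (s / th n) l k * err n l z) / th n.
  have -> : generator (q n) (f s) z =
      \sum_(l in S) transition r (s / th n) l k * generator (q n) (H n l) z.
    rewrite -(generator_sum (q n) (mem S)); apply: eq_generator => u.
    by apply: eq_bigr => l _; rewrite mulrC.
  have -> : df s z = \sum_(l in S) transition r (s / th n) l k *
      ((th n)^-1 * \sum_(j in S) H n j z * G j l).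
    rewrite /df (eq_bigr (fun j => \sum_(l in S) transition r (s / th n) l k *
        ((th n)^-1 * (H n j z * G j l)))); last first.
      move=> j jS; rewrite DE// !mulr_sumr; apply: eq_bigr => l _; ring.
    rewrite exchange_big/=; apply: eq_bigr => l _.
    by rewrite -!mulr_sumr.
  rewrite -sumrB -sumrN mulr_suml; apply: eq_bigr => l _; rewrite /err.
  by field; rewrite gt_eqF.
rewrite normrM normrN normfV (gtr0_norm (th_gt0 n)) ler_wpM2r ?invr_ge0 ?(ltW (th_gt0 n))//.
rewrite (le_trans (ler_norm_sum _ _ _))// ler_sum// => l lS.
rewrite normrM ger0_norm ?transition_ge0//.
apply: (@le_trans _ _ `|err n l z|).
  by rewrite ler_piMl// transition_le1.
by rewrite (bigD1 z)//= lerDl sumr_ge0.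
Qed.

(** [a] is replaced by [H n] at cost [e1], the two evolutions are exchanged at cost [e2], and [H n]
    is replaced by [a] again in the limit. *)
Lemma slow_semigroup_cvg (t : nat -> R) (tau : R) k x : k \in S ->
  (forall n, 0 <= t n) -> t n / th n @[n --> \oo] --> tau ->
  semigroup (q n) (t n) (fun z => a z k) x @[n --> \oo] -->
    \sum_(j in S) a x j * transition r tau j k.
Proof.
move=> kS t0 t_tau.
pose e1 n := \sum_y `|a y k - H n k y|.
pose e2 n := (\sum_(l in S) \sum_y `|err n l y|) * (t n / th n).
pose g n := \sum_(j in S) H n j x * transition r (t n / th n) j k.
have e10 : e1 n @[n --> \oo] --> 0.
  apply: cvg0_sum => y _; rewrite (_ : (fun n => _) = fun n => `|H n k y - a y k|).
    by apply: cvg0_norm; exact: smoothed_potential_cvg.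
  by apply/funext => n; rewrite distrC.
have e20 : e2 n @[n --> \oo] --> 0.
  rewrite -[X in _ --> X](mul0r tau); apply: cvgM => //; apply: cvg0_sum => l lS; apply: cvg0_sum => y _.
  have herr : err n l y @[n --> \oo] --> 0 by exact: smoothed_error_cvg.
  have := cvg0_norm herr.
  by rewrite (_ : (fun n => `|_ - 0|) = fun n => `|err n l y|)//;
    apply/funext => n; rewrite subr0.
have gcvg : g n @[n --> \oo] --> \sum_(j in S) a x j * transition r tau j k.
  apply: cvg_bigsum => j jS; apply: cvgM; first exact: smoothed_potential_cvg.
  have cont : {for tau, continuous (fun s => transition r s j k)}.
    by apply: (is_derive_continuous (fun s => is_derive_transition r j k s)).
  exact: (cvg_comp _ _ t_tau cont).
rewrite (_ : (fun n => _) = fun n => (semigroup (q n) (t n) (fun z => a z k) x - g n) + g n).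
  rewrite -[X in _ --> X]add0r; apply: cvgD => //.
  apply: (@cvg_dist_bound _ _ (fun n => e1 n + e2 n)).
    move=> n; rewrite subr0.
    rewrite -[X in `|X|](subrKA (semigroup (q n) (t n) (H n k) x)).
    rewrite (le_trans (ler_normD _ _))// lerD//.
      exact: semigroup_dist_sum.
    rewrite distrC (le_trans (intertwining_bound n x kS (t0 n)))// /e2.
    by rewrite -mulrA (mulrC _ (t n)).
  by rewrite -[X in _ --> X]addr0; exact: cvgD.
by apply/funext => n; rewrite subrK.
Qed.

End Intermediate.

(** Essentially the geometric mean of [tm] and [th]; the extra term [th n / (n + 1)] keeps [d]
    positive where [tm] vanishes. *)
Lemma intermediate_scale : exists d : nat -> R, [/\ forall n, 0 < d n,
  tm n / d n @[n --> \oo] --> 0 & d n / th n @[n --> \oo] --> 0].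
Proof.
pose u n := tm n / th n; pose s n := Num.sqrt (u n) + n.+1%:R^-1.
have u0 n : 0 <= u n by rewrite divr_ge0 ?(pl_tm pl)// ltW.
have s0 n : 0 < s n by rewrite /s ltr_wpDl ?sqrtr_ge0// invr_gt0.
have sq0 : Num.sqrt (u n) @[n --> \oo] --> 0.
  rewrite -[X in _ --> X](@sqrtr0 R); apply: (cvg_comp _ _ tm_th).
  exact: sqrt_continuous.
exists (fun n => th n * s n); split.
- by move=> n; rewrite mulr_gt0.
- apply: (@cvg_dist_bound _ _ (fun n => Num.sqrt (u n))) => // n.
  have -> : tm n / (th n * s n) = u n / s n by rewrite invfM mulrA.
  rewrite subr0 ger0_norm; last exact: (divr_ge0 (u0 n) (ltW (s0 n))).
  rewrite ler_pdivrMr//.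
  rewrite /s mulrDr -expr2 sqr_sqrtr// lerDl mulr_ge0// ?sqrtr_ge0//.
- rewrite (_ : (fun n => _) = s); last first.
    by apply/funext => n; rewrite mulrAC divff ?mul1r// gt_eqF.
  rewrite -[X in _ --> X]addr0; apply: cvgD => //; exact: cvg_harmonic.
Qed.

Lemma level_limit t x y : 0 < t ->
  transition (q n) (t * th n) x y @[n --> \oo] -->
    \sum_(k in S) (\sum_(j in S) a x j * transition r t j k) * m k y.
Proof.
move=> t0; have [d [d0 tmd dth]] := intermediate_scale.
have [E hE] := scaled_exit_cvg r_cvg.
have d_exit : d n * exit_rate q pi S w n @[n --> \oo] --> 0.
  rewrite (_ : (fun n => _) = fun n => d n / th n * (th n * exit_rate q pi S w n)).
    by rewrite -[X in _ --> X](mul0r E); exact: cvgM.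
  by apply/funext => n; rewrite mulrA divfK// gt_eqF.
(* The time is split into a slow stretch [u n] followed by a mixing stretch [d n]. The difference
   may be negative for small [n], hence the truncation. *)
pose u n := Num.max 0 (t * th n - d n).
have u0 n : 0 <= u n by rewrite le_max lexx.
have uE : \forall n \near \oo, u n = t * th n - d n.
  have /cvgrPdist_le/(_ t t0) := dth; apply: filterS => n.
  rewrite sub0r normrN => /(le_trans (ler_norm _)).
  by rewrite ler_pdivrMr// => h; rewrite /u max_r// subr_ge0.
have uth : u n / th n @[n --> \oo] --> t.
  apply: (@cvg_near_bound _ _ (fun n => d n / th n)) => //.
  move: uE; apply: filterS => n ->.
  rewrite mulrBl mulfK ?gt_eqF// addrAC subrr add0r normrN ger0_norm//.
  by rewrite divr_ge0 ?(ltW (d0 n)) ?(ltW (th_gt0 n)).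
clearbody u.
pose g n := \sum_(k in S) semigroup (q n) (u n) (fun z => a z k) x * m k y.
have gcvg : g n @[n --> \oo] -->
    \sum_(k in S) (\sum_(j in S) a x j * transition r t j k) * m k y.
  apply: cvg_bigsum => k kS; apply: cvgM; last exact: cvg_cst.
  exact: (slow_semigroup_cvg d0 tmd dth kS u0 uth).
pose b n := \sum_z `|transition (q n) (d n) z y - kern z y|.
have b0 : b n @[n --> \oo] --> 0.
  by apply: cvg0_sum => z _; apply: cvg0_norm; exact: (pl_fast pl d0 tmd d_exit).
suff h : transition (q n) (t * th n) x y - g n @[n --> \oo] --> 0.
  rewrite (_ : (fun n => _) = fun n => (transition (q n) (t * th n) x y - g n) + g n).
    by rewrite -[X in _ --> X]add0r; exact: cvgD.
  by apply/funext => n; rewrite subrK.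
apply: (@cvg_near_bound _ _ b) => //.
move: uE; apply: filterS => n un; rewrite subr0.
have -> : transition (q n) (t * th n) x y =
    semigroup (q n) (u n) (fun z => transition (q n) (d n) z y) x.
  rewrite -[t * th n](subrK (d n)) -un transitionD semigroupE.
  by apply: eq_bigr.
have -> : g n = semigroup (q n) (u n) (fun z => kern z y) x.
  rewrite semigroupE /g; under [RHS]eq_bigr do rewrite mulr_sumr.
  rewrite exchange_big/=; apply: eq_bigr => k _; rewrite semigroupE mulr_suml.
  by apply: eq_bigr => z _; rewrite mulrA.
exact: semigroup_dist_sum.
Qed.

End LevelLimit.

(** * Passage to the next level *)

Section NextLevel.
Context (R : realType) (V : finType) (q : nat -> V -> V -> R) (pi : nat -> V -> R).
Hypothesis q_ge0 : forall n x y, 0 <= q n x y.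
Hypothesis q_irr : forall n, irreducible (q n).
Hypothesis pi_stat : forall n, stationary (q n) [set: V]%SET (pi n).

Let pi_gt0 n x : 0 < pi n x.
Proof. exact: (stationary_gt0 (q_ge0 n) (q_irr n) (pi_stat n)). Qed.

Context (I : finType) (S : {set I}) (w : I -> {set V}).
Context (a : V -> I -> R) (m : I -> V -> R) (tm : nat -> R).
Hypothesis pl : prelevel q pi S w a m tm.
Context (th : nat -> R) (r : I -> I -> R).
Hypothesis th_gt0 : forall n, 0 < th n.
Hypothesis r_off : forall i j, ~~ [&& i \in S, j \in S & i != j] -> r i j = 0.
Hypothesis r_cvg : forall i j, i \in S -> j \in S -> i != j ->
  th n * well_rate q pi S w n i j @[n --> \oo] --> r i j.
Hypothesis tm_th : tm n / th n @[n --> \oo] --> 0.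

Let ok : wells_ok pi S w m := pl_ok pl.

Let r_ge0 i j : 0 <= r i j.
Proof. exact: (scaled_rate_ge0 q_ge0 q_irr pi_stat ok th_gt0 r_off r_cvg). Qed.

Let S_closed : closed r S. Proof. exact: scaled_rate_closed. Qed.

Implicit Types (C D : {set I}) (M : {set V}).

Let union (C : {set I}) : {set V} := (\bigcup_(i in C) w i)%SET.

Definition merged_wells : {set {set V}} :=
  [set (\bigcup_(i in (C : {set I})) w i)%SET | C in closed_classes r S]%SET.

Definition submembers (M : {set V}) : {set I} := [set i in S | w i \subset M]%SET.

Definition merged_absorption x M : R :=
  \sum_(j in S) a x j * absorb r (submembers M) j.

Definition merged_measure M x : R :=
  \sum_(j in submembers M) stationary_measure r (submembers M) j * m j x.

Let S' := merged_wells.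
Let w' := fun M : {set V} => M.
Let Cs := closed_classes r S.

Let CsP C : C \in Cs -> closed_irreducible r C /\ C \subset S.
Proof. by rewrite inE => /andP[]. Qed.

Let mem_union (C : {set I}) (i : I) (x : V) : i \in C -> x \in w i -> x \in union C.
Proof. by move=> iC xi; apply/finset.bigcupP; exists i. Qed.

Lemma submembers_union C : C \in Cs -> submembers (union C) = C.
Proof.
move=> /CsP[_ /fintype.subsetP CS]; apply/setP => i; rewrite inE.
apply/andP/idP => [[iS /fintype.subsetP iC]|iC].
  have [x xi] := set0Pn _ (well_ne ok iS).
  have /finset.bigcupP[j jC xj] := iC x xi.
  by rewrite (well_disj ok iS (CS _ jC) xi xj).
split; first exact: CS.
by apply/fintype.subsetP => x; exact: mem_union.
Qed.

Lemma sum_merged (F : {set V} -> R) : \sum_(M in S') F M = \sum_(C in Cs) F (union C).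
Proof.
rewrite /S' /merged_wells big_imset//= => C D CC DC /(congr1 submembers).
by rewrite !submembers_union.
Qed.

Lemma merged_measureE C x : C \in Cs ->
  merged_measure (union C) x = \sum_(j in C) stationary_measure r C j * m j x.
Proof. by move=> CC; rewrite /merged_measure submembers_union. Qed.

Lemma mass_union n C : C \in Cs -> mass pi n (union C) = \sum_(i in C) mass pi n (w i).
Proof. by move=> /CsP[_ CS]; rewrite /mass (sum_unionE ok). Qed.

Lemma union_ne C : C \in Cs -> union C != finset.set0.
Proof.
move=> /CsP[/closed_irreducibleP[C0 _ _] /fintype.subsetP CS].
have [i iC] := set0Pn _ C0; have [x xi] := set0Pn _ (well_ne ok (CS _ iC)).
by apply/set0Pn; exists x; exact: (mem_union iC xi).
Qed.

Let nu n C i := mass pi n (w i) / mass pi n (union C).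

Let nu_ge0 n C i : C \in Cs -> i \in S -> 0 <= nu n C i.
Proof.
move=> CC iS; rewrite divr_ge0 ?ltW//; last by apply: (mass_gt0 q_ge0 q_irr pi_stat) => //; exact: union_ne.
by apply: (mass_gt0 q_ge0 q_irr pi_stat) => //; exact: (well_ne ok).
Qed.

Let nu_sum1 n C : C \in Cs -> \sum_(i in C) nu n C i = 1.
Proof.
move=> CC; rewrite -mulr_suml -mass_union// divff// gt_eqF//.
by apply: (mass_gt0 q_ge0 q_irr pi_stat) => //; exact: union_ne.
Qed.

Let nu_le1 n C i : C \in Cs -> i \in C -> nu n C i <= 1.
Proof.
move=> CC iC; have [_ /fintype.subsetP CS] := CsP CC.
rewrite -(nu_sum1 n CC) (bigD1 i)//= lerDl; apply: sumr_ge0 => j /andP[jC _].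
by apply: nu_ge0 => //; exact: CS.
Qed.

Let outflow n C := \sum_(k in C) nu n C k *
  \sum_(i in S | i \notin C) th n * well_rate q pi S w n k i.

Lemma class_rate0 C k l : C \in Cs -> k \in C -> l \notin C -> r k l = 0.
Proof.
by move=> /CsP[/class_closed Cc _] kC lC; exact: (closed_rate0 r_ge0 Cc kC lC).
Qed.

Lemma outflow_cvg C : C \in Cs -> outflow n C @[n --> \oo] --> 0.
Proof.
move=> CC; have [_ /fintype.subsetP CS] := CsP CC.
apply: cvg0_sum => k kC; apply: (cvg0_bounded_mul (B := 1)).
  by move=> n; rewrite ger0_norm ?nu_le1// nu_ge0// CS.
apply: cvg0_sum => i /andP[iS iC].
rewrite -(class_rate0 CC kC iC); apply: r_cvg => //; first exact: CS.
by apply: contraNneq iC => <-.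
Qed.

Lemma class_rate_sum n C k : C \in Cs -> k \in C ->
  \sum_(l in C) well_rate q pi S w n k l = - \sum_(i in S | i \notin C) well_rate q pi S w n k i.
Proof.
move=> /CsP[_ /fintype.subsetP CS] kC; apply/eqP; rewrite -addr_eq0; apply/eqP.
have := well_rate_sum0 q_ge0 q_irr ok n k; rewrite (bigID (mem C))/=.
congr (_ + _ = _); apply: eq_bigl => l; rewrite andb_idl//; exact: CS.
Qed.

Lemma outflowE n C : C \in Cs -> outflow n C =
  - (th n * \sum_(k in C) nu n C k * \sum_(l in C) well_rate q pi S w n k l).
Proof.
move=> CC; rewrite mulr_sumr -sumrN; apply: eq_bigr => k kC.
rewrite class_rate_sum// -mulr_sumr; ring.
Qed.

Let inflow n C l := \sum_(i in S | i \notin C) nu n C i * (th n * well_rate q pi S w n i l).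

Lemma inflowE n C l : C \in Cs ->
  \sum_(k in C) nu n C k * (th n * well_rate q pi S w n k l) = - inflow n C l.
Proof.
move=> CC; have [_ /fintype.subsetP CS] := CsP CC.
apply/eqP; rewrite -addr_eq0; apply/eqP.
have := well_balance q_ge0 q_irr pi_stat ok n l.
move=> /(congr1 (fun z => th n / mass pi n (union C) * z)); rewrite mulr0 mulr_sumr.
rewrite (bigID (mem C))/= => e; rewrite -[RHS]e; congr (_ + _); last by apply: eq_bigr => i _; rewrite /nu; ring.
rewrite [RHS](eq_bigl (mem C)); last by move=> i /=; rewrite andb_idl//; exact: CS.
by apply: eq_bigr => i _; rewrite /nu; ring.
Qed.

(** Wells outside [C] may be much heavier than [C], so [nu n C i] is not controlled there and small
    rates alone do not suffice. By stationarity the total inflow equals the outflow, which vanishes,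
    and its summands are nonnegative. *)
Lemma inflow_cvg C l : C \in Cs -> l \in C -> inflow n C l @[n --> \oo] --> 0.
Proof.
move=> CC lC; have [_ /fintype.subsetP CS] := CsP CC.
have in0 n k : k \in C -> 0 <= inflow n C k.
  move=> kC; apply: sumr_ge0 => i /andP[iS iC].
  rewrite mulr_ge0 ?nu_ge0// mulr_ge0 ?(ltW (th_gt0 n))//.
  apply: (well_rate_ge0 q_ge0 q_irr pi_stat ok n iS (CS _ kC)).
  by apply: contraNneq iC => ->.
apply: (@cvg_dist_bound _ _ (fun n => outflow n C)); last exact: outflow_cvg.
move=> n; rewrite subr0 ger0_norm ?in0//.
apply: (@le_trans _ _ (\sum_(k in C) inflow n C k)).
  rewrite (bigD1 l)//= lerDl; apply: sumr_ge0 => k /andP[kC _]; exact: in0.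
rewrite outflowE// le_eqVlt; apply/orP; left; apply/eqP/oppr_inj.
rewrite opprK -sumrN; under eq_bigr do rewrite -inflowE//.
rewrite exchange_big/= mulr_sumr; apply: eq_bigr => k _.
by rewrite !mulr_sumr; apply: eq_bigr => j _; ring.
Qed.

(** The relative masses in [C] are invariant for the scaled rates up to the inflow, hence
    asymptotically invariant for [r]. *)
Lemma nu_cvg C i : C \in Cs -> i \in C -> nu n C i @[n --> \oo] --> stationary_measure r C i.
Proof.
move=> CC iC; have [Ci CSs] := CsP CC; have /fintype.subsetP CS := CSs.
pose nuC n k := if k \in C then nu n C k else 0.
rewrite (_ : (fun n => _) = fun n => nuC n i); last by apply/funext => n; rewrite /nuC iC.
have nuCE n (F : I -> R) : \sum_k nuC n k * F k = \sum_(k in C) nu n C k * F k.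
  by rewrite [RHS]big_mkcond/=; apply: eq_bigr => k _; rewrite /nuC; case: ifP; rewrite ?mul0r.
apply: (approximate_stationarity r_ge0 Ci).
- by move=> n k; rewrite /nuC; case: ifP => // kC; apply: nu_ge0 => //; exact: CS.
- by move=> n k /negbTE kC; rewrite /nuC kC.
- by move=> n; rewrite /nuC -big_mkcond/= nu_sum1.
move=> l; rewrite (_ : (fun n => _) = fun n => \sum_(k in C)
    nu n C k * generator r (fun u => (u == l)%:R) k); last first.
  by apply/funext => n; rewrite nuCE.
have [lC|lC] := boolP (l \in C); last first.
  rewrite (_ : (fun n => _) = fun=> 0); first exact: cvg_cst.
  apply/funext => n; apply: big1 => k kC; rewrite generator_delta.
  case: eqP => [kl|_]; first by move: lC; rewrite -kl kC.
  by rewrite (class_rate0 CC kC lC) mulr0.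
rewrite (_ : (fun n => _) = fun n => \sum_(k in C) nu n C k *
    (generator r (fun u => (u == l)%:R) k - th n * well_rate q pi S w n k l) - inflow n C l).
  rewrite -[X in _ --> X]subr0; apply: cvgB; last exact: inflow_cvg.
  apply: cvg0_sum => k kC; apply: (cvg0_bounded_mul (B := 1)).
    by move=> n; rewrite ger0_norm ?nu_le1// nu_ge0// CS.
  rewrite -[X in _ --> X](subrr (generator r (fun u => (u == l)%:R) k)).
  apply: cvgB; first exact: cvg_cst.
  exact: (scaled_rate_cvg q_ge0 q_irr ok r_off r_cvg (CS _ kC) (CS _ lC)).
apply/funext => n; rewrite -inflowE// -big_split/=; apply: eq_bigr => k _; ring.
Qed.

Lemma merged_wells_ok : wells_ok pi S' w' merged_measure.
Proof.
have smP C := fun CC => stationary_measureP r_ge0 (CsP (C := C) CC).1.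
split.
- have [i iS] := set0Pn _ (wells_ne ok).
  have [C [Ci iC]] := reachable_class r i.
  apply/set0Pn; exists (union C); apply/imsetP; exists C => //.
  rewrite inE Ci andbT; apply/fintype.subsetP => j /iC.
  exact: (closed_reachable S_closed).
- by move=> _ /imsetP[C CC ->]; exact: union_ne.
- move=> _ _ x /imsetP[C CC ->] /imsetP[D DC ->].
  move=> /finset.bigcupP[i iC xi] /finset.bigcupP[j jD xj].
  have [Ci /fintype.subsetP CS] := CsP CC; have [Di /fintype.subsetP DS] := CsP DC.
  have ij := well_disj ok (CS _ iC) (DS _ jD) xi xj; subst j.
  by congr union; exact: (class_eq Ci Di iC jD).
- move=> _ x /imsetP[C CC ->] xC; rewrite merged_measureE// big1// => j jC.
  have [_ /fintype.subsetP CS] := CsP CC.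
  rewrite (well_supp ok) ?mulr0//; first exact: CS.
  by apply: contra xC => /(mem_union jC).
- move=> _ x /imsetP[C CC ->] /finset.bigcupP[i iC xi]; rewrite merged_measureE//.
  have [Ci /fintype.subsetP CS] := CsP CC.
  rewrite (bigD1 i)//= ltr_pwDl//.
    by rewrite mulr_gt0 ?(well_pos ok (CS _ iC) xi)// stationary_measure_gt0.
  apply: sumr_ge0 => j /andP[jC _].
  by rewrite mulr_ge0 ?(ltW (stationary_measure_gt0 r_ge0 Ci jC))// (well_ge0 ok)// CS.
- move=> _ /imsetP[C CC ->].
  rewrite (eq_bigr (fun x => \sum_(j in C) stationary_measure r C j * m j x)); last first.
    by move=> x _; exact: (merged_measureE x CC).
  have [Ci /fintype.subsetP CS] := CsP CC.
  rewrite exchange_big/= (eq_bigr (fun j => stationary_measure r C j)); last first.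
    by move=> j jC; rewrite -mulr_sumr (well_sum1 ok (CS _ jC)) mulr1.
  have [_ supp <- _] := smP C CC.
  rewrite [RHS](bigID (mem C))/= [X in _ = _ + X]big1 ?addr0//.
move=> _ x /imsetP[C CC ->] /finset.bigcupP[i iC xi]; rewrite merged_measureE//.
have [Ci /fintype.subsetP CS] := CsP CC.
rewrite [X in _ --> X](_ : _ = stationary_measure r C i * m i x); last first.
  rewrite (bigD1 i)//= big1 ?addr0// => j /andP[jC ji].
  rewrite (well_supp ok) ?mulr0//; first exact: CS.
  apply: contra ji => xj; apply/eqP; exact: (well_disj ok (CS _ jC) (CS _ iC) xj xi).
(* The weight inside the merged well factors into the share of the old well and the weight inside
   the old well. *)
rewrite (_ : (fun n => _) = fun n => nu n C i * (pi n x / mass pi n (w i))).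
  by apply: cvgM; [exact: nu_cvg|exact: (well_mu ok (CS _ iC) xi)].
apply/funext => n.
have Mi : mass pi n (w i) != 0 by rewrite gt_eqF// (mass_gt0 q_ge0 q_irr pi_stat)// (well_ne ok)// CS.
have MC : mass pi n (union C) != 0 by rewrite gt_eqF// (mass_gt0 q_ge0 q_irr pi_stat)// union_ne.
by rewrite /nu /w' -/(union C); field; rewrite MC Mi.
Qed.

Let ok' := merged_wells_ok.

Lemma dom_merged : {subset dom S' w' <= dom S w}.
Proof.
move=> x /finset.bigcupP[_ /imsetP[C CC ->] /finset.bigcupP[i iC xi]].
by have [_ /fintype.subsetP CS] := CsP CC; exact: (mem_dom (CS _ iC) xi).
Qed.

(** The potential [h] of the merged well dominates the sum [g] of the old potentials over [C]: on
    the wells of [C] both are 1, on the other wells [g] is 0, and both are harmonic off the old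
    wells. As they agree on the merged well, the generator of [h] is at least that of [g] there. *)
Lemma merged_exit_le n C : C \in Cs ->
  - well_rate q pi S' w' n (union C) (union C) <=
  \sum_(k in C) nu n C k * \sum_(i in S | i \notin C) well_rate q pi S w n k i.
Proof.
move=> CC; have [_ CSs] := CsP CC; have /fintype.subsetP CS := CSs.
have CS' : union C \in S' by apply/imsetP; exists C.
pose g x := \sum_(k in C) potential q S w n k x.
pose h := potential q S' w' n (union C).
have gD i x : i \in S -> x \in w i -> g x = (i \in C)%:R.
  move=> iS xi; rewrite /g; have [iC|iC] := boolP (i \in C).
    rewrite (bigD1 i)//= (potential_well q_ge0 q_irr ok n iS iS xi) eqxx big1 ?addr0//.
    move=> k /andP[kC ki]; rewrite (potential_well q_ge0 q_irr ok n iS (CS _ kC) xi).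
    by rewrite eq_sym (negbTE ki).
  rewrite big1// => k kC; rewrite (potential_well q_ge0 q_irr ok n iS (CS _ kC) xi).
  by case: eqP => // ik; move: iC; rewrite ik kC.
have gL x : generator (q n) g x = \sum_(k in C) generator (q n) (potential q S w n k) x.
  have := generator_sum (q n) (mem C) (fun=> 1) (fun k => potential q S w n k) x.
  under [X in _ = X -> _]eq_bigr do rewrite mul1r.
  by move=> <-; apply: eq_generator => u; apply: eq_bigr => k _; rewrite mul1r.
have hg x : 0 <= h x - g x.
  apply: (@min_principle _ _ _ (q_ge0 n) (q_irr n) (dom S w) (fun x => h x - g x) 0) => [||y /finset.bigcupP[i iS yi]].
  - exact: (dom_ne ok).
  - move=> y yD; rewrite generatorB gL big1 ?subr0; last first.
      by move=> k kC; rewrite (potential_off q_ge0 q_irr ok).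
    rewrite (potential_off q_ge0 q_irr ok')//.
    by apply: contra yD; exact: dom_merged.
  rewrite (gD i)//; have [iC|iC] := boolP (i \in C).
    rewrite /h (potential_well q_ge0 q_irr ok' n CS' CS') ?eqxx ?subrr//.
    exact: (mem_union iC yi).
  by rewrite subr0 (potential_ge0 q_ge0 q_irr ok').
have hL x : x \in union C -> - generator (q n) h x <= - generator (q n) g x.
  move=> xC; rewrite lerN2 -subr_ge0 -generatorB; apply: generator_at_zero_ge0 => //.
  rewrite /h (potential_well q_ge0 q_irr ok' n CS' CS' xC) eqxx.
  have /finset.bigcupP[i iC xi] := xC.
  by rewrite (gD i) ?CS// iC subrr.
have M0 : 0 < mass pi n (union C) by apply: (mass_gt0 q_ge0 q_irr pi_stat) => //; exact: union_ne.
apply: (@le_trans _ _ ((mass pi n (union C))^-1 *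
    \sum_(x in union C) pi n x * - generator (q n) g x)).
  rewrite /well_rate -mulrN -sumrN ler_wpM2l ?invr_ge0 ?(ltW M0)//.
  by apply: ler_sum => x xC; rewrite -mulrN ler_wpM2l ?(ltW (pi_gt0 n x))// hL.
rewrite (sum_unionE ok)// mulr_sumr le_eqVlt; apply/orP; left; apply/eqP.
apply: eq_bigr => k kC; rewrite /nu -mulrA mulrCA; congr (_ * _).
rewrite -[X in _ * X]opprK -class_rate_sum// /well_rate.
have Mk : mass pi n (w k) != 0 by rewrite gt_eqF// (mass_gt0 q_ge0 q_irr pi_stat)// (well_ne ok)// CS.
under [X in _ * - X]eq_bigr do rewrite mulrC.
rewrite -mulr_suml mulrN mulrCA divff ?mulr1//.
rewrite exchange_big/= -sumrN; apply: eq_bigr => x _.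
by rewrite gL mulrN -mulr_sumr.
Qed.

Lemma merged_exit_cvg : th n * exit_rate q pi S' w' n @[n --> \oo] --> 0.
Proof.
apply: (@cvg_dist_bound _ _ (fun n => \sum_(C in Cs) outflow n C)); last first.
  by apply: cvg0_sum => C CC; exact: outflow_cvg.
move=> n; rewrite subr0 ger0_norm; last first.
  by rewrite mulr_ge0 ?(ltW (th_gt0 n))// (exit_rate_ge0 q_ge0 q_irr pi_stat ok').
rewrite /exit_rate (eq_bigr (fun M => - well_rate q pi S' w' n M M)); last first.
  by move=> M MS; rewrite (well_rate_diag q_ge0 q_irr ok')// opprK.
rewrite sum_merged mulr_sumr; apply: ler_sum => C CC.
apply: le_trans (ler_wpM2l (ltW (th_gt0 n)) (merged_exit_le n CC)) _.
rewrite /outflow le_eqVlt; apply/orP; left; apply/eqP.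
rewrite [LHS]mulr_sumr; apply: eq_bigr => k _.
by rewrite [LHS]mulrCA; congr (_ * _); rewrite [LHS]mulr_sumr.
Qed.

Let E T x y := \sum_(k in S) (\sum_(j in S) a x j * transition r T j k) * m k y.
Let kern' x y := \sum_(M in S') merged_absorption x M * merged_measure M y.

Lemma level_limit_cvg x y : E T x y @[T --> +oo] --> kern' x y.
Proof.
rewrite (_ : kern' x y = \sum_(k in S) (\sum_(j in S) a x j *
    \sum_(C in Cs) absorb r C j * stationary_measure r C k) * m k y).
  apply: cvg_bigsum => k kS; apply: cvgM; last exact: cvg_cst.
  apply: cvg_bigsum => j jS; apply: cvgM; first exact: cvg_cst.
  exact: transition_cvg.
rewrite /kern' sum_merged.
under [RHS]eq_bigr do under eq_bigr do rewrite mulr_sumr.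
under [RHS]eq_bigr do rewrite exchange_big/= mulr_suml.
rewrite exchange_big/=; apply: eq_bigr => C CC.
have [Ci /fintype.subsetP CS] := CsP CC.
rewrite merged_measureE// /merged_absorption submembers_union//.
rewrite [RHS](bigID (mem C))/= [X in _ = _ + X]big1 ?addr0; last first.
  move=> k /andP[_ kC]; have [_ supp _ _] := stationary_measureP r_ge0 Ci.
  by rewrite big1 ?mul0r// => j _; rewrite supp// !mulr0.
rewrite [RHS](eq_bigl (mem C)); last by move=> k /=; rewrite andb_idl//; exact: CS.
rewrite mulr_sumr; apply: eq_bigr => k _; rewrite mulrA; congr (_ * _).
by rewrite mulr_suml; apply: eq_bigr => j _; rewrite mulrA.
Qed.

Let late e : 0 < e -> exists T, 0 < T /\ \sum_x \sum_y `|E T x y - kern' x y| <= e.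
Proof.
move=> e0.
have h : \sum_x \sum_y `|E T x y - kern' x y| @[T --> +oo] --> (0 : R).
  rewrite [X in _ --> X](_ : _ = \sum_(x : V) \sum_(y : V) `|kern' x y - kern' x y|).
    apply: cvg_bigsum => x _; apply: cvg_bigsum => y _; apply: cvg_norm.
    by apply: cvgB; [exact: level_limit_cvg|exact: cvg_cst].
  by rewrite big1// => x _; rewrite big1// => y _; rewrite subrr normr0.
have A1 : \forall T \near +oo, (0 : R) < T by apply: nbhs_pinfty_gt; rewrite num_real.
have /cvgrPdist_le/(_ e e0) A2 := h.
have [T [T0 hT]] := filter_ex (filterI A1 A2); exists T; split=> //.
by move: hT => /=; rewrite sub0r normrN => /(le_trans (ler_norm _)).
Qed.

Let limit_at T x y : 0 < T ->
  transition (q n) (T * th n) x y @[n --> \oo] --> E T x y.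
Proof. exact: (level_limit q_ge0 q_irr pi_stat pl th_gt0 r_off r_cvg tm_th). Qed.

Let limit_gap T n := \sum_x \sum_y `|transition (q n) (T * th n) x y - E T x y|.

Let limit_gap_cvg T : 0 < T -> limit_gap T n @[n --> \oo] --> 0.
Proof.
move=> T0; apply: cvg0_sum => x _; apply: cvg0_sum => y _; apply: cvg0_norm.
exact: limit_at.
Qed.

(** The merged potential is nearly preserved up to time [T * th n], when the law is close to
    [kern']; [kernel_potential] evaluates its integral against [kern'] exactly. *)
Lemma merged_potential_cvg M x : M \in S' ->
  potential q S' w' n M x @[n --> \oo] --> merged_absorption x M.
Proof.
move=> MS; have [K K0 hK] := potential_slow q_ge0 q_irr pi_stat ok'.
apply: cvg_approx => e e0; have [T [T0 hT]] := late e0.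
exists (fun n => K * (T * (th n * exit_rate q pi S' w' n)) + limit_gap T n).
  rewrite -[X in _ --> X]addr0; apply: cvgD; last exact: limit_gap_cvg.
  rewrite -[X in _ --> X](mulr0 K); apply: cvgM; first exact: cvg_cst.
  rewrite -[X in _ --> X](mulr0 T); apply: cvgM; first exact: cvg_cst.
  exact: merged_exit_cvg.
apply: nearW => n.
set f := potential q S' w' n M.
have f1 y : `|f y| <= 1 by exact: (potential_norm q_ge0 q_irr ok').
have tT0 : 0 <= T * th n by rewrite mulr_ge0 ?(ltW T0) ?(ltW (th_gt0 n)).
have h1 := hK n M x _ MS tT0; rewrite -/f -(mulrA T) distrC in h1.
rewrite -(kernel_potential q_ge0 q_irr ok' merged_absorption n x MS) -/f.
rewrite -[X in `|X|](subrKA (semigroup (q n) (T * th n) f x)).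
rewrite (le_trans (ler_normD _ _))// [leRHS]addrCA lerD//.
rewrite -[X in `|X|](subrKA (\sum_y E T x y * f y)).
rewrite (le_trans (ler_normD _ _))// [leLHS]addrC lerD//.
  rewrite -sumrB (le_trans (ler_norm_sum _ _ _))//; apply: le_trans hT.
  rewrite [leRHS](bigD1 x)//= ler_wpDr//; first by apply: sumr_ge0 => z _; exact: sumr_ge0.
  by apply: ler_sum => y _; rewrite -mulrBl normrM ler_piMr.
rewrite semigroupE -sumrB (le_trans (ler_norm_sum _ _ _))// /limit_gap.
rewrite [leRHS](bigD1 x)//= ler_wpDr//; first by apply: sumr_ge0 => z _; exact: sumr_ge0.
by apply: ler_sum => y _; rewrite -mulrBl normrM ler_piMr.
Qed.

(** The last stretch [T * th n] of the time relaxes the chain to [kern'], as a function of its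
    position at time [u]. That function is a combination of absorption weights, which are close to
    the merged potentials, and these hardly change up to time [d n]. *)
Lemma merged_fast (d : nat -> R) : (forall n, 0 < d n) ->
  th n / d n @[n --> \oo] --> 0 ->
  d n * exit_rate q pi S' w' n @[n --> \oo] --> 0 ->
  forall x y, transition (q n) (d n) x y @[n --> \oo] --> kern' x y.
Proof.
move=> d0 th_d d_exit x y.
have [K K0 hK] := potential_slow q_ge0 q_irr pi_stat ok'.
pose gap M n := \sum_z `|potential q S' w' n M z - merged_absorption z M|.
have gap0 M : M \in S' -> gap M n @[n --> \oo] --> 0.
  by move=> MS; apply: cvg0_sum => z _; apply: cvg0_norm; exact: merged_potential_cvg.
apply: cvg_approx => e e0; have [T [T0 hT]] := late e0.
exists (fun n => limit_gap T n + \sum_(M in S')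
    `|merged_measure M y| * (gap M n + (K * (d n * exit_rate q pi S' w' n) + gap M n))).
  rewrite -[X in _ --> X]addr0; apply: cvgD; first exact: limit_gap_cvg.
  apply: cvg0_sum => M MS; rewrite -[X in _ --> X](mulr0 `|merged_measure M y|).
  apply: cvgM; first exact: cvg_cst.
  rewrite -[X in _ --> X]addr0; apply: cvgD; first exact: gap0.
  rewrite -[X in _ --> X]addr0; apply: cvgD; last exact: gap0.
  by rewrite -[X in _ --> X](mulr0 K); apply: cvgM => //; exact: cvg_cst.
have Ti0 : 0 < T^-1 by rewrite invr_gt0.
have /cvgrPdist_le/(_ _ Ti0) := th_d; apply: filterS => n.
rewrite sub0r normrN => /(le_trans (ler_norm _)); rewrite ler_pdivrMr// mulrC ler_pdivlMr// mulrC.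
move=> Td; pose u := d n - T * th n.
have u0 : 0 <= u by rewrite subr_ge0.
have ud : u <= d n by rewrite /u gerBl mulr_ge0 ?(ltW T0) ?(ltW (th_gt0 n)).
have -> : transition (q n) (d n) x y =
    semigroup (q n) u (fun z => transition (q n) (T * th n) z y) x.
  by rewrite -[d n](subrK (T * th n)) -/u transitionD semigroupE; apply: eq_bigr.
rewrite -[X in `|X|](subrKA (semigroup (q n) u (fun z => kern' z y) x)).
rewrite (le_trans (ler_normD _ _))// addrA lerD//.
  rewrite (le_trans (semigroup_dist_sum _ _ _ (q_ge0 n) u0))//.
  apply: (@le_trans _ _ (\sum_z (`|E T z y - kern' z y| +
      `|transition (q n) (T * th n) z y - E T z y|))).
    apply: ler_sum => z _; rewrite [leRHS]addrC.
    rewrite -[X in `|X| <= _](subrKA (E T z y)); exact: ler_normD.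
  rewrite big_split/= lerD//.
    apply: le_trans hT; apply: ler_sum => z _.
    by rewrite (bigD1 y)//= lerDl sumr_ge0.
  by apply: ler_sum => z _; rewrite [leRHS](bigD1 y)//= lerDl sumr_ge0.
have -> : semigroup (q n) u (fun z => kern' z y) x = \sum_(M in S') merged_measure M y *
    semigroup (q n) u (fun z => merged_absorption z M) x.
  rewrite semigroupE; under eq_bigr do rewrite mulr_sumr.
  rewrite exchange_big/=; apply: eq_bigr => M _; rewrite semigroupE mulr_sumr.
  by apply: eq_bigr => z _; ring.
rewrite {1}/kern' -sumrB (le_trans (ler_norm_sum _ _ _))// ler_sum// => M MS.
rewrite (mulrC (merged_absorption x M)) -mulrBr normrM ler_wpM2l//.
set f := potential q S' w' n M.
rewrite -[X in `|X|](subrKA (semigroup (q n) u f x)).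
rewrite (le_trans (ler_normD _ _))// lerD//.
  rewrite (le_trans (semigroup_dist_sum _ _ _ (q_ge0 n) u0))// /gap.
  by apply: ler_sum => z _; rewrite distrC.
rewrite -[X in `|X|](subrKA (f x)) (le_trans (ler_normD _ _))// lerD//.
  apply: le_trans (hK n M x u MS u0) _; rewrite ler_wpM2l// ler_wpM2r//.
  exact: (exit_rate_ge0 q_ge0 q_irr pi_stat ok').
by rewrite /gap [leRHS](bigD1 x)//= lerDl sumr_ge0.
Qed.

Lemma next_prelevel : prelevel q pi merged_wells id merged_absorption merged_measure th.
Proof.
split.
- exact: merged_wells_ok.
- by move=> n; exact: ltW.
- exact: merged_exit_cvg.
- exact: merged_fast.
Qed.

End NextLevel.

(** * The first and the last level *)

Section LevelZero.
Context (R : realType) (V : finType) (q : nat -> V -> V -> R) (pi : nat -> V -> R).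
Hypothesis q_ge0 : forall n x y, 0 <= q n x y.
Hypothesis q_irr : forall n, irreducible (q n).
Hypothesis pi_stat : forall n, stationary (q n) [set: V]%SET (pi n).

Let pi_gt0 n x : 0 < pi n x.
Proof. exact: (stationary_gt0 (q_ge0 n) (q_irr n) (pi_stat n)). Qed.

Let w (x : V) : {set V} := [set x]%SET.

Lemma well_rate_singleton n x y : x != y -> well_rate q pi [set: V]%SET w n x y = q n x y.
Proof.
move=> xy; rewrite /well_rate /mass !big_set1 mulKf ?gt_eqF//.
rewrite -(trace_setT (q_ge0 n) (q_irr n) xy) /trace /potential.
have -> : dom [set: V]%SET w = [set: V]%SET.
  by apply/setP => u; rewrite [RHS]inE; apply/finset.bigcupP; exists u; rewrite !inE.
congr (generator _ (harm _ _ _) _); apply/funext => u; by rewrite inE.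
Qed.

Lemma wells_singleton_ok (x0 : V) :
  wells_ok pi [set: V]%SET w (fun x y => (x == y)%:R).
Proof.
split.
- by apply/set0Pn; exists x0; rewrite inE.
- by move=> x _; apply/set0Pn; exists x; rewrite inE.
- by move=> x y z _ _; rewrite !inE => /eqP <- /eqP.
- by move=> x y _; rewrite inE eq_sym => /negbTE ->.
- by move=> x y _; rewrite inE => /eqP ->; rewrite eqxx.
- by move=> x _; rewrite (bigD1 x)//= eqxx big1 ?addr0// => y /negbTE yx; rewrite eq_sym yx.
move=> x y _; rewrite inE => /eqP ->; rewrite eqxx /mass.
rewrite (_ : (fun n => _) = fun=> 1); first exact: cvg_cst.
by apply/funext => n; rewrite big_set1 divff// gt_eqF.
Qed.

(** Here [exit_rate] is the total of all jump rates; on time scales well below its inverse the chain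
    has not moved, whence the identity kernel. *)
Lemma level_zero (x0 : V) : prelevel q pi [set: V]%SET w
  (fun x y => (x == y)%:R) (fun x y => (x == y)%:R) (fun=> 0).
Proof.
have ok := wells_singleton_ok x0; split=> //.
- rewrite (_ : (fun n => _) = fun=> 0); first exact: cvg_cst.
  by apply/funext => n; rewrite mul0r.
move=> d d0 _ d_exit x y.
rewrite (_ : \sum_(i in _) _ = (x == y)%:R); last first.
  rewrite (bigD1 x)//= ?inE// eqxx mul1r big1 ?addr0// => z /andP[_ zx].
  by rewrite eq_sym (negbTE zx) mul0r.
apply: (@cvg_dist_bound _ _ (fun n => exit_rate q pi [set: V]%SET w n * d n)); last first.
  by rewrite (_ : (fun n => _) = fun n => d n * exit_rate q pi [set: V]%SET w n)//;
    apply/funext => n; rewrite mulrC.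
move=> n; rewrite transitionE; apply: semigroup_dist => //; first exact: ltW.
move=> z; rewrite generator_delta; case: eqP => [->|/eqP zy]; last first.
  rewrite ger0_norm// -(well_rate_singleton n zy).
  by apply: (well_rate_le_exit q_ge0 q_irr pi_stat ok); rewrite ?inE.
rewrite normrN ger0_norm ?sumr_ge0// /exit_rate.
rewrite [leRHS](bigD1 y)/= ?inE//.
rewrite [leLHS](_ : _ = \sum_(j in [set: V]%SET | j != y) well_rate q pi [set: V]%SET w n y j).
  rewrite lerDl; apply: sumr_ge0 => i _; apply: sumr_ge0 => j /andP[_ ji].
  by apply: (well_rate_ge0 q_ge0 q_irr pi_stat ok); rewrite ?inE// eq_sym.
rewrite [RHS](eq_bigl (fun j => j != y)); last by move=> j; rewrite inE.
by apply: eq_bigr => j jy; rewrite well_rate_singleton// eq_sym.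
Qed.

End LevelZero.

(** * Comparability and the fractions of the total rate *)

Section WellRatios.
Context (R : realType) (V : finType) (E : rel V) (q : nat -> V -> V -> R).
Context (pi : nat -> V -> R).
Hypothesis q_edge : forall n x y, E x y -> 0 < q n x y.
Hypothesis q_nonedge : forall n x y, ~~ E x y -> q n x y = 0.
Hypothesis q_irr : forall n, irreducible (q n).
Hypothesis pi_stat : forall n, stationary (q n) [set: V]%SET (pi n).
Hypothesis q_comparable : forall (m : nat) (k l : V * V -> nat), (1 <= m)%N ->
  (\sum_(e : V * V | E e.1 e.2) k e)%N = m -> (\sum_(e : V * V | E e.1 e.2) l e)%N = m ->
  comparable_seq (fun n => \prod_(e : V * V | E e.1 e.2) q n e.1 e.2 ^+ k e)
                 (fun n => \prod_(e : V * V | E e.1 e.2) q n e.1 e.2 ^+ l e).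

Let q_ge0 n x y : 0 <= q n x y.
Proof. by have [/(q_edge n)/ltW//|/(q_nonedge n) ->] := boolP (E x y). Qed.

Let pi_gt0 n x : 0 < pi n x.
Proof. exact: (stationary_gt0 (q_ge0 n) (q_irr n) (pi_stat n)). Qed.

Context (I : finType) (S : {set I}) (w : I -> {set V}) (m : I -> V -> R).
Hypothesis ok : wells_ok pi S w m.

Lemma well_rate_ratio0 i j : i \in S -> j \in S -> i != j ->
  ratio0 E q 1 (fun n => well_rate q pi S w n i j).
Proof.
move=> iS jS ij.
(* The stationary weights are rearranged so that only their ratios occur, since it is these that are
   quotients of homogeneous sums of the rates. *)
apply: (@eq_ratio0 _ _ _ _ _ (fun n => \sum_(x in w i)
    (\sum_(y in w i) pi n y / pi n x)^-1 * \sum_(y in w j) trace (q n) (dom S w) x y)).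
  move=> n; rewrite /well_rate mulr_sumr; apply: eq_bigr => x xi.
  rewrite mulrA; congr (_ * _).
    by rewrite -mulr_suml invfM invrK.
  rewrite /potential generator_harm_set//; first exact: (dom_ne ok).
  by apply/fintype.subsetP => y; exact: mem_dom.
apply: (ratio0_sum q_edge) => x xi.
rewrite (_ : 1%N = (0 + 1)%N)//; apply: ratio0M => //.
  right; apply: (@eq_ratio _ _ _ _ _ (fun n => 1 / \sum_(y in w i) pi n y / pi n x)).
    by move=> n; rewrite div1r.
  apply: (@ratio_div _ _ _ _ 0 0); first exact: ratio1.
  apply: (@ratio_pos _ _ _ _ 0); last first.
    move=> n; rewrite (bigD1 x)//= ltr_pwDl ?divr_gt0//.
    by apply: sumr_ge0 => y _; rewrite divr_ge0// ltW.
  apply: (ratio0_sum q_edge) => // y yi; right.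
  exact: (stationary_ratio_class q_edge q_nonedge q_irr y x pi_stat).
apply: (ratio0_sum q_edge) => // y yj; apply: (trace_ratio0 q_edge q_nonedge q_irr).
- exact: mem_dom xi.
- exact: mem_dom yj.
- by apply: contraNneq ij => xy; apply/eqP; apply: (well_disj ok iS jS xi); rewrite xy.
Qed.

Lemma well_rate_fraction_cvg i j : i \in S -> j \in S -> i != j ->
  cvgn (fun n => (exit_rate q pi S w n)^-1 * well_rate q pi S w n i j).
Proof.
move=> iS jS ij.
pose rest n := \sum_(k in S | k != i) \sum_(l in S | l != k) well_rate q pi S w n k l +
  \sum_(l in S | (l != i) && (l != j)) well_rate q pi S w n i l.
rewrite (_ : (fun n => _) = fun n => well_rate q pi S w n i j /
    (well_rate q pi S w n i j + rest n)).
  apply: (ratio0_fraction q_edge q_comparable (d := 1)) => //.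
    exact: well_rate_ratio0.
  apply: (ratio0D q_edge) => //.
    apply: (ratio0_sum q_edge) => k /andP[kS _]; apply: (ratio0_sum q_edge) => l /andP[lS lk].
    by apply: well_rate_ratio0; rewrite // eq_sym.
  apply: (ratio0_sum q_edge) => l /and3P[lS li _].
  by apply: well_rate_ratio0; rewrite // eq_sym.
apply/funext => n; rewrite mulrC; congr (_ / _).
rewrite /exit_rate (bigD1 i)//= (bigD1 j)/=; last by rewrite jS eq_sym.
rewrite /rest -addrA; congr (_ + _); rewrite addrC; congr (_ + _).
by apply: eq_bigl => l; rewrite andbA.
Qed.

End WellRatios.

(** * Counting closed classes *)

Section ClassCount.
Context (R : realType) (T : finType) (r : T -> T -> R) (D : {set T}).
Hypothesis r_ge0 : forall x y, 0 <= r x y.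

Lemma card_classes_le : (#|closed_classes r D| <= #|D|)%N.
Proof.
have [->|[x0 _]] := set_0Vmem D.
  rewrite cards0 leqn0 cards_eq0; apply/eqP/setP => C; rewrite !inE.
  by apply/negbTE/negP => /andP[]; rewrite finset.subset0 => /eqP -> /closed_irreducibleP[/eqP].
pose f (C : {set T}) := odflt x0 [pick x in C].
have fP C : C \in closed_classes r D -> f C \in C.
  rewrite inE => /andP[_ /closed_irreducibleP[/set0Pn[x xC] _ _]].
  by rewrite /f; case: pickP => //= /(_ x); rewrite xC.
rewrite -(card_in_imset (f := f)).
  apply: subset_leq_card; apply/fintype.subsetP => _ /imsetP[C CC ->].
  by move: (CC); rewrite inE => /andP[/fintype.subsetP CD _]; apply/CD/fP.
move=> C C' CC CC' fCC'; have := fP C CC; have := fP C' CC'; rewrite -fCC'.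
move: CC CC'; rewrite !inE => /andP[_ Ci] /andP[_ C'i] xC' xC.
exact: (class_eq Ci C'i xC xC').
Qed.

(** Each class gets a representative, with [i] preferred. If [i] is recurrent then [j] is in its
    class and is not chosen; otherwise [i] itself is not chosen. *)
Lemma card_classes_lt i j : i \in D -> j \in D -> i != j -> 0 < r i j ->
  (#|closed_classes r D| < #|D|)%N.
Proof.
move=> iD jD ij rij.
pose f (C : {set T}) := if i \in C then i else odflt i [pick x in C].
have fP C : C \in closed_classes r D -> f C \in C.
  rewrite inE => /andP[_ /closed_irreducibleP[/set0Pn[x xC] _ _]].
  by rewrite /f; case: ifP => // _; case: pickP => //= /(_ x); rewrite xC.
have eqC C C' x : C \in closed_classes r D -> C' \in closed_classes r D ->
    x \in C -> x \in C' -> C = C'.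
  by rewrite !inE => /andP[_ Ci] /andP[_ C'i]; exact: (class_eq Ci C'i).
rewrite -(card_in_imset (f := f)); last first.
  move=> C C' CC CC' fCC'; apply: (eqC _ _ (f C)) => //; first exact: fP.
  by rewrite fCC' fP.
have sub : f @: closed_classes r D \subset D.
  apply/fintype.subsetP => _ /imsetP[C CC ->].
  by move: (CC); rewrite inE => /andP[/fintype.subsetP CD _]; apply/CD/fP.
apply: proper_card; apply/properP; split=> //.
have [[C [CC iC]]|noC] := pselect (exists C, C \in closed_classes r D /\ i \in C).
  exists j => //; apply/negP => /imsetP[C' C'C jf].
  have jC' : j \in C' by rewrite jf fP.
  have jC : j \in C.
    by move: CC; rewrite inE => /andP[_ /closed_irreducibleP[_ Cc _]]; exact: Cc iC rij.
  have CC' := eqC _ _ _ CC C'C jC jC'; move/eqP: ij; apply.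
  by rewrite jf /f -CC' iC.
exists i => //; apply/negP => /imsetP[C CC fi]; apply: noC; exists C; split=> //.
by rewrite fi fP.
Qed.

End ClassCount.

(** * The single remaining well *)

Section FinalLevel.
Context (R : realType) (V : finType) (q : nat -> V -> V -> R) (pi : nat -> V -> R).
Hypothesis q_ge0 : forall n x y, 0 <= q n x y.
Hypothesis q_irr : forall n, irreducible (q n).
Hypothesis pi_stat : forall n, stationary (q n) [set: V]%SET (pi n).
Context (I : finType) (i : I) (w : I -> {set V}).
Context (a : V -> I -> R) (m : I -> V -> R) (tm : nat -> R).
Hypothesis pl : prelevel q pi [set i]%SET w a m tm.

Lemma exit_rate_singleton n : exit_rate q pi [set i]%SET w n = 0.
Proof.
rewrite /exit_rate big_set1 big1// => j /andP[]; rewrite inE => /eqP ->.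
by rewrite eqxx.
Qed.

Lemma stationary_cvg y : pi n y @[n --> \oo] --> m i y.
Proof.
(* A time much longer than [tm]; there is no upper constraint, as a single well has exit rate 0. At
   such times the law from every point is close to [m i], and averaging over [pi n] keeps [pi n]. *)
pose d n := n.+1%:R * (tm n + 1).
have tm1 n : 0 < tm n + 1 by rewrite ltr_wpDl// (pl_tm pl).
have d0 n : 0 < d n by rewrite mulr_gt0.
have tmd : tm n / d n @[n --> \oo] --> 0.
  apply: (@cvg_dist_bound _ _ (fun n => n.+1%:R^-1)); last exact: cvg_harmonic.
  move=> n; rewrite subr0 ger0_norm; last by rewrite divr_ge0 ?(pl_tm pl)// ltW.
  rewrite ler_pdivrMr// /d mulrA mulVf ?mul1r ?lerDl//.
have dex : d n * exit_rate q pi [set i]%SET w n @[n --> \oo] --> 0.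
  rewrite (_ : (fun n => _) = fun=> 0); first exact: cvg_cst.
  by apply/funext => n; rewrite exit_rate_singleton mulr0.
have iS : i \in [set i]%SET by rewrite inE.
have fast x z : transition (q n) (d n) x z @[n --> \oo] --> a x i * m i z.
  by have := pl_fast pl d0 tmd dex (x := x) (y := z); rewrite big_set1.
have a1 x : a x i = 1.
  rewrite -[LHS]mulr1 -[X in _ * X = _](well_sum1 (pl_ok pl) iS) mulr_sumr.
  apply: (@cvg_unique _ _ (\sum_z transition (q n) (d n) x z @[n --> \oo])) => //.
    apply: cvg_bigsum => z _; exact: (fast x z).
  rewrite (_ : (fun n => _) = fun=> 1); first exact: cvg_cst.
  by apply/funext => n; rewrite transition_sum1.
rewrite (_ : (fun n => _) = fun n =>
   \sum_x pi n x * (transition (q n) (d n) x y - m i y) + m i y).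
  rewrite -[X in _ --> X]add0r; apply: cvgD; last exact: cvg_cst.
  apply: cvg0_sum => x _; apply: (cvg0_bounded_mul (B := 1)).
    move=> n; have [pi0 _ pi1 _] := pi_stat n.
    rewrite ger0_norm// -pi1 (bigD1 x)//= lerDl; exact: sumr_ge0.
  rewrite -[X in _ --> X](subrr (m i y)); apply: cvgB; last exact: cvg_cst.
  by have := fast x y; rewrite a1 mul1r.
apply/funext => n; have [_ _ pi1 piP] := pi_stat n.
under eq_bigr do rewrite mulrBr.
by rewrite sumrB -mulr_suml pi1 mul1r piP ?subrK// ltW.
Qed.

End FinalLevel.

(** If it vanished, a potential would be harmonic everywhere, and the maximum principle with the
    boundary reduced to another well would make it nonpositive on its own well. *)
Lemma exit_rate_gt0 (R : realType) (V : finType) (q : nat -> V -> V -> R) (pi : nat -> V -> R)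
    (q_ge0 : forall n x y, 0 <= q n x y) (q_irr : forall n, irreducible (q n))
    (pi_stat : forall n, stationary (q n) [set: V]%SET (pi n))
    (I : finType) (S : {set I}) (w : I -> {set V}) (m : I -> V -> R) n :
  wells_ok pi S w m -> (1 < #|S|)%N -> 0 < exit_rate q pi S w n.
Proof.
move=> ok /card_gt1P[i [j [iS jS ij]]].
rewrite lt_neqAle (exit_rate_ge0 q_ge0 q_irr pi_stat ok) andbT; apply/negP => /eqP e0.
have [K _ hK] := generator_potential_bound q_ge0 q_irr pi_stat ok.
have L0 x : generator (q n) (potential q S w n j) x = 0.
  by apply/eqP; rewrite -normr_le0 (le_trans (hK n j x jS))// -e0 mulr0.
have /set0Pn[x xj] := well_ne ok jS.
have p0 y : y \in w i -> potential q S w n j y <= 0.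
  by move=> yi; rewrite (potential_well q_ge0 q_irr ok n iS jS yi) (negbTE ij).
have Lge y : y \notin w i -> 0 <= generator (q n) (potential q S w n j) y by rewrite L0.
have /= := max_principle (q_ge0 n) (q_irr n) (well_ne ok iS) Lge p0 x.
by rewrite (potential_well q_ge0 q_irr ok n jS jS xj) eqxx ler10.
Qed.

(** * The hierarchy of levels *)

Lemma eq_prelevel (R : realType) (V : finType) (q : nat -> V -> V -> R) (pi : nat -> V -> R)
    (I : finType) (S : {set I}) (w : I -> {set V}) (a a' : V -> I -> R) (m m' : I -> V -> R)
    (tm : nat -> R) :
  (forall x i, i \in S -> a x i = a' x i) -> (forall i x, i \in S -> m i x = m' i x) ->
  prelevel q pi S w a m tm -> prelevel q pi S w a' m' tm.
Proof.
move=> aa mm [[S0 w0 wD m0 m1 ms mu] tm0 sep fast]; split=> //.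
- split=> //.
  + by move=> i x iS xi; rewrite -mm// m0.
  + by move=> i x iS xi; rewrite -mm// m1.
  + by move=> i iS; rewrite -(ms i iS); apply: eq_bigr => x _; rewrite mm.
  + by move=> i x iS xi; rewrite -mm//; exact: mu.
move=> d d0 td de x y; rewrite (eq_bigr (fun i => a x i * m i y)); first exact: fast.
by move=> i iS; rewrite aa// mm.
Qed.

Section Hierarchy.
Context (R : realType) (V : finType) (E : rel V) (X : nat -> markov_chain R V).
Hypothesis E_irreflexive : irreflexive E.
Hypothesis rate_edge : forall n x y, E x y -> 0 < rate (X n) x y.
Hypothesis rate_nonedge : forall n x y, ~~ E x y -> rate (X n) x y = 0.
Hypothesis X_irreducible : forall n, irreducible (rate (X n)).
Hypothesis rate_cvg : forall x y, E x y -> cvgn (fun n => rate (X n) x y).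
Hypothesis limit_rate_nontrivial : exists x y, E x y /\ 0 < limit_rate X x y.
Hypothesis X_comparability : comparability X E.

Local Notation q := (fun n => rate (X n)).
Local Notation pi := (fun n => inv_measure (X n)).
Implicit Types (S : {set {set V}}).

Let q_ge0 n x y : 0 <= rate (X n) x y.
Proof. by have [/(rate_edge n)/ltW//|/(rate_nonedge n) ->] := boolP (E x y). Qed.

Let q_diag n x : rate (X n) x x = 0.
Proof. by rewrite rate_nonedge// E_irreflexive. Qed.

Let q_jumps n x : 0 < holding_rate (X n) x.
Proof.
have [u [v [Euv _]]] := limit_rate_nontrivial.
have [y yx] : exists y, y != x.
  have [ux|] := eqVneq u x; last by exists u.
  by exists v; apply: contraTneq Euv => ->; rewrite ux E_irreflexive.
have /connectP[[/= _ yE|z s /= /andP[xz _] _]] := X_irreducible n x y.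
  by move: yx; rewrite yE eqxx.
rewrite /holding_rate (bigD1 z)//= ltr_pwDl// sumr_ge0// => t _; exact: q_ge0.
Qed.

Let pi_stat n : stationary (rate (X n)) [set: V]%SET (inv_measure (X n)).
Proof.
apply: stationary_measureP => //; apply/closed_irreducibleP; split.
- by have [u _] := limit_rate_nontrivial; apply/set0Pn; exists u; rewrite inE.
- by move=> x y; rewrite !inE.
- by move=> x y _ _; exact: X_irreducible.
Qed.

Lemma limit_rate_cvg x y : rate (X n) x y @[n --> \oo] --> limit_rate X x y.
Proof.
have [/rate_cvg//|Exy] := boolP (E x y).
rewrite /limit_rate (_ : (fun n => _) = fun=> 0); last first.
  by apply/funext => n; rewrite rate_nonedge.
by rewrite lim_cst//; exact: cvg_cst.
Qed.

Lemma limit_rate_ge0 x y : 0 <= limit_rate X x y.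
Proof. apply: (cvgr_to_ge (limit_rate_cvg (x := x) (y := y))); exact: nearW. Qed.

Section Scale.
Context (S : {set {set V}}) (m : {set V} -> V -> R).
Hypothesis ok : wells_ok pi S id m.

Let wtrace n i x : i \in S -> generator (rate (X n)) (potential q S id n i) x =
  \sum_(y in i) trace (rate (X n)) (dom S id) x y.
Proof.
move=> iS; rewrite /potential generator_harm_set//; first exact: (dom_ne ok).
by apply/fintype.subsetP => y; exact: mem_dom.
Qed.

Lemma mean_rateE n i j : i \in S -> j \in S -> i != j ->
  mean_rate X S n i j = well_rate q pi S id n i j.
Proof.
move=> iS jS ij; rewrite /mean_rate /well_rate; congr (_ * _).
apply: eq_bigr => x xi; rewrite wtrace//; congr (_ * _); apply: eq_bigr => y yj.
apply: trace_rateE => //; [exact: (mem_dom iS)|exact: (mem_dom jS)|].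
by apply: contraNneq ij => xy; apply/eqP; apply: (well_disj ok iS jS xi); rewrite xy.
Qed.

Hypothesis S1 : (1 < #|S|)%N.

Lemma partition_scaleE n : partition_scale X S n = (exit_rate q pi S id n)^-1.
Proof.
rewrite /partition_scale /exit_rate; congr (_^-1); apply: eq_bigr => i iS.
have [j jS ji] : exists2 j, j \in S & j != i.
  have /card_gt1P[k [l [kS lS kl]]] := S1.
  by have [ki|] := eqVneq k i; [exists l; rewrite // -ki eq_sym|exists k].
rewrite capacityE//; last 2 first.
- move=> x xi; apply/negP => /finset.bigcupP[k]; rewrite !inE => /andP[ki kS] xk.
  by move/eqP: ki; apply; exact: (well_disj ok kS iS xk xi).
- have /set0Pn[y yj] := well_ne ok jS; apply/set0Pn; exists y.
  by apply/finset.bigcupP; exists j; rewrite // !inE ji.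
have -> : (i :|: finset.cover (S :\ i))%SET = dom S id.
  by rewrite /dom (big_setD1 i).
have sub : (S :\ i)%SET \subset S by exact: subD1set.
transitivity (\sum_(j in S | j != i) \sum_(x in i) (mass pi n i)^-1 *
    (inv_measure (X n) x * \sum_(y in j) trace (rate (X n)) (dom S id) x y)); last first.
  apply: eq_bigr => k /andP[kS _]; rewrite /well_rate mulr_sumr.
  by apply: eq_bigr => x _; rewrite wtrace.
rewrite mulrC mulr_sumr exchange_big/=; apply: eq_bigr => x xi.
rewrite -mulr_sumr; congr (_ * _); rewrite -mulr_sumr; congr (_ * _).
rewrite generator_harm_set//; last 2 first.
- exact: (dom_ne ok).
- by rewrite /dom (big_setD1 i)//= finset.subsetUr.
rewrite (sum_unionE ok _ sub); apply: eq_bigl => k.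
by rewrite !inE andbC.
Qed.

Lemma partition_scale_gt0 n : 0 < partition_scale X S n.
Proof.
rewrite partition_scaleE invr_gt0.
exact: (exit_rate_gt0 q_ge0 X_irreducible pi_stat n ok S1).
Qed.

Lemma reduced_rate_off i j : ~~ [&& i \in S, j \in S & i != j] -> reduced_rate X S i j = 0.
Proof. by rewrite /reduced_rate => /negbTE ->. Qed.

Lemma reduced_rate_cvg i j : i \in S -> j \in S -> i != j ->
  partition_scale X S n * well_rate q pi S id n i j @[n --> \oo] --> reduced_rate X S i j.
Proof.
move=> iS jS ij; rewrite /reduced_rate iS jS ij /=.
rewrite (_ : (fun n => partition_scale X S n * mean_rate X S n i j) =
  fun n => (exit_rate q pi S id n)^-1 * well_rate q pi S id n i j); last first.
  by apply/funext => n; rewrite mean_rateE// partition_scaleE.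
rewrite (_ : (fun n => partition_scale X S n * well_rate _ _ _ _ _ _ _) =
  fun n => (exit_rate q pi S id n)^-1 * well_rate q pi S id n i j); last first.
  by apply/funext => n; rewrite partition_scaleE.
exact: (well_rate_fraction_cvg rate_edge rate_nonedge X_irreducible pi_stat X_comparability ok
  iS jS ij).
Qed.

(** The time scale is the inverse of the total rate, so the scaled rates sum to 1 for every [n]. *)
Lemma reduced_rate_nontrivial : exists i j,
  [/\ i \in S, j \in S, i != j & 0 < reduced_rate X S i j].
Proof.
apply: contrapT => none.
have r0 i j : i \in S -> j \in S -> i != j -> reduced_rate X S i j = 0.
  move=> iS jS ij; apply/eqP; rewrite eq_le leNgt; apply/andP; split.
    by apply/negP => rij; apply: none; exists i, j.
  exact: (scaled_rate_ge0 q_ge0 X_irreducible pi_stat ok partition_scale_gt0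
    reduced_rate_off reduced_rate_cvg).
have : \sum_(i in S) \sum_(j in S | j != i)
    partition_scale X S n * well_rate q pi S id n i j @[n --> \oo] --> (0 : R).
  apply: cvg0_sum => i iS; apply: cvg0_sum => j /andP[jS ji].
  by rewrite -(r0 i j) 1?eq_sym//; apply: reduced_rate_cvg; rewrite // eq_sym.
rewrite (_ : (fun n => _) = fun=> 1).
  move=> to0; have /eqP : 1 = 0 :> R; last by rewrite oner_eq0.
  by apply: (@cvg_unique _ _ ((1 : R) @[_ --> \oo])) => //; exact: cvg_cst.
apply/funext => n; under eq_bigr do rewrite -mulr_sumr.
rewrite -mulr_sumr partition_scaleE mulVf// gt_eqF//.
exact: (exit_rate_gt0 q_ge0 X_irreducible pi_stat n ok S1).
Qed.

Lemma card_coarsen_lt : (#|coarsen X S| < #|S|)%N.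
Proof.
have [i [j [iS jS ij rij]]] := reduced_rate_nontrivial.
exact: leq_ltn_trans (leq_imset_card _ _) (card_classes_lt iS jS ij rij).
Qed.

End Scale.

(* The paper's [theta^(p-1)], with [theta^(0) = 1]. *)
Definition previous_scale p : nat -> R :=
  if p is p'.+2 then time_scale X p'.+1 else fun=> 1.

Definition level_state p := prelevel q pi (wells X p) id (absorption X p.-1)
  (level_measure X p) (previous_scale p).

(** The first level is itself an instance of the recursion step, from singletons with [th = 1] and
    reduced rates [limit_rate]; the merged objects then have to be identified with those of
    [wells X 1]. *)
Lemma level_state_one : level_state 1.
Proof.
have [x0 _] := limit_rate_nontrivial.
have r_off i j : ~~ [&& i \in [set: V]%SET, j \in [set: V]%SET & i != j] ->
    limit_rate X i j = 0.
  rewrite !inE /= negbK => /eqP ->; rewrite /limit_rate (_ : (fun n => _) = fun=> 0) ?lim_cst//.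
  by apply/funext => n; rewrite q_diag.
have r_cvg i j : i \in [set: V]%SET -> j \in [set: V]%SET -> i != j ->
    1 * well_rate q pi [set: V]%SET finset.set1 n i j @[n --> \oo] --> limit_rate X i j.
  move=> _ _ ij; rewrite (_ : (fun n => _) = fun n => rate (X n) i j).
    exact: limit_rate_cvg.
  by apply/funext => n; rewrite mul1r (well_rate_singleton q_ge0 X_irreducible pi_stat n ij).
have tm_th : (fun=> 0 : R) n / (fun=> 1 : R) n @[n --> \oo] --> 0.
  by rewrite (_ : (fun n => _) = fun=> 0); [exact: cvg_cst|apply/funext => n; rewrite mul0r].
have := next_prelevel q_ge0 X_irreducible pi_stat
  (level_zero q_ge0 X_irreducible pi_stat x0) (th := fun=> 1) (fun=> ltr01) r_off r_cvg tm_th.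
have -> : merged_wells [set: V]%SET finset.set1 (limit_rate X) = wells X 1.
  rewrite /merged_wells /wells /= -[RHS]imset_id; apply: eq_imset => C.
  apply/setP => x; apply/finset.bigcupP/idP => [[i iC]|xC]; first by rewrite inE => /eqP ->.
  by exists x; rewrite // inE.
have membersE M : submembers [set: V]%SET finset.set1 M = M.
  by apply/setP => x; rewrite !inE finset.sub1set.
apply: eq_prelevel => [x M _|M x].
  rewrite /merged_absorption membersE (bigD1 x)//= eqxx mul1r big1 ?addr0// => z /andP[_ zx].
  by rewrite eq_sym (negbTE zx) mul0r.
rewrite inE /= => /andP[_ Mi]; rewrite /merged_measure membersE.
have [_ supp _ _] := stationary_measureP limit_rate_ge0 Mi.
have [xM|xM] := boolP (x \in M).
  rewrite (bigD1 x)//= eqxx mulr1 big1 ?addr0// => z /andP[_ zx].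
  by rewrite (negbTE zx) mulr0.
rewrite supp// big1// => z zM; have [zx|] := eqVneq z x; last by rewrite mulr0.
by rewrite -zx zM in xM.
Qed.

Lemma previous_scale_cvg p : level_state p -> (1 < #|wells X p|)%N ->
  previous_scale p n / time_scale X p n @[n --> \oo] --> 0.
Proof.
move=> st S1; rewrite (_ : (fun n => _) =
  fun n => previous_scale p n * exit_rate q pi (wells X p) id n); first exact: (pl_sep st).
by apply/funext => n; rewrite /time_scale (partition_scaleE (pl_ok st) S1) invrK.
Qed.

(** For [p] a successor, [coarsen], [members], [absorption] and [level_measure] are convertible to
    the objects of [next_prelevel] with [w = id], so no identification is left. *)
Lemma level_state_next p : (1 <= p)%N -> level_state p -> (1 < #|wells X p|)%N ->
  level_state p.+1.
Proof.
case: p => // p _ st S1; have ok := pl_ok st.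
exact: (next_prelevel q_ge0 X_irreducible pi_stat st (partition_scale_gt0 ok S1)
  (@reduced_rate_off _) (reduced_rate_cvg ok S1) (previous_scale_cvg st S1)).
Qed.

(** The cardinality bound is carried along to show that the search for the depth succeeds: each
    level loses at least one well. *)
Lemma level_state_card p : (forall i, (i < p)%N -> #|wells X i.+1| != 1%N) ->
  level_state p.+1 /\ (#|wells X p.+1| + p <= #|V|)%N.
Proof.
elim: p => [_|p IH pV].
  split; first exact: level_state_one.
  rewrite addn0 -cardsT; exact: card_classes_le.
have [|st cV] := IH; first by move=> i ip; apply: pV; rewrite ltnS ltnW.
have S1 : (1 < #|wells X p.+1|)%N.
  by rewrite ltn_neqAle eq_sym pV//= card_gt0; exact: (wells_ne (pl_ok st)).
split; first exact: level_state_next.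
rewrite addnS -addSn; apply: leq_trans cV; rewrite leq_add2r.
exact: (card_coarsen_lt (pl_ok st) S1).
Qed.

Lemma depthP : [/\ (depth X < #|V|)%N, #|wells X (depth X).+1| = 1%N &
  forall i, (i < depth X)%N -> #|wells X i.+1| != 1%N].
Proof.
pose single := fun p => #|wells X p.+1| == 1%N.
have before i : (i < depth X)%N -> ~~ single i.
  move=> id; have iV : (i < #|V|)%N.
    by apply: leq_trans id _; rewrite -[leqRHS](size_iota 0); exact: find_size.
  by have := before_find 0%N id; rewrite nth_iota// add0n /single => ->.
have hs : has single (iota 0 #|V|).
  (* If the search failed, the cardinality bound would leave no well at level [#|V|.+1]. *)
  apply: contraT => /hasPn none; have [|st] := @level_state_card #|V|.
    by move=> i iV; apply: none; rewrite mem_iota.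
  by have := wells_ne (pl_ok st); rewrite -card_gt0; lia.
have dV : (depth X < #|V|)%N by move: (hs); rewrite has_find size_iota.
split=> //; apply/eqP; have := nth_find 0%N hs.
by rewrite nth_iota.
Qed.

Lemma level_stateP p : (1 <= p <= (depth X).+1)%N -> level_state p.
Proof.
case: p => // p /andP[_ pd]; have [_ _ before] := depthP.
by have [] := level_state_card (fun i (ip : (i < p)%N) => before i (leq_trans ip pd)).
Qed.

Lemma wells_card_gt1 p : (1 <= p <= depth X)%N -> (1 < #|wells X p|)%N.
Proof.
case: p => // p /andP[_ pd]; have [_ _ before] := depthP.
rewrite ltn_neqAle eq_sym before//= card_gt0.
by apply: (wells_ne (pl_ok (level_stateP _))); rewrite /= ltnW.
Qed.

Lemma time_scale_gt0 p n : (1 <= p <= depth X)%N -> 0 < time_scale X p n.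
Proof.
move=> pd; apply: (partition_scale_gt0 _ (wells_card_gt1 pd)).
by apply: (pl_ok (level_stateP _)); case/andP: pd => -> /leqW.
Qed.

Lemma fast_limit p (beta : nat -> R) x y : (1 <= p <= (depth X).+1)%N ->
  (forall n, 0 < beta n) -> prec (theta X p.-1) (EFin \o beta) ->
  prec (EFin \o beta) (theta X p) ->
  ptrans (X n) (beta n) x y @[n --> \oo] -->
    \sum_(j in wells X p) absorption X p.-1 x j * level_measure X p j y.
Proof.
move=> pd beta0 lower upper; have st := level_stateP pd.
rewrite (_ : (fun n => _) = fun n => transition (rate (X n)) (beta n) x y); last first.
  by apply/funext => n; rewrite ptransE// ltW.
apply: (pl_fast st beta0).
  apply/(prec_EFinP _ beta0); move: lower pd; case: p {upper st} => // -[|p]//= + pd.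
  by rewrite /theta /= -ltnS pd.
move: upper; rewrite /theta; case: eqP => [p0|_]; first by rewrite p0 in pd.
case/andP: pd => p1 pd'; case: leqP => [pd|dp _].
  have pd1 : (1 <= p <= depth X)%N by rewrite p1.
  move=> /(prec_EFinP _ (fun n => time_scale_gt0 n pd1)).
  rewrite (_ : (fun n => _) = fun n => beta n * exit_rate q pi (wells X p) id n)//.
  by apply/funext => n; rewrite /time_scale (partition_scaleE (pl_ok st) (wells_card_gt1 pd1)) invrK.
(* At the last level [theta] is infinite and bounds nothing; correspondingly the exit rate of the
   single well is 0. *)
have -> : p = (depth X).+1 by apply/eqP; rewrite eqn_leq pd'.
have [_ /eqP/cards1P[M ->] _] := depthP.
rewrite (_ : (fun n => _) = fun=> 0); first exact: cvg_cst.
by apply/funext => n; rewrite exit_rate_singleton mulr0.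
Qed.

Lemma slow_limit p t x y : (1 <= p <= depth X)%N -> 0 < t ->
  ptrans (X n) (t * time_scale X p n) x y @[n --> \oo] -->
    \sum_(j in wells X p) level_weight X p t x j * level_measure X p j y.
Proof.
move=> pd t0; have S1 := wells_card_gt1 pd.
have st : level_state p by apply: level_stateP; case/andP: pd => -> /leqW.
rewrite (_ : (fun n => _) = fun n =>
  transition (rate (X n)) (t * time_scale X p n) x y); last first.
  by apply/funext => n; rewrite ptransE// mulr_ge0// ltW// time_scale_gt0.
exact: (level_limit q_ge0 X_irreducible pi_stat st (partition_scale_gt0 (pl_ok st) S1)
  (@reduced_rate_off _) (reduced_rate_cvg (pl_ok st) S1) (previous_scale_cvg st S1)).
Qed.

Lemma lim_slow p t x y : (1 <= p <= depth X)%N -> 0 < t ->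
  limn (fun n => ptrans (X n) (t * time_scale X p n) x y) =
    \sum_(j in wells X p) level_weight X p t x j * level_measure X p j y.
Proof. by move=> pd t0; apply/cvg_lim => //; exact: slow_limit. Qed.

Lemma slow_limit_at0 p x y : (1 <= p <= depth X)%N ->
  limn (fun n => ptrans (X n) (t * time_scale X p n) x y) @[t --> 0^'+] -->
    \sum_(j in wells X p) absorption X p.-1 x j * level_measure X p j y.
Proof.
move=> pd; apply: cvg_trans.
  apply: (near_eq_cvg (f := fun t =>
    \sum_(j in wells X p) level_weight X p t x j * level_measure X p j y)).
  by apply: filterS (nbhs_right_gt (0 : R)) => t t0; rewrite lim_slow.
apply: cvg_bigsum => j jS; apply: cvgMl => //.
rewrite (_ : absorption X p.-1 x j = \sum_(k in wells X p) absorption X p.-1 x k *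
    transition (reduced_rate X (wells X p)) 0 k j).
  apply: cvg_bigsum => k kS; apply: cvgMr => //; apply: cvg_at_right_filter.
  exact: (is_derive_continuous (is_derive_transition _ _ _)).
rewrite (bigD1 j)//= transition0 eqxx mulr1 big1 ?addr0// => k /andP[_ kj].
by rewrite transition0 (negbTE kj) mulr0.
Qed.

Lemma slow_limit_at_infty p x y : (1 <= p <= depth X)%N ->
  limn (fun n => ptrans (X n) (t * time_scale X p n) x y) @[t --> +oo] -->
    \sum_(m in wells X p.+1) absorption X p x m * level_measure X p.+1 m y.
Proof.
move=> pd; have S1 := wells_card_gt1 pd.
have st : level_state p by apply: level_stateP; case/andP: pd => -> /leqW.
apply: cvg_trans.
  apply: (near_eq_cvg (f := fun t =>
    \sum_(j in wells X p) level_weight X p t x j * level_measure X p j y)).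
  by apply: filterS (nbhs_pinfty_gt (num_real 0)) => t t0; rewrite lim_slow.
move: pd st S1; case: p => // p pd st S1.
exact: (level_limit_cvg q_ge0 X_irreducible pi_stat st (partition_scale_gt0 (pl_ok st) S1)
  (@reduced_rate_off _) (reduced_rate_cvg (pl_ok st) S1)).
Qed.

Lemma last_level : exists M (a : V -> {set V} -> R) tm,
  wells X (depth X).+1 = [set M]%SET /\
  prelevel q pi [set M]%SET id a (level_measure X (depth X).+1) tm.
Proof.
have [_ /eqP/cards1P[M WM] _] := depthP; exists M; do 2 eexists; split=> //.
by rewrite -WM; apply: level_stateP; rewrite /= ltnSn.
Qed.

Lemma leftover_mass_cvg : inv_mass (X n) (leftover X (depth X).+1) @[n --> \oo] --> (0 : R).
Proof.
have [M [a [tm [WM st]]]] := last_level; have ok := pl_ok st.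
apply: cvg0_sum => x; rewrite /leftover WM inE => xM.
rewrite -(well_supp (i := M) (x := x) ok); first exact: (stationary_cvg pi_stat st).
  by rewrite inE.
by apply: contra xM => xM; apply/finset.bigcupP; exists M; rewrite ?inE.
Qed.

Lemma inv_measure_cvg x : x \in finset.cover (wells X (depth X).+1) ->
  cvgn (fun n => inv_measure (X n) x) /\ 0 < limn (fun n => inv_measure (X n) x) <= 1.
Proof.
have [M [a [tm [WM st]]]] := last_level; have ok := pl_ok st.
rewrite WM => /finset.bigcupP[_ /set1P-> xM].
have MS : M \in [set M]%SET by rewrite inE.
have lim_x : inv_measure (X n) x @[n --> \oo] --> level_measure X (depth X).+1 M x.
  exact: (stationary_cvg pi_stat st).
split; first by apply/cvg_ex; eexists; exact: lim_x.
rewrite (cvg_lim _ lim_x)// (well_pos ok MS xM)/= -(well_sum1 ok MS) (bigD1 x)//= lerDl.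
by apply: sumr_ge0 => z _; exact: (well_ge0 ok).
Qed.

End Hierarchy.

Theorem theorem3p1 (R : realType) (V : finType) (E : rel V)
    (X : nat -> markov_chain R V)
    (E_irreflexive : irreflexive E)
    (rate_edge : forall n x y, E x y -> 0 < rate (X n) x y)
    (rate_nonedge : forall n x y, ~~ E x y -> rate (X n) x y = 0)
    (X_irreducible : forall n, irreducible (rate (X n)))
    (rate_cvg : forall x y, E x y -> cvgn (fun n => rate (X n) x y))
    (limit_rate_nontrivial : exists x y, E x y /\ 0 < limit_rate X x y)
    (X_comparability : comparability X E) :
  (* (a) *)
  (forall (p : nat) (beta : nat -> R) (x y : V),
      (1 <= p <= (depth X).+1)%N ->
      (forall n, 0 < beta n) ->
      prec (theta X p.-1) (EFin \o beta) ->
      prec (EFin \o beta) (theta X p) ->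
      ptrans (X n) (beta n) x y @[n --> \oo] -->
        \sum_(j in wells X p) absorption X p.-1 x j * level_measure X p j y) /\
  (* (b) *)
  (forall (p : nat) (t : R) (x y : V),
      (1 <= p <= depth X)%N -> 0 < t ->
      ptrans (X n) (t * time_scale X p n) x y @[n --> \oo] -->
        \sum_(j in wells X p) level_weight X p t x j * level_measure X p j y) /\
  (* (c) *)
  (forall (p : nat) (x y : V),
      (1 <= p <= depth X)%N ->
      limn (fun n => ptrans (X n) (t * time_scale X p n) x y) @[t --> 0^'+] -->
        \sum_(j in wells X p) absorption X p.-1 x j * level_measure X p j y) /\
  (* (d) *)
  (forall (p : nat) (x y : V),
      (1 <= p <= depth X)%N ->
      limn (fun n => ptrans (X n) (t * time_scale X p n) x y) @[t --> +oo] -->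
        \sum_(m in wells X p.+1) absorption X p x m * level_measure X p.+1 m y) /\
  inv_mass (X n) (leftover X (depth X).+1) @[n --> \oo] --> (0 : R) /\
  (forall x : V, x \in finset.cover (wells X (depth X).+1) ->
      cvgn (fun n => inv_measure (X n) x) /\
      0 < limn (fun n => inv_measure (X n) x) <= 1).
Proof.
split; first by move=> p beta x y; exact: fast_limit.
split; first by move=> p t x y; exact: slow_limit.
split; first by move=> p x y; exact: slow_limit_at0.
split; first by move=> p x y; exact: slow_limit_at_infty.
by split=> [|x]; [exact: leftover_mass_cvg|exact: inv_measure_cvg].
Qed.
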